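(* (Dual least squares method.) Let $\Omega\subseteq\mathbb{R}^2$ be a bounded simply connected domain with analytic boundary and regular analytic parametrization $\gamma$, and let $S_0$ be the modified Symm integral operator on $L^2(0,2\pi)$ associated with $\gamma$, with $L^2$-adjoint $S_0^*$. Let $r\ge0$. There exists $c>0$ such that the following holds. Let $g\in H^{r+1}(0,2\pi)$, let $\Psi^\dagger\in H^r(0,2\pi)$ be the unique solution of $S_0\Psi^\dagger=g$, let $\delta\ge0$, let $g^\delta\in L^2(0,2\pi)$ satisfy $\|g^\delta-g\|_{L^2}\le\delta$, and let $n\ge1$ and $X_n=\mathrm{span}\{e^{ikt}\}_{k=-n}^{n}$. Let $\Psi_n^\delta=S_0^*\tilde\psi_n^\delta$, with $\tilde\psi_n^\delta\in X_n$, be the dual least squares solution, that is, $\tilde\psi_n^\delta$ solves $$(S_0^*\tilde\psi_n^\delta,S_0^*\psi_n)=(g^\delta,\psi_n)\quad\text{for all }\psi_n\in X_n.$$ Then $$\|\Psi^\dagger-\Psi_n^\delta\|_{L^2}\le c\Big(n\delta+\min\{\|\Psi^\dagger-z_n\|_{L^2}:z_n\in S_0^*(X_n)\}\Big).$$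
   Context: The boundary has a regular analytic parametrization $\partial\Omega=\{\gamma(t):t\in[0,2\pi)\}$, where $\gamma:\mathbb{R}\to\mathbb{R}^2$ is real-analytic, $2\pi$-periodic, injective on $[0,2\pi)$, and $|\gamma'(t)|>0$ for all $t$. $|\partial\Omega|$ denotes the length of $\partial\Omega$. The modified Symm integral operator is $$(S_0\Psi)(t)=\int_0^{2\pi}G(t,s)\Psi(s)\,ds,\quad t\in[0,2\pi),$$ $$G(t,s)=-\frac{1}{2\pi}\ln|\gamma(t)-\gamma(s)|+\frac{1}{2\pi}\frac{1}{|\partial\Omega|}\int_0^{2\pi}\ln|\gamma(t)-\gamma(\sigma)|\,|\gamma'(\sigma)|\,d\sigma+\frac{1}{|\partial\Omega|}.$$ $H^r(0,2\pi)$ is the $2\pi$-periodic (complex-valued) Sobolev space of order $r$, with norm $\|x\|_{H^r}^2=\sum_{k\in\mathbb{Z}}(1+k^2)^r|a_k|^2$ in terms of the Fourier coefficients $a_k$ of $x$; $(\cdot,\cdot)$ is the inner product of $L^2(0,2\pi)$. *)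

(* Defs.v *)
From HB Require Import structures.
From mathcomp Require Export all_boot all_order all_algebra.
From mathcomp Require Export complex.
From mathcomp Require Export all_classical all_reals all_analysis.

Export Order.TTheory GRing.Theory Num.Theory.
Export numFieldNormedType.Exports.

Set Implicit Arguments.
Unset Strict Implicit.
Unset Printing Implicit Defensive.

#[global] Open Scope classical_set_scope.
#[global] Open Scope ring_scope.
#[global] Open Scope complex_scope.

Section plane.
Context {R : realType}.

(* The norm that the library puts on R * R is the max norm. *)
Definition euclid_norm (v : R * R) : R := Num.sqrt (v.1 ^+ 2 + v.2 ^+ 2).

Definition boundary (A : set (R * R)) : set (R * R) :=
  closure A `\` interior A.

Definition domain (A : set (R * R)) : Prop :=
  [/\ open A, connected A & A !=set0].

(* Every loop f in A is contractible in A relative to its base point f 0. *)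
Definition simply_connected (A : set (R * R)) : Prop :=
  forall f : R -> R * R,
    {within `[0, 1]%classic, continuous f} ->
    (forall s : R, 0 <= s <= 1 -> A (f s)) -> f 0 = f 1 ->
  exists H : R * R -> R * R,
    [/\ {within `[0, 1]%classic `*` `[0, 1]%classic, continuous H},
        (forall s u : R, 0 <= s <= 1 -> 0 <= u <= 1 -> A (H (s, u))),
        (forall s : R, 0 <= s <= 1 -> H (s, 0) = f s /\ H (s, 1) = f 0) &
        (forall u : R, 0 <= u <= 1 -> H (0, u) = f 0 /\ H (1, u) = f 0)].

Definition real_analytic (f : R -> R) : Prop :=
  forall t0 : R, exists (a : nat -> R) (e : R),
    0 < e /\ forall t, `|t - t0| < e -> pseries a (t - t0) @ \oo --> f t.

Definition speed (gamma : R -> R * R) (t : R) : R :=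
  euclid_norm (derive1 (fst \o gamma) t, derive1 (snd \o gamma) t).

Definition regular_analytic_curve (gamma : R -> R * R) : Prop :=
  [/\ real_analytic (fst \o gamma) /\ real_analytic (snd \o gamma),
      periodic gamma (2 * pi),
      {in `[0, 2 * pi[ &, injective gamma} &
      forall t, 0 < speed gamma t].

End plane.

Section L2.
Context {R : realType}.
Local Notation mu := (@lebesgue_measure R).
Local Notation D := (`[0, 2 * pi[%classic : set R).

Definition Cintegral (f : R -> R[i]) : R[i] :=
  (\int[mu]_(t in D) complex.Re (f t)) +i* (\int[mu]_(t in D) complex.Im (f t)).

(* Elements of L^2(0, 2 pi) are represented by functions on R, of which only
   the values on [0, 2 pi) matter, equality being [eqL2]. *)
Definition inL2 (f : R -> R[i]) : Prop :=
  [/\ measurable_fun D (fun t => complex.Re (f t)),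
      measurable_fun D (fun t => complex.Im (f t)) &
      (\int[mu]_(t in D) (Normc.normc (f t) ^+ 2)%:E < +oo)%E].

Definition eqL2 (f g : R -> R[i]) : Prop := ae_eq mu D f g.

Definition dotL2 (f g : R -> R[i]) : R[i] :=
  Cintegral (fun t => f t * (g t)^*).

Definition normL2 (f : R -> R[i]) : R :=
  Num.sqrt (\int[mu]_(t in D) (Normc.normc (f t) ^+ 2)).

(* T represents the Hilbert space adjoint of S; it is unique up to [eqL2]. *)
Definition adjointL2 (S T : (R -> R[i]) -> (R -> R[i])) : Prop :=
  forall y, inL2 y -> inL2 (T y) /\
    forall x, inL2 x -> dotL2 (S x) y = dotL2 x (T y).

(* t |-> e^(i k t) *)
Definition expik (k : int) (t : R) : R[i] :=
  cos (k%:~R * t) +i* sin (k%:~R * t).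

Definition fourier (f : R -> R[i]) (k : int) : R[i] :=
  ((2 * pi)^-1)%:C * Cintegral (fun t => f t * expik (- k) t).

(* H^r(0, 2 pi) for r >= 0, where it is a subspace of L^2(0, 2 pi) *)
Definition sobolev (r : R) (f : R -> R[i]) : Prop :=
  inL2 f /\
  (\esum_(k in [set: int])
     ((1 + k%:~R ^+ 2) `^ r * Normc.normc (fourier f k) ^+ 2)%:E < +oo)%E.

(* The span of e^(i k t) for -n <= k <= n; the index j stands for k = j - n. *)
Definition trig_poly (n : nat) : set (R -> R[i]) :=
  [set f | exists a : 'I_(n.*2.+1) -> R[i],
     f = fun t => \sum_(j < n.*2.+1) a j * expik (j%:Z - n%:Z) t].

End L2.

Section Symm.
Context {R : realType}.
Variable gamma : R -> R * R.
Local Notation mu := (@lebesgue_measure R).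
Local Notation D := (`[0, 2 * pi[%classic : set R).

Definition curve_length : R := \int[mu]_(s in D) speed gamma s.

(* [ln 0 = 0] in the library, which only affects the diagonal, a null set. *)
Definition symm_kernel (t s : R) : R :=
  - (2 * pi)^-1 * ln (euclid_norm (gamma t - gamma s))
  + (2 * pi)^-1 * curve_length^-1
    * (\int[mu]_(u in D) (ln (euclid_norm (gamma t - gamma u)) * speed gamma u))
  + curve_length^-1.

Definition symm_op (Psi : R -> R[i]) (t : R) : R[i] :=
  Cintegral (fun s => (symm_kernel t s)%:C * Psi s).

End Symm.

Definition is_min {R : realType} (A : set R) (m : R) : Prop := A m /\ lbound A m.

(* Main.v *)
Require Import Defs.
From mathcomp Require Import ring lra zify archimedean measurable_realfun.

Set Implicit Arguments.
Unset Strict Implicit.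
Unset Printing Implicit Defensive.

(** Why the theorem holds. Write S for the operator. Everything rests on a
    stability estimate ([symm_op_stable]): if w is a trigonometric polynomial
    of degree at most n, n >= 1, and (f, h) = (S f, w) for all square-integrable
    f, that is h = S^* w, then |w| <= C n |h|. It implies that the Gram matrix of
    the S^* e_k is invertible ([gram_unit]), so that Psi has a best approximation
    z0 = S^* phi ([best_approximation]). For h = S^* psi - z0 and w = psi - phi the
    two Galerkin equations give |h|^2 = Re (gdelta - g, w) <= delta |w|, hence
    |h| <= C n delta, and |Psi - S^* psi| <= |Psi - z0| + |h|
    ([dual_least_squares_error]).

    The kernel of S is real, so stability need only be proved for real functions
    ([stability_real]). Let w = c + sum_p a_p trig_p and W = sum_p a_p^2. As S maps
    the speed of the parametrization to 1, testing with it bounds c by |h|. On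
    functions of frequency k, S is division by 2k up to an error of order 1/k^2
    ([symm_real_trig]): the logarithm of the chord length of the curve differs
    from that of the unit circle, whose Fourier coefficients are explicit
    ([log_circle_fourier]), by a function with two bounded derivatives
    ([log_chord_fourier]). Testing with trig_p therefore bounds the coefficients of
    frequency above N: their squares sum to at most C (n^2 |h|^2 + W / N).

    The low frequencies are controlled by positivity of the logarithmic energy on
    functions of mean zero, in a quantitative form. With weight = 1 + |gamma|^2,
    the kernel q(t,s) = 1 - |gamma(t) - gamma(s)|^2 / (weight(t) weight(s)) has values in
    [0, 1] and is positive semidefinite, as are its powers, and
    - ln |gamma(t) - gamma(s)|^2 = sum_(m >= 1) q^m / m - ln weight(t) - ln weight(s).
    So the logarithmic energy of a function of mean zero is at least 1/m times its
    q^m-energy, for every m ([energy_le_pot]). Now q^m concentrates near the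
    diagonal, where its integral over s is of order 1 / sqrt m; thus its energy is
    comparable to the square norm divided by sqrt m, up to an error that involves
    the Lipschitz constant and is of lower order for the low frequencies
    ([energy_tpoly_lower]). Choosing N, and then m in terms of N, absorbs all
    error terms ([absorb]) and gives W <= C n^2 |h|^2. *)

(** * Continuity, improper integrals and integrals over a period *)

Section continuity.
Context {R : realType} {T : topologicalType}.
Implicit Types (f g : T -> R) (x : T).

Lemma contc (c : R) x : continuous_at x (fun=> c).
Proof. exact: cst_continuous. Qed.

Lemma contD f g x : continuous_at x f -> continuous_at x g ->
  continuous_at x (fun y => f y + g y).
Proof. exact: continuousD. Qed.

Lemma contN f x : continuous_at x f -> continuous_at x (fun y => - f y).
Proof. exact: continuousN. Qed.

Lemma contB f g x : continuous_at x f -> continuous_at x g ->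
  continuous_at x (fun y => f y - g y).
Proof. exact: continuousB. Qed.

Lemma contM f g x : continuous_at x f -> continuous_at x g ->
  continuous_at x (fun y => f y * g y).
Proof. exact: continuousM. Qed.

Lemma contX f n x : continuous_at x f -> continuous_at x (fun y => f y ^+ n).
Proof. by move=> cf; apply: (@continuous_comp _ _ _ f (fun u => u ^+ n)) => //; exact: exprn_continuous. Qed.

Lemma contV f x : f x != 0 -> continuous_at x f -> continuous_at x (fun y => (f y)^-1).
Proof. by move=> fx0 cf; apply: continuousV. Qed.

Lemma cont_norm f x : continuous_at x f -> continuous_at x (fun y => `|f y|).
Proof. by move=> cf; apply: (@continuous_comp _ _ _ f Num.norm) => //; exact: norm_continuous. Qed.

Lemma cont_sum (I : Type) (r : seq I) (F : I -> T -> R) x :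
  (forall i, continuous_at x (F i)) -> continuous_at x (fun y => \sum_(i <- r) F i y).
Proof.
move=> cF; elim: r => [|i r IH].
  have -> : (fun y => \sum_(i <- [::]) F i y) = (fun=> 0) by apply/funext => y; rewrite big_nil.
  exact: contc.
have -> : (fun y => \sum_(j <- i :: r) F j y) = (fun y => F i y + \sum_(j <- r) F j y).
  by apply/funext => y; rewrite big_cons.
exact: contD.
Qed.

End continuity.

Section integrals.
Context {R : realType}.
Local Notation mu := (@lebesgue_measure R).

Lemma is_derive_continuous (f : R -> R) (x df : R) :
  is_derive x 1 f df -> {for x, continuous f}.
Proof.
by move=> fd; apply/differentiable_continuous/derivable1_diffP; case: fd.
Qed.

(** The integrand may be unbounded at both ends. Inner segments are covered by
    the fundamental theorem of calculus, and integrability makes their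
    integrals converge. *)
Lemma Rintegral_FTC_oo (f F : R -> R) (a b A B : R) : a < b ->
  (forall x, x \in `]a, b[ -> is_derive x 1 F (f x)) ->
  {in `]a, b[, continuous f} ->
  mu.-integrable `[a, b] (EFin \o f) ->
  F x @[x --> a^'+] --> A -> F x @[x --> b^'-] --> B ->
  \int[mu]_(x in `[a, b]) f x = B - A.
Proof.
move=> ab dF cf intf FA FB.
have FTC x y : a < x -> x < y -> y < b -> \int[mu]_(z in `[x, y]) f z = F y - F x.
  move=> ax xy yb.
  have sub z : z \in `[x, y] -> z \in `]a, b[.
    by rewrite !in_itv/= => /andP[xz zy]; rewrite (lt_le_trans ax xz) (le_lt_trans zy yb).
  rewrite /Rintegral (@continuous_FTC2 _ f F x y xy) //.
  - by apply: continuous_in_subspaceT => z /set_mem/= zxy; apply: cf; exact: sub.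
  - have cF z : z \in `[x, y] -> {for z, continuous F}.
      by move=> /sub/dF; exact: is_derive_continuous.
    split.
    + by move=> z zxy; have [] := dF z (sub _ (subset_itv_oo_cc zxy)).
    + by apply: cvg_at_right_filter; apply: cF; rewrite in_itv/= lexx ltW.
    + by apply: cvg_at_left_filter; apply: cF; rewrite in_itv/= lexx ltW.
  - move=> z zxy; rewrite derive1E.
    by have := dF z (sub _ (subset_itv_oo_cc zxy)) => /@derive_val.
pose c := (a + b) / 2.
have ac : a < c by rewrite midf_lt.
have cb : c < b by rewrite midf_lt.
have icb : mu.-integrable `[c, b] (EFin \o f).
  by apply: integrableS intf => //; apply: subset_itvr; rewrite bnd_simp ltW.
have iac : mu.-integrable `[a, c] (EFin \o f).
  by apply: integrableS intf => //; apply: subset_itvl; rewrite bnd_simp ltW.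
have H1 : \int[mu]_(x in `[c, b]) f x = B - F c.
  have l1 := parameterized_integral_cvg_at_left cb icb.
  have l2 : (\int[mu]_(z in `[c, x]) f z) @[x --> b^'-] --> B - F c.
    have : F x - F c @[x --> b^'-] --> B - F c by apply: cvgB => //; exact: cvg_cst.
    apply: cvg_trans; apply: near_eq_cvg; near=> x.
    by rewrite FTC.
  exact: cvg_unique l1 l2.
have H2 : \int[mu]_(x in `[a, c]) f x = F c - A.
  have l1 : (\int[mu]_(z in `[a, x]) f z) @[x --> a^'+] --> (0 : R).
    by apply: cvg_at_right_filter; exact: parameterized_integral_cvg_left ac iac.
  have l2 : (\int[mu]_(z in `[a, x]) f z) @[x --> a^'+] -->
     \int[mu]_(x in `[a, c]) f x - (F c - A).
    have : \int[mu]_(x in `[a, c]) f x - (F c - F x) @[x --> a^'+] -->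
       \int[mu]_(x in `[a, c]) f x - (F c - A).
      by apply: cvgB; [exact: cvg_cst|apply: cvgB => //; exact: cvg_cst].
    apply: cvg_trans; apply: near_eq_cvg; near=> x.
    have ax : a < x by near: x; exact: nbhs_right_gt.
    have xc : x < c by near: x; exact: nbhs_right_lt.
    rewrite -(FTC x c)//.
    rewrite (@itv_bndbnd_setU _ _ _ (BRight x)) ?bnd_simp ?ltW//.
    rewrite Rintegral_setU//=.
    + rewrite Rintegral_itv_obnd_cbnd ?addrK//.
      by apply: integrableS iac => //; apply: subset_itv; rewrite bnd_simp// ltW.
    + by rewrite -itv_bndbnd_setU ?bnd_simp ?ltW.
    + apply/disj_set2P; rewrite -subset0 => z/=; rewrite !in_itv/= => -[/andP[_]].
      by rewrite leNgt => /negbTE ->.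
  have /eqP : 0 = \int[mu]_(x in `[a, c]) f x - (F c - A) by exact: cvg_unique l1 l2.
  by rewrite eq_sym subr_eq0 => /eqP.
rewrite (@itv_bndbnd_setU _ _ _ (BRight c)) ?bnd_simp ?ltW//.
rewrite Rintegral_setU//=.
- rewrite H2 Rintegral_itv_obnd_cbnd; first by rewrite H1; ring.
  by apply: integrableS icb => //; apply: subset_itv; rewrite bnd_simp// ltW.
- by rewrite -itv_bndbnd_setU ?bnd_simp ?ltW.
- apply/disj_set2P; rewrite -subset0 => z/=; rewrite !in_itv/= => -[/andP[_]].
  by rewrite leNgt => /negbTE ->.
Unshelve. all: by end_near. Qed.

(** Monotone convergence: the integrals over inner segments are increments of F,
    hence bounded. *)
Lemma ge0_integrable_FTC (f F : R -> R) (a b : R) : a < b ->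
  (forall x, x \in `]a, b[ -> is_derive x 1 F (f x)) ->
  {in `]a, b[, continuous f} ->
  (forall x, x \in `]a, b[ -> 0 <= f x) ->
  {within `[a, b], continuous F} ->
  mu.-integrable `]a, b[ (EFin \o f).
Proof.
move=> ab dF cf f0 cF.
have mf : measurable_fun `]a, b[ f by apply: open_continuous_measurable_fun => // x /set_mem; exact: cf.
have ndF x y : a <= x -> x <= y -> y <= b -> F x <= F y.
  move=> ax xy yb.
  have dFxy z : z \in `]x, y[ -> is_derive z 1 F (f z).
    by rewrite in_itv/= => /andP[xz zy]; apply: dF; rewrite in_itv/= (le_lt_trans ax xz) (lt_le_trans zy yb).
  have cFxy : {within `[x, y], continuous F}.
    by apply: continuous_subspaceW cF; apply: subset_itv; rewrite bnd_simp.
  have [xyE|xy'] := eqVneq x y; first by rewrite xyE.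
  have {}xy' : x < y by rewrite lt_neqAle xy' xy.
  have [c cxy E] := MVT xy' dFxy cFxy.
  rewrite -subr_ge0 E mulr_ge0 ?subr_ge0// f0//.
  by move: cxy; rewrite !in_itv/= => /andP[xc cy]; rewrite (le_lt_trans ax xc) (lt_le_trans cy yb).
pose e n := n.+2%:R^-1 * (b - a).
have ba0 : 0 < b - a by rewrite subr_gt0.
have e0 n : 0 < e n by rewrite mulr_gt0// invr_gt0 ltr0n.
have e2 n : e n <= (b - a) / 2.
  by rewrite /e [leRHS]mulrC ler_pM2r// lef_pV2 ?posrE ?ltr0n// ler_nat.
pose E n := `[a + e n, b - e n]%classic.
have ndE : nondecreasing_seq E.
  move=> n m nm; rewrite subsetEset; apply: subset_itv; rewrite bnd_simp ?lerD2l ?lerN2;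
    by rewrite ler_pM2r// lef_pV2 ?posrE ?ltr0n// ler_nat !ltnS.
have Eab : \bigcup_n E n = `]a, b[%classic.
  rewrite eqEsubset; split.
    move=> x [n _]; rewrite /E/= !in_itv/= => /andP[ax xb].
    by have := e0 n; lra.
  move=> x/=; rewrite in_itv/= => /andP[ax xb].
  pose d := Num.min (x - a) (b - x).
  have d0 : 0 < d by rewrite lt_min !subr_gt0 ax.
  exists (Num.truncn ((b - a) / d)) => //=.
  have : e (Num.truncn ((b - a) / d)) <= d.
    rewrite /e mulrC ler_pdivrMr ?ltr0n// mulrC -ler_pdivrMr//.
    apply: ltW; apply: (lt_trans (truncnS_gt _)); by rewrite ltr_nat.
  by rewrite /d le_min /E/= in_itv/= => /andP[? ?]; apply/andP; split; lra.
have subE n : E n `<=` `]a, b[%classic by rewrite -Eab; exact: bigcup_sup.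
have mE n : measurable_fun (E n) (EFin \o f).
  by apply/measurable_EFinP; apply: measurable_funS mf.
have f0E n x : E n x -> (0 <= (EFin \o f) x)%E.
  by move=> /subE xab; rewrite lee_fin f0.
have cvgE := ge0_nondecreasing_set_cvg_integral ndE (fun i => measurable_itv _) mE f0E (mu := mu).
rewrite Eab in cvgE.
apply/integrableP; split; first exact/measurable_EFinP.
rewrite [X in (X < _)%E](_ : _ = (\int[mu]_(x in `]a, b[) (EFin \o f) x)%E); last first.
  by apply: eq_integral => x /set_mem xab; rewrite gee0_abs// lee_fin f0.
rewrite -(cvg_lim _ cvgE)//; apply: (@le_lt_trans _ _ (F b - F a)%:E); last exact: ltry.
apply: lime_le; first by apply/cvg_ex; eexists; exact: cvgE.
apply: nearW => n; rewrite /E.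
have [enn|enn] := ltP (a + e n) (b - e n); last first.
  have {}enn : a + e n = b - e n by have := e2 n; lra.
  rewrite enn set_itv1 integral_set1 lee_fin subr_ge0 ndF// ltW//.
rewrite (@continuous_FTC2 _ f F) //.
- rewrite -EFinD lee_fin lerB// ndF//; by have := e0 n; lra.
- by apply: continuous_in_subspaceT => z /set_mem/= zxy; apply: cf; exact: (subE n).
- have cF' z : z \in `[a + e n, b - e n] -> {for z, continuous F}.
    by move=> /(subE n)/dF; exact: is_derive_continuous.
  split.
  + by move=> z zxy; have [] := dF z (subE n _ (subset_itv_oo_cc zxy)).
  + by apply: cvg_at_right_filter; apply: cF'; rewrite in_itv/= lexx ltW.
  + by apply: cvg_at_left_filter; apply: cF'; rewrite in_itv/= lexx ltW.
- move=> z zxy; rewrite derive1E.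
  by have := dF z (subE n _ (subset_itv_oo_cc zxy)) => /@derive_val.
Qed.

Lemma ge0_integral_shift (D : set R) (f : R -> \bar R) (t : R) :
  measurable D -> measurable_fun D f -> (forall x, (0 <= f x)%E) ->
  (\int[mu]_(x in [set x | D (t + x)%R]) f (t + x)%R = \int[mu]_(x in D) f x)%E.
Proof.
move=> mD mf f0.
pose phi : measurableTypeR R -> measurableTypeR R := fun x => t + x.
have mphi : measurable_fun [set: R] phi by apply: measurable_funD.
rewrite -(@ge0_integral_pushforward _ _ _ _ _ phi mphi mu D f) //.
apply: eq_measure_integral => A mA AD; apply/esym.
apply: lebesgue_measure_unique => //= _ [[a b]] _ <-; rewrite /pushforward.
rewrite (_ : phi @^-1` _ = `]a - t, b - t]%classic); last first.
  by apply/seteqP; split => x /=; rewrite !in_itv/= /phi ltrBlDl lerBrDl.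
rewrite !lebesgue_measure_itv/= !lte_fin ltrD2r -!EFinD.
by case: ifP => //= _; congr EFin; ring.
Qed.

(** Translation moves the period to [t, T + t[; its part beyond T is moved back to
    [0, t[. *)
Lemma ge0_integral_periodic (f : R -> \bar R) (T t : R) :
  measurable_fun [set: R] f -> (forall x, (0 <= f x)%E) ->
  (forall x, f (x + T) = f x) -> 0 <= t <= T ->
  (\int[mu]_(x in `[0%R, T[) f (t + x)%R = \int[mu]_(x in `[0%R, T[) f x)%E.
Proof.
move=> mf f0 fT /andP[t0 tT].
have mfS (A : set R) : measurable_fun A f by exact: measurable_funS mf.
transitivity (\int[mu]_(x in `[t, (T + t)%R[) f x)%E.
  rewrite -(@ge0_integral_shift `[t, T + t[%classic f t)//.
  congr (integral mu _ _); apply/seteqP.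
  by split => x /=; rewrite !in_itv/= => /andP[? ?]; apply/andP; split; lra.
rewrite (_ : `[t, T + t[%classic = `[t, T[%classic `|` `[T, T + t[%classic); last first.
  by rewrite -itv_bndbnd_setU// bnd_simp// lerDl.
rewrite ge0_integral_setU//=; last first.
  apply/disj_set2P; rewrite -subset0 => z/=; rewrite !in_itv/= => -[/andP[_ zT] /andP[]].
  by rewrite leNgt zT.
  exact: mfS.
rewrite -(@ge0_integral_shift `[T, T + t[%classic f T)//.
rewrite [X in (_ + X = _)%E](_ : _ = (\int[mu]_(x in `[0%R, t[) f x)%E); last first.
  rewrite (_ : [set x | _] = `[0%R, t[%classic); last first.
    apply/seteqP; split => x /=; rewrite !in_itv/= => /andP[? ?]; apply/andP; split; lra.
  by apply: eq_integral => x _; rewrite addrC fT.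
have -> : `[0, T[%classic = `[0, t[%classic `|` `[t, T[%classic.
  by rewrite -itv_bndbnd_setU// bnd_simp.
rewrite ge0_integral_setU//=; [by rewrite addeC|exact: mfS|].
apply/disj_set2P; rewrite -subset0 => z/=; rewrite !in_itv/= => -[/andP[_ zT] /andP[]].
by rewrite leNgt zT.
Qed.

Lemma integrable_periodic (f : R -> R) (T t : R) :
  measurable_fun [set: R] f -> (forall x, f (x + T) = f x) -> 0 <= t <= T ->
  mu.-integrable `[0, T[ (EFin \o (fun x => f (t + x))) <->
  mu.-integrable `[0, T[ (EFin \o f).
Proof.
move=> mf fT tT.
have mft : measurable_fun [set: R] (fun x => f (t + x)).
  by apply: measurableT_comp => //; exact: measurable_funD.
have E := @ge0_integral_periodic (fun x => `|(f x)%:E|)%E T t _ _ _ tT.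
have {}E : (\int[mu]_(x in `[0%R, T[) `|(f (t + x))%:E| =
   \int[mu]_(x in `[0%R, T[) `|(f x)%:E|)%E.
  apply: E => //; last by move=> x; rewrite fT.
  by apply: measurableT_comp => //; exact/measurable_EFinP.
split => /integrableP[_ l]; apply/integrableP; split.
- by apply/measurable_EFinP; exact: measurable_funS mf.
- by rewrite /= -E.
- by apply/measurable_EFinP; exact: measurable_funS mft.
- by rewrite /= E.
Qed.

Lemma Rintegral_periodic (f : R -> R) (T t : R) :
  measurable_fun [set: R] f -> (forall x, f (x + T) = f x) -> 0 <= t <= T ->
  \int[mu]_(x in `[0, T[) f (t + x) = \int[mu]_(x in `[0, T[) f x.
Proof.
move=> mf fT tT; rewrite /Rintegral; congr fine.
have mfE : measurable_fun [set: R] (EFin \o f) by exact/measurable_EFinP.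
rewrite integralE [in RHS]integralE; congr (_ - _)%E.
- rewrite -(@ge0_integral_periodic ((EFin \o f)^\+)%E T t) //.
  + by apply: eq_integral => x _; rewrite !funeposE.
  + exact: measurable_funepos.
  + by move=> x; rewrite !funeposE/= fT.
- rewrite -(@ge0_integral_periodic ((EFin \o f)^\-)%E T t) //.
  + by apply: eq_integral => x _; rewrite !funenegE.
  + exact: measurable_funeneg.
  + by move=> x; rewrite !funenegE/= fT.
Qed.

End integrals.

(** * Derivatives of real-analytic functions *)

Section analytic.
Context {R : realType}.

Lemma is_cvg_series_derive_geometric (r : R) : 0 <= r < 1 ->
  cvgn (series (fun i => i.+1%:R * r ^+ i)).
Proof.
move=> /andP[r0 r1].
have E n : series (fun i => i.+1%:R * r ^+ i) n * (1 - r) ^+ 2 =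
    1 - (n.+1%:R - n%:R * r) * r ^+ n.
  elim: n => [|n IH]; first by rewrite /series/= big_geq// mul0r expr0; ring.
  rewrite seriesSr mulrDl IH [r ^+ n.+1]exprS -!natr1 /=; ring.
have r10 : 0 < (1 - r) ^+ 2 by rewrite exprn_gt0// subr_gt0.
apply: nondecreasing_is_cvgn.
  by apply: nondecreasing_series => n _ _; rewrite mulr_ge0// exprn_ge0.
exists ((1 - r) ^- 2) => _ [n _ <-].
rewrite -[leRHS]mul1r ler_pdivlMr// E lerBlDr lerDl mulr_ge0 ?exprn_ge0// subr_ge0.
apply: (@le_trans _ _ (n%:R * 1)); first by rewrite ler_wpM2l// ltW.
by rewrite mulr1 ler_nat.
Qed.

Lemma is_cvg_pseries_diffs (f : R^nat) (x z : R) : cvgn (pseries f x) -> `|z| < `|x| ->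
  cvgn (pseries (pseries_diffs f) z).
Proof.
move=> Cx zx; have [K [Kreal Kf]] := cvg_series_bounded Cx.
have x0 : 0 < `|x| by apply: le_lt_trans zx.
pose B := `|K + 1| / `|x|.
apply: normed_cvg.
apply: (@series_le_cvg _ _ (B *: (fun i => i.+1%:R * (`|z| / `|x|) ^+ i))) => [n|n|n|].
- exact: normr_ge0.
- by rewrite /= !mulr_ge0 ?invr_ge0 ?exprn_ge0 ?divr_ge0.
- rewrite [leRHS](_ : _ = B * (n.+1%:R * (`|z| / `|x|) ^+ n))// /= /pseries_diffs 2!normrM normrX.
  rewrite ger0_norm// exprMn exprVn.
  have -> : `|f n.+1| = `|f n.+1 * x ^+ n.+1| / `|x| / `|x| ^+ n.
    by rewrite normrM normrX exprS; field; rewrite expf_neq0 ?gt_eqF.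
  rewrite [leRHS](_ : _ = n.+1%:R * (B / `|x| ^+ n) * `|z| ^+ n); last first.
    by ring.
  apply: ler_wpM2r; first by rewrite exprn_ge0.
  apply: ler_wpM2l => //.
  apply: ler_wpM2r; first by rewrite invr_ge0 exprn_ge0.
  apply: ler_wpM2r; first by rewrite invr_ge0.
  by apply: Kf => //; rewrite (lt_le_trans _ (ler_norm _))// ltrDl.
- apply: is_cvg_seriesZ; apply: is_cvg_series_derive_geometric.
  by rewrite divr_ge0//= ltr_pdivrMr// mul1r.
Qed.

(** A power series may be differentiated termwise inside its disc of convergence.
    Each step of the argument costs a factor 2 in the radius, whence e / 8. *)
Lemma real_analytic_derive (f : R -> R) : real_analytic f ->
  (forall x, derivable f x 1) /\ real_analytic (derive1 f).
Proof.
move=> af.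
have key (t0 : R) : exists (a : R^nat) (e : R), 0 < e /\ forall t : R, `|t - t0| < e ->
    is_derive t 1 f (limn (pseries (pseries_diffs a) (t - t0))) /\
    cvgn (pseries (pseries_diffs a) (t - t0)).
  have [a [e [e0 H]]] := af t0.
  have C x : `|x| < e -> cvgn (pseries a x).
    by move=> xe; apply/cvg_ex; exists (f (x + t0)); have := H (x + t0); rewrite addrK; apply.
  have e1 : `|e / 2| < e by rewrite ger0_norm ?ltr_pdivrMr//; lra.
  have e2 : `|e / 4| < `|e / 2| by rewrite !ger0_norm; lra.
  have e3 : `|e / 8| < `|e / 4| by rewrite !ger0_norm; lra.
  have e4 : `|e / 16| < `|e / 8| by rewrite !ger0_norm; lra.
  have C0 := is_cvg_pseries_inside (is_cvg_pseries_inside (C _ e1) e2) e3.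
  have C1 := is_cvg_pseries_diffs (C _ e1) e2.
  have C2 := is_cvg_pseries_diffs C1 e3.
  have C1' := is_cvg_pseries_inside C1 e3.
  exists a, (e / 8); split; first by lra.
  move=> t tt.
  have e80 : `|e / 8| = e / 8 by rewrite ger0_norm; lra.
  have {}tt : `|t - t0| < `|e / 8| by rewrite e80.
  split; last exact: is_cvg_pseries_inside C1' tt.
  have D := pseries_snd_diffs C0 C1' C2 tt.
  pose g (x : R) := limn (pseries a x).
  have D2 : is_derive t 1 (g \o shift (- t0)) (limn (pseries (pseries_diffs a) (t - t0))).
    rewrite -[X in is_derive _ _ _ X]mulr1.
    have D1 : is_derive (shift (- t0) t) 1 g (limn (pseries (pseries_diffs a) (t - t0))) by exact: D.
    exact: (@is_derive1_comp R g (shift (- t0)) t _ _ D1 (is_derive_shift t 1 (- t0))).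
  apply: near_eq_is_derive D2.
  have : \forall x \near t, `|x - t0| < e / 8.
    apply/nbhs_ballP; exists (e / 8 - `|t - t0|) => /= [|x]; first by rewrite subr_gt0 -e80.
    rewrite /ball/= distrC => tx; apply: (le_lt_trans (ler_distD t _ _)); lra.
  apply: filterS => x xx; rewrite /g/=; apply/cvg_lim => //.
  by apply: H; apply: lt_trans xx _; lra.
split=> [x|t0].
  have [a [e [e0 H]]] := key x.
  have xx : `|x - x| < e by rewrite subrr normr0.
  by have [D _] := H x xx; exact: ex_derive.
have [a [e [e0 H]]] := key t0; exists (pseries_diffs a), e; split=> // t /H[D C].
by rewrite derive1E; move/@derive_val: D => ->.
Qed.

End analytic.

(** * Periodic functions *)

Section periodicity.
Context {R : realType}.
Implicit Types (f : R -> R) (T t : R).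

Lemma period_reduction T t : 0 < T ->
  exists n : int, exists2 s : R, 0 <= s < T & t = s + n%:~R * T.
Proof.
move=> T0; exists (Num.floor (t / T)), (t - (Num.floor (t / T))%:~R * T); last by ring.
have := floor_itv (t / T); rewrite intrD mulr1z => /andP[].
by rewrite ler_pdivlMr// ltr_pdivrMr// mulrDl mul1r subr_ge0 ltrBlDl addrC => -> ->.
Qed.

Lemma periodic_int (V : Type) (f : R -> V) T : (forall x, f (x + T) = f x) ->
  forall (n : int) x, f (x + n%:~R * T) = f x.
Proof.
move=> fT; have H (n : nat) x : f (x + n%:R * T) = f x.
  elim: n x => [|n IH] x; first by rewrite mul0r addr0.
  by rewrite -natr1 mulrDl mul1r addrA fT IH.
case=> n x; first by rewrite -[RHS](H n) -pmulrn.
by rewrite -[LHS](H n.+1) NegzE mulrNz mulNr -pmulrn subrK.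
Qed.

Lemma periodic_bounded f T : 0 < T -> (forall x, f (x + T) = f x) ->
  continuous f -> exists M, 0 < M /\ forall x, `|f x| <= M.
Proof.
move=> T0 fT cf.
have [c _ H] := @EVT_max _ (fun x => `|f x|) 0 T (ltW T0)
  (continuous_subspaceT (fun x => continuous_comp (cf x) (@norm_continuous _ _ _))).
exists (`|f c| + 1); split; first by rewrite ltr_wpDl.
move=> x; have [n [s /andP[s0 sT] ->]] := period_reduction x T0.
rewrite periodic_int//; apply: (le_trans (H s _)); last by rewrite lerDl.
by rewrite in_itv/= s0 ltW.
Qed.

Lemma periodic_derive f T : (forall x, f (x + T) = f x) -> (forall x, derivable f x 1) ->
  forall x, derive1 f (x + T) = derive1 f x.
Proof.
move=> fT df x; rewrite !derive1E.
have D1 : is_derive (shift T x) 1 f ('D_1 f (x + T)) by exact/derivableP.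
have := @is_derive1_comp R f (shift T) x _ _ D1 (is_derive_shift x 1 T).
rewrite (_ : f \o shift T = f); last by apply/funext => y /=; exact: fT.
by move=> /@derive_val ->; rewrite mulr1.
Qed.

End periodicity.

(** * Divided differences *)

Section divided_differences.
Context {R : realType}.

(** Three derivatives are what is needed for the divided differences of f to have
    two bounded derivatives. Only the derivatives are bounded by M. *)
Definition C3fun (f f1 f2 f3 : R -> R) (M : R) :=
  [/\ forall x : R, is_derive x 1 f (f1 x), forall x : R, is_derive x 1 f1 (f2 x),
      forall x : R, is_derive x 1 f2 (f3 x) &
      forall x, [/\ `|f1 x| <= M, `|f2 x| <= M & `|f3 x| <= M]].

(** An integration gains one power of |tau|; this bounds Taylor remainders. *)
Lemma mean_value_bound (N dN : R -> R) (C tau : R) (j : nat) : N 0 = 0 ->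
  (forall x : R, is_derive x 1 N (dN x)) ->
  (forall x, `|dN x| <= C * `|x| ^+ j) -> 0 <= C -> `|N tau| <= C * `|tau| ^+ j.+1.
Proof.
move=> N0 dN' bN C0.
have cN : continuous N by move=> x; exact: is_derive_continuous.
have key x : `|x| <= `|tau| -> `|dN x| <= C * `|tau| ^+ j.
  by move=> xt; apply: (le_trans (bN x)); rewrite ler_wpM2l// lerXn2r ?nnegrE.
have [t0|t0|->] := ltgtP tau 0; last by rewrite N0 !normr0 exprS mul0r mulr0.
- have [c cI E] := @MVT _ N dN tau 0 t0 (fun x _ => dN' x) (continuous_subspaceT cN).
  rewrite -normrN -[- N tau]add0r -{1}N0 E normrM sub0r normrN exprSr mulrA.
  rewrite ler_wpM2r// key//; move: cI; rewrite in_itv/= => /andP[tc c0].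
  by rewrite !ltr0_norm// lerN2 ltW.
- have [c cI E] := @MVT _ N dN 0 tau t0 (fun x _ => dN' x) (continuous_subspaceT cN).
  rewrite -[N tau]subr0 -{1}N0 E normrM subr0 exprSr mulrA.
  rewrite ler_wpM2r// key//; move: cI; rewrite in_itv/= => /andP[tc c0].
  by rewrite !gtr0_norm// ltW.
Qed.

Lemma is_derive_translate (f f' : R -> R) (t x : R) : (forall x : R, is_derive x 1 f (f' x)) ->
  is_derive x 1 (fun y => f (t + y)) (f' (t + x)).
Proof.
move=> df; rewrite -[f' _]mulr1.
rewrite (_ : (fun y => f (t + y)) = f \o shift t); last by apply/funext => y /=; rewrite addrC.
by rewrite [t + x]addrC; apply: is_derive1_comp; exact: is_derive_shift.
Qed.

(** g0 is the divided difference of f at t, and g1, g2 are its first two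
    derivatives with respect to tau; Taylor's formula keeps them bounded as
    tau tends to 0. *)
Lemma divided_differences (f f1 f2 f3 : R -> R) (M t tau : R) : 0 <= M ->
  C3fun f f1 f2 f3 M -> tau != 0 ->
  exists g0 g1 g2 : R, [/\ `|g0| <= M, `|g1| <= M, `|g2| <= M,
    `|g0 - f1 t| <= M * `|tau| &
    [/\ f (t + tau) = f t + tau * g0, f1 (t + tau) = g0 + tau * g1 &
       f2 (t + tau) = 2 * g1 + tau * g2]].
Proof.
move=> M0 [d0 d1 d2 bM] tau0.
have d0t (x : R) := is_derive_translate t x d0.
have d1t (x : R) := is_derive_translate t x d1.
have d2t (x : R) := is_derive_translate t x d2.
pose g0 := (f (t + tau) - f t) / tau.
pose g1 := (f1 (t + tau) - g0) / tau.
pose g2 := (f2 (t + tau) - 2 * g1) / tau.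
have at0 : 0 < `|tau| by rewrite normr_gt0.
exists g0, g1, g2; split.
- rewrite normrM normfV ler_pdivrMr//.
  pose N y := f (t + y) - f t.
  have dN (x : R) : is_derive x 1 N (f1 (t + x)).
    by apply: is_derive_eq; rewrite subr0.
  have := @mean_value_bound N (fun y => f1 (t + y)) M tau 0 _ dN _ M0.
  rewrite expr1; apply; first by rewrite /N addr0 subrr.
  by move=> x; rewrite expr0 mulr1; have [] := bM (t + x).
- rewrite (_ : g1 = (tau * f1 (t + tau) - (f (t + tau) - f t)) / tau ^+ 2); last first.
    by rewrite /g1 /g0; field.
  rewrite normrM normfV normrX ler_pdivrMr ?exprn_gt0//.
  pose N y := y * f1 (t + y) - (f (t + y) - f t).
  have dN (x : R) : is_derive x 1 N (x * f2 (t + x)).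
    apply: is_derive_eq; rewrite subr0 /GRing.scale/=; ring.
  have := @mean_value_bound N (fun y => y * f2 (t + y)) M tau 1 _ dN _ M0; apply.
    by rewrite /N addr0 subrr mul0r subrr.
  by move=> x; rewrite expr1 normrM mulrC ler_wpM2r//; have [] := bM (t + x).
- rewrite (_ : g2 = (tau ^+ 2 * f2 (t + tau) - 2 * tau * f1 (t + tau)
      + 2 * (f (t + tau) - f t)) / tau ^+ 3); last first.
    by rewrite /g2 /g1 /g0; field.
  rewrite normrM normfV normrX ler_pdivrMr ?exprn_gt0//.
  pose N y := y ^+ 2 * f2 (t + y) - 2 * y * f1 (t + y) + 2 * (f (t + y) - f t).
  have dN (x : R) : is_derive x 1 N (x ^+ 2 * f3 (t + x)).
    apply: is_derive_eq; rewrite subr0 /GRing.scale/=; ring.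
  have := @mean_value_bound N (fun y => y ^+ 2 * f3 (t + y)) M tau 2 _ dN _ M0; apply.
    by rewrite /N addr0 subrr; ring.
  by move=> x; rewrite normrM normrX mulrC ler_wpM2r ?exprn_ge0//; have [] := bM (t + x).
- rewrite (_ : g0 - f1 t = ((f (t + tau) - f t) - tau * f1 t) / tau); last first.
    by rewrite /g0; field.
  rewrite normrM normfV ler_pdivrMr// -mulrA -expr2.
  pose N y := f (t + y) - f t - y * f1 t.
  have dN (x : R) : is_derive x 1 N (f1 (t + x) - f1 t).
    apply: is_derive_eq; rewrite subr0 /GRing.scale/=; ring.
  have := @mean_value_bound N (fun y => f1 (t + y) - f1 t) M tau 1 _ dN _ M0; apply.
    by rewrite /N addr0 subrr mul0r subrr.
  move=> x; rewrite expr1.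
  have dN1 (y : R) : is_derive y 1 (fun y => f1 (t + y) - f1 t) (f2 (t + y)).
    by apply: is_derive_eq; rewrite subr0.
  have := @mean_value_bound (fun y => f1 (t + y) - f1 t) (fun y => f2 (t + y)) M x 0 _ dN1 _ M0.
  rewrite expr1; apply; first by rewrite addr0 subrr.
  by move=> y; rewrite expr0 mulr1; have [] := bM (t + y).
- by split; rewrite /g2 /g1 /g0; field.
Qed.

End divided_differences.

(** * Chords of a closed curve *)

Section chord.
Context {R : realType}.
Variables (x x1 x2 x3 y y1 y2 y3 : R -> R) (M : R).
Hypotheses (M0 : 0 <= M) (Cx : C3fun x x1 x2 x3 M) (Cy : C3fun y y1 y2 y3 M).

(** The square of the length of the chord from parameter t to t + tau. *)
Definition chord (x y : R -> R) (t tau : R) :=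
  (x (t + tau) - x t) ^+ 2 + (y (t + tau) - y t) ^+ 2.
Definition dchord (x x1 y y1 : R -> R) (t tau : R) :=
  2 * ((x (t + tau) - x t) * x1 (t + tau) + (y (t + tau) - y t) * y1 (t + tau)).
Definition ddchord (x x1 x2 y y1 y2 : R -> R) (t tau : R) :=
  2 * (x1 (t + tau) ^+ 2 + (x (t + tau) - x t) * x2 (t + tau) +
       (y1 (t + tau) ^+ 2 + (y (t + tau) - y t) * y2 (t + tau))).

Lemma is_derive_chord (t tau : R) : is_derive tau 1 (chord x y t) (dchord x x1 y y1 t tau).
Proof.
have [dx _ _ _] := Cx; have [dy _ _ _] := Cy.
have dxt := is_derive_translate t tau dx; have dyt := is_derive_translate t tau dy.
rewrite /chord; apply: is_derive_eq; rewrite !subr0 /dchord /GRing.scale/=; ring.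
Qed.

Lemma is_derive_dchord (t tau : R) :
  is_derive tau 1 (dchord x x1 y y1 t) (ddchord x x1 x2 y y1 y2 t tau).
Proof.
have [dx dx1 _ _] := Cx; have [dy dy1 _ _] := Cy.
have dxt := is_derive_translate t tau dx; have dyt := is_derive_translate t tau dy.
have dx1t := is_derive_translate t tau dx1; have dy1t := is_derive_translate t tau dy1.
rewrite /dchord; apply: is_derive_eq; rewrite !subr0 /ddchord /GRing.scale/=; ring.
Qed.

Lemma normrM_le (a b A B : R) : `|a| <= A -> `|b| <= B -> `|a * b| <= A * B.
Proof. by move=> aA bB; rewrite normrM ler_pM. Qed.

Lemma ler_norm_div (a b A c : R) : 0 < c -> c <= b -> `|a| <= A -> `|a / b| <= A / c.
Proof.
move=> c0 cb aA; have b0 : 0 < b by apply: lt_le_trans cb.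
rewrite normrM normfV (gtr0_norm b0) ler_pM ?invr_ge0 ?(ltW b0)//.
by rewrite lef_pV2.
Qed.

(** The squared chord length P is tau^2 G, with G the sum of the squares of the
    divided differences. The bounds say that ln P - ln tau^2 = ln G has two
    bounded derivatives in tau, and that G extends continuously to tau = 0. *)
Lemma chord_log_bounds (c : R) : 0 < c -> exists2 C : R, 0 <= C &
  forall t tau : R, tau != 0 -> c * tau ^+ 2 <= chord x y t tau ->
  let P := chord x y t tau in
  let P' := dchord x x1 y y1 t tau in
  let P'' := ddchord x x1 x2 y y1 y2 t tau in
  [/\ `|P' / P - 2 / tau| <= C, `|P'' / P - (P' / P) ^+ 2 + 2 / tau ^+ 2| <= C &
      `|P / tau ^+ 2 - (x1 t ^+ 2 + y1 t ^+ 2)| <= C * `|tau|].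
Proof.
move=> c0; exists (8 * (M * M) / c + (4 * (M * M) / c) ^+ 2 + 4 * (M * M)).
  by rewrite !addr_ge0 ?exprn_ge0 ?divr_ge0 ?mulr_ge0// ltW.
move=> t tau tau0 cP P P' P''.
have [a0 [a1 [a2 [ba0 ba1 ba2 da [E0 E1 E2]]]]] := divided_differences t M0 Cx tau0.
have [b0 [b1 [b2 [bb0 bb1 bb2 db [F0 F1 F2]]]]] := divided_differences t M0 Cy tau0.
pose G := a0 ^+ 2 + b0 ^+ 2.
have PG : P = tau ^+ 2 * G by rewrite /P /chord E0 F0 /G; ring.
have cG : c <= G.
  have t20 : 0 < tau ^+ 2 by rewrite exprn_even_gt0.
  by move: cP; rewrite -/P PG mulrC ler_pM2l.
have G0 : G != 0 by rewrite gt_eqF// (lt_le_trans c0).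
have HG' : `|2 * (a0 * a1 + b0 * b1)| <= 4 * (M * M).
  have := normrM_le ba0 ba1; have := normrM_le bb0 bb1.
  by rewrite !ler_norml => /andP[? ?] /andP[? ?]; apply/andP; split; lra.
have HG'' : `|2 * (a1 * a1 + a0 * a2 + (b1 * b1 + b0 * b2))| <= 8 * (M * M).
  have := normrM_le ba1 ba1; have := normrM_le bb1 bb1.
  have := normrM_le ba0 ba2; have := normrM_le bb0 bb2.
  rewrite !ler_norml => /andP[? ?] /andP[? ?] /andP[? ?] /andP[? ?].
  by apply/andP; split; lra.
have B1 := ler_norm_div c0 cG HG'.
have B2 := ler_norm_div c0 cG HG''.
have B11 : `|(2 * (a0 * a1 + b0 * b1) / G) ^+ 2| <= (4 * (M * M) / c) ^+ 2.
  by rewrite normrX lerXn2r ?nnegrE ?divr_ge0 ?mulr_ge0// ltW.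
have MM : 0 <= M * M by rewrite mulr_ge0.
have MMc : 0 <= M * M / c by rewrite divr_ge0// ltW.
have s0 : 0 <= (4 * (M * M) / c) ^+ 2 by rewrite exprn_even_ge0.
have PE' : P' / P = 2 / tau + 2 * (a0 * a1 + b0 * b1) / G.
  rewrite PG /P' /dchord E0 F0 E1 F1.
  by rewrite /G; field; rewrite -/G G0 tau0.
split.
- rewrite PE' addrC addKr; apply: (le_trans B1); rewrite -addrA ler_wpDr//.
    by rewrite addr_ge0// mulr_ge0.
  by rewrite ler_wpM2r ?invr_ge0 ?(ltW c0)// ler_wpM2r// ler_nat.
- rewrite (_ : _ + _ = 2 * (a1 * a1 + a0 * a2 + (b1 * b1 + b0 * b2)) / G -
     (2 * (a0 * a1 + b0 * b1) / G) ^+ 2).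
    move: B2 B11; rewrite !ler_norml => /andP[? ?] /andP[? ?].
    by apply/andP; split; lra.
  rewrite PE' PG /P'' /ddchord E0 F0 E1 F1 E2 F2 /G.
  by field; rewrite -/G G0 tau0.
- rewrite PG mulrAC divff ?mul1r ?expf_neq0// /G.
  have [_ _ _ /(_ t)[bx _ _]] := Cx; have [_ _ _ /(_ t)[by_ _ _]] := Cy.
  have h1 : `|(a0 - x1 t) * (a0 + x1 t)| <= M * `|tau| * (M + M).
    by apply: normrM_le => //; apply: (le_trans (ler_normD _ _)); rewrite lerD.
  have h2 : `|(b0 - y1 t) * (b0 + y1 t)| <= M * `|tau| * (M + M).
    by apply: normrM_le => //; apply: (le_trans (ler_normD _ _)); rewrite lerD.
  rewrite (_ : _ - _ = (a0 - x1 t) * (a0 + x1 t) + (b0 - y1 t) * (b0 + y1 t)); last by ring.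
  apply: (le_trans (ler_normD _ _)); apply: (le_trans (lerD h1 h2)).
  rewrite [leLHS](_ : _ = (4 * (M * M)) * `|tau|); last by ring.
  by rewrite ler_wpM2r// lerDr addr_ge0// !mulr_ge0// invr_ge0 ltW.
Qed.

Hypotheses (px : forall t, x (t + 2 * pi) = x t) (py : forall t, y (t + 2 * pi) = y t).
Hypothesis inj : forall s t : R, 0 <= s < 2 * pi -> 0 <= t < 2 * pi -> x s = x t -> y s = y t -> s = t.
Hypothesis reg : forall t : R, 0 < x1 t ^+ 2 + y1 t ^+ 2.

Let pi20 : 0 < 2 * pi :> R.
Proof. by rewrite mulr_gt0// pi_gt0. Qed.

Let cx : continuous x.
Proof. by move=> t; have [d _ _ _] := Cx; exact: is_derive_continuous. Qed.
Let cy : continuous y.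
Proof. by move=> t; have [d _ _ _] := Cy; exact: is_derive_continuous. Qed.

Lemma period_reduction2 t : exists2 s : R, 0 <= s < 2 * pi &
  forall u, x (t + u) = x (s + u) /\ y (t + u) = y (s + u).
Proof.
have [n [s s02 ->]] := period_reduction t pi20; exists s => // u.
by split; rewrite addrAC periodic_int.
Qed.

Lemma chord_gt0 t tau : 0 < tau < 2 * pi -> 0 < chord x y t tau.
Proof.
move=> /andP[tau0 tau2]; have [s /andP[s0 s2] E] := period_reduction2 t.
have -> : chord x y t tau = chord x y s tau.
  have [e1 e2] := E tau; have := E 0; rewrite !addr0 => -[e3 e4].
  by rewrite /chord e1 e2 e3 e4.
rewrite lt_neqAle /chord addr_ge0 ?sqr_ge0// andbT eq_sym paddr_eq0 ?sqr_ge0// !sqrf_eq0 !subr_eq0.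
apply/negP => /andP[/eqP ex /eqP ey].
have [st|st] := ltP (s + tau) (2 * pi).
  by have := inj _ _ ex ey; rewrite s0 s2 st addr_ge0 ?(ltW tau0)// => /(_ isT isT); lra.
have ex' : x (s + tau - 2 * pi) = x s by rewrite -px subrK.
have ey' : y (s + tau - 2 * pi) = y s by rewrite -py subrK.
have := inj _ _ ex' ey'; rewrite s0 s2 subr_ge0 st ltrBlDr ltrD//.
  by move=> /(_ isT isT); lra.
Qed.

Lemma chord_sym t tau : chord x y t (- tau) = chord x y (t - tau) tau.
Proof. rewrite /chord subrK; ring. Qed.

Lemma speed_lower_bound : exists2 m : R, 0 < m & forall t, m <= x1 t ^+ 2 + y1 t ^+ 2.
Proof.
have [dx dx1 _ _] := Cx; have [dy dy1 _ _] := Cy.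
have px1 t : x1 (t + 2 * pi) = x1 t.
  have E u : derive1 x u = x1 u by rewrite derive1E; move: (dx u) => /@derive_val.
  by rewrite -!E periodic_derive// => u; have [] := dx u.
have py1 t : y1 (t + 2 * pi) = y1 t.
  have E u : derive1 y u = y1 u by rewrite derive1E; move: (dy u) => /@derive_val.
  by rewrite -!E periodic_derive// => u; have [] := dy u.
have cs : continuous (fun t => x1 t ^+ 2 + y1 t ^+ 2).
  move=> t; apply: (@is_derive_continuous _ _ _ (2 * x1 t * x2 t + 2 * y1 t * y2 t)).
  have := dx1 t; have := dy1 t => ? ?; apply: is_derive_eq; rewrite /GRing.scale/=; ring.
have [c _ H] := EVT_min (ltW pi20) (continuous_subspaceT cs).
exists (x1 c ^+ 2 + y1 c ^+ 2) => // t.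
have [n [s /andP[s0 s2] ->]] := period_reduction t pi20.
by rewrite !periodic_int// H// in_itv/= s0 ltW.
Qed.

(** Near the diagonal this is regularity, through the divided differences; away
    from it the squared chord length has a positive minimum, by injectivity
    and compactness. *)
Lemma chord_arc : exists2 c : R, 0 < c &
  forall t tau : R, `|tau| <= pi -> c * tau ^+ 2 <= chord x y t tau.
Proof.
have pi0 : 0 < pi :> R by exact: pi_gt0.
suff [c c0 H] : exists2 c : R, 0 < c &
    forall t tau : R, 0 <= tau <= pi -> c * tau ^+ 2 <= chord x y t tau.
  exists c => // t tau; rewrite ler_norml => /andP[t1 t2].
  have [tau0|tau0] := leP 0 tau; first by apply: H; rewrite tau0.
  rewrite -[tau]opprK sqrrN chord_sym H// oppr_ge0 ltW//=; lra.
have [m m0 Hm] := speed_lower_bound.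
(* up to tau0 the divided differences stay close to the velocity *)
pose tau0 := Num.min (m / (8 * (M + 1) ^+ 2)) pi.
have M1 : 0 < M + 1 by rewrite ltr_wpDl.
have tau00 : 0 < tau0.
  by rewrite lt_min pi0 andbT divr_gt0// mulr_gt0// exprn_gt0.
pose A := `[(0 : R), 2 * pi]%classic `*` `[tau0, pi]%classic.
have cA : compact A by apply: compact_setX; exact: segment_compact.
have A0 : A !=set0.
  by exists (0, pi); split => /=; rewrite in_itv/= ?lexx ?(ltW pi20)// ge_min lexx orbT.
have ch : continuous (fun p : R * R => chord x y p.1 p.2).
  move=> p; rewrite /chord.
  have sumc : {for p, continuous (fun p : R * R => p.1 + p.2)}.
    by apply: (@continuousD _ _ _ fst snd); [exact: cvg_fst|exact: cvg_snd].
  have C1 (f : R -> R) : continuous f -> {for p, continuous (fun p : R * R => (f (p.1 + p.2) - f p.1) ^+ 2)}.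
    move=> cf; apply: (@continuous_comp _ _ _ (fun p : R * R => f (p.1 + p.2) - f p.1) (fun u => u ^+ 2)).
      apply: (@continuousB _ _ _ (fun p : R * R => f (p.1 + p.2)) (fun p => f p.1)).
        by apply: (@continuous_comp _ _ _ (fun p : R * R => p.1 + p.2) f) => //; exact: cf.
      by apply: (@continuous_comp _ _ _ fst f); [exact: cvg_fst|exact: cf].
    exact: exprn_continuous.
  by apply: (@continuousD _ _ _ (fun p : R * R => (x (p.1 + p.2) - x p.1) ^+ 2)
     (fun p => (y (p.1 + p.2) - y p.1) ^+ 2)); exact: C1.
have [q qA Hq] := compact_EVT_min A0 cA (continuous_subspaceT ch).
have Q0 : 0 < chord x y q.1 q.2.
  apply: chord_gt0; move/set_mem: qA => [_ /=]; rewrite in_itv/= => /andP[q1 q2].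
  by rewrite (lt_le_trans tau00 q1)/= (le_lt_trans q2)// ltr_pMl// ltr1n.
exists (Num.min (m / 2) (chord x y q.1 q.2 / pi ^+ 2)).
  by rewrite lt_min divr_gt0//= divr_gt0// exprn_gt0.
move=> t tau /andP[ta tb].
have [le|gt] := leP tau tau0; last first.
  have [s /andP[s0 s2] E] := period_reduction2 t.
  have -> : chord x y t tau = chord x y s tau.
    have [e1 e2] := E tau; have := E 0; rewrite !addr0 => -[e3 e4].
    by rewrite /chord e1 e2 e3 e4.
  apply: le_trans (Hq (s, tau) _); last first.
    by rewrite inE /A; split => /=; rewrite in_itv/= ?s0 ?tb ?(ltW gt)// ltW.
  apply: (@le_trans _ _ (chord x y q.1 q.2 / pi ^+ 2 * pi ^+ 2)).
    apply: ler_pM; first by rewrite le_min !divr_ge0 ?exprn_ge0// ltW.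
    - exact: sqr_ge0.
    - by rewrite ge_min lexx orbT.
    - by rewrite lerXn2r ?nnegrE ?(ltW pi0).
  by rewrite divfK// expf_neq0// gt_eqF.
have [->|taun] := eqVneq tau 0; first by rewrite expr0n/= mulr0 /chord addr_ge0 ?sqr_ge0.
have [a0 [_ [_ [ba0 _ _ da [E0 _ _]]]]] := divided_differences t M0 Cx taun.
have [b0 [_ [_ [bb0 _ _ db [F0 _ _]]]]] := divided_differences t M0 Cy taun.
have -> : chord x y t tau = (a0 ^+ 2 + b0 ^+ 2) * tau ^+ 2 by rewrite /chord E0 F0; ring.
apply: ler_wpM2r; first exact: sqr_ge0.
apply: (@le_trans _ _ (m / 2)); first by rewrite ge_min lexx.
have [_ _ _ /(_ t)[bx _ _]] := Cx; have [_ _ _ /(_ t)[by_ _ _]] := Cy.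
have h1 : `|(a0 - x1 t) * (a0 + x1 t)| <= M * `|tau| * (M + M).
  by apply: normrM_le => //; apply: (le_trans (ler_normD _ _)); rewrite lerD.
have h2 : `|(b0 - y1 t) * (b0 + y1 t)| <= M * `|tau| * (M + M).
  by apply: normrM_le => //; apply: (le_trans (ler_normD _ _)); rewrite lerD.
have ht : M * `|tau| * (M + M) <= m / 4.
  rewrite ger0_norm//.
  have : tau <= m / (8 * (M + 1) ^+ 2) by apply: (le_trans le); rewrite ge_min lexx.
  rewrite ler_pdivlMr ?mulr_gt0 ?exprn_gt0// => h.
  rewrite ler_pdivlMr//; apply: le_trans h.
  rewrite (_ : _ * 4 = tau * (8 * M ^+ 2)); last by ring.
  by rewrite ler_wpM2l// ler_wpM2l// lerXn2r ?nnegrE ?(ltW M1)// lerDl.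
have := Hm t; move: h1 h2; rewrite !ler_norml => /andP[? ?] /andP[? ?] ?; nra.
Qed.

End chord.

(** * Decay of Fourier coefficients *)

Section singular_integrals.
Context {R : realType}.
Local Notation mu := (@lebesgue_measure R).

Lemma integrable_oo_cc (f : R -> R) (a b : R) :
  mu.-integrable `]a, b[ (EFin \o f) -> mu.-integrable `[a, b] (EFin \o f).
Proof.
move=> /integrableP[mf fi].
have mf' : measurable_fun `[a, b] (EFin \o f).
  by apply/emeasurable_fun_itv_obnd_cbndP/emeasurable_fun_itv_bndo_bndcP.
apply/integrableP; split => //.
by rewrite integral_itv_bndoo//; apply: measurableT_comp.
Qed.

Lemma bounded_integrable_oo (f : R -> R) (a b C : R) :
  {in `]a, b[, continuous f} -> (forall x, x \in `]a, b[ -> `|f x| <= C) ->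
  mu.-integrable `[a, b] (EFin \o f).
Proof.
move=> cf bf; apply: integrable_oo_cc; apply: measurable_bounded_integrable => //.
- rewrite [X in (X < _)%E]lebesgue_measure_itv/=; case: ifP => _; last exact: ltry.
  by rewrite -EFinB ltry.
- by apply: open_continuous_measurable_fun => // x /set_mem; exact: cf.
- exists C; split; first exact: num_real.
  by move=> M CM x /bf h; apply: (le_trans h); exact: ltW.
Qed.

(** F and L have the same limits at the ends because H vanishes there. This spares
    computing the limits of products such as ln x * sin x. *)
Lemma Rintegral_FTC_approx (f F L H : R -> R) (a b : R) : a < b ->
  (forall x, x \in `]a, b[ -> is_derive x 1 F (f x)) ->
  {in `]a, b[, continuous f} ->
  mu.-integrable `[a, b] (EFin \o f) ->
  continuous L -> continuous H -> H a = 0 -> H b = 0 ->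
  (forall x, x \in `]a, b[ -> `|F x - L x| <= H x) ->
  \int[mu]_(x in `[a, b[) f x = L b - L a.
Proof.
move=> ab dF cf fi cL cH Ha Hb FLH.
rewrite Rintegral_itv_bndo_bndc; last first.
  by apply: integrableS fi => //; apply: subset_itvl; rewrite bnd_simp.
have FL (F' : set_system R) (c : R) : Filter F' -> F' `=>` nbhs c -> H c = 0 ->
    (\forall x \near F', x \in `]a, b[) -> F x @[x --> F'] --> L c.
  move=> FF Fc Hc near_ab.
  have L1 : L x @[x --> F'] --> L c by apply: cvg_trans (cL c); exact: cvg_app.
  have H1 : H x @[x --> F'] --> 0 by rewrite -Hc; apply: cvg_trans (cH c); exact: cvg_app.
  rewrite -[L c]add0r.
  rewrite (_ : F = (fun x => (F x - L x) + L x)); last by apply/funext => x; rewrite subrK.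
  apply: cvgD => //; apply/norm_cvg0P.
  apply: (@squeeze_cvgr _ _ _ _ (cst 0) H) => //; last exact: cvg_cst.
  by apply: filterS near_ab => x xab; rewrite normr_ge0 FLH.
apply: (@Rintegral_FTC_oo _ f F) => //.
- apply: FL => //; first exact: cvg_within.
  near=> x; rewrite in_itv/=; apply/andP; split => //; near: x; exact: nbhs_right_lt.
- apply: FL => //; first exact: cvg_within.
  near=> x; rewrite in_itv/=; apply/andP; split => //; near: x; exact: nbhs_left_gt.
Unshelve. all: by end_near. Qed.

Lemma le_Rintegral_cst (f : R -> R) (a b C : R) : a < b ->
  mu.-integrable `[a, b] (EFin \o f) ->
  (forall x, x \in `]a, b[ -> `|f x| <= C) -> `|\int[mu]_(x in `[a, b[) f x| <= C * (b - a).
Proof.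
move=> ab fi fC.
have fico : mu.-integrable `[a, b[ (EFin \o f).
  by apply: integrableS fi => //; apply: subset_itvl; rewrite bnd_simp.
have fioo : mu.-integrable `]a, b[ (EFin \o f).
  by apply: integrableS fi => //; exact: subset_itv_oo_cc.
rewrite -Rintegral_itv_obnd_cbnd//.
apply: (le_trans (le_normr_Rintegral _ _)) => //.
have ci : mu.-integrable `]a, b[ (EFin \o cst C).
  apply: (@integrableS _ _ _ mu `[a, b]) => //; first exact: subset_itv_oo_cc.
  by apply: (@bounded_integrable_oo _ _ _ `|C|) => // x _; exact: contc.
have -> : C * (b - a) = \int[mu]_(x in `]a, b[) C.
  by rewrite Rintegral_cst// [X in fine X]lebesgue_measure_itv/= lte_fin ab -EFinB.
by apply: le_Rintegral => //; exact: integrable_norm.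
Qed.

Lemma is_derive_scale (c x : R) : is_derive x 1 (fun x => c * x) c.
Proof. by apply: is_derive_eq; rewrite /GRing.scale/= mulr1. Qed.

Lemma is_derive_cosM (c x : R) :
  is_derive x 1 (fun x => cos (c * x)) (- sin (c * x) * c).
Proof.
have := is_derive_scale c x => ?.
by apply: (@is_derive1_comp _ cos (fun x => c * x)).
Qed.

Lemma is_derive_sinM (c x : R) : is_derive x 1 (fun x => sin (c * x)) (cos (c * x) * c).
Proof.
have := is_derive_scale c x => ?.
by apply: (@is_derive1_comp _ sin (fun x => c * x)).
Qed.

Lemma natM2pi (k : nat) : k%:R * (2 * pi) = 0 + pi *+ 2 *+ k :> R.
Proof. by rewrite add0r -[in RHS]mulr_natl -[pi *+ 2]mulr_natl. Qed.

Lemma sin_natM2pi (k : nat) : sin (k%:R * (2 * pi)) = 0 :> R.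
Proof. by rewrite natM2pi (periodicn (@sinD2pi R)) sin0. Qed.

Lemma cos_natM2pi (k : nat) : cos (k%:R * (2 * pi)) = 1 :> R.
Proof. by rewrite natM2pi (periodicn (@cosD2pi R)) cos0. Qed.

(** Two integrations by parts. The boundary terms of the first vanish or cancel
    because K has the same limit K0 at both ends. In the second, 1 - cos (k x)
    is taken as the primitive of k sin (k x), so that K1 meets only factors that
    vanish at the ends. *)
Lemma fourier_decay (K K1 K2 : R -> R) (K0 C : R) (k : nat) : (0 < k)%N -> 0 <= C ->
  (forall x : R, x \in `]0, 2 * pi[ -> is_derive x 1 K (K1 x)) ->
  (forall x : R, x \in `]0, 2 * pi[ -> is_derive x 1 K1 (K2 x)) ->
  {in `]0, 2 * pi[, continuous K2} ->
  (forall x : R, x \in `]0, 2 * pi[ ->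
     [/\ `|K x - K0| <= C * (x * (2 * pi - x)), `|K1 x| <= C & `|K2 x| <= C]) ->
  `|\int[mu]_(x in `[0, 2 * pi[) (K x * cos (k%:R * x))| <= 4 * pi * C / k%:R ^+ 2 /\
  `|\int[mu]_(x in `[0, 2 * pi[) (K x * sin (k%:R * x))| <= 4 * pi * C / k%:R ^+ 2.
Proof.
move=> k0 C0 dK dK1 cK2 bK.
have p0 : 0 < pi :> R by exact: pi_gt0.
have p20 : 0 < 2 * pi :> R by rewrite mulr_gt0.
have kn0 : k%:R != 0 :> R by rewrite pnatr_eq0 -lt0n.
have k20 : 0 < k%:R ^+ 2 :> R by rewrite exprn_even_gt0.
have dc := is_derive_cosM k%:R; have ds := is_derive_sinM k%:R.
have cc : continuous (fun x : R => cos (k%:R * x)) by move=> x; exact: is_derive_continuous.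
have cs : continuous (fun x : R => sin (k%:R * x)) by move=> x; exact: is_derive_continuous.
have cK : {in `]0, 2 * pi[, continuous K} by move=> x /dK; exact: is_derive_continuous.
have s2 := sin_natM2pi k; have c2 := cos_natM2pi k.
pose bb (x : R) := x * (2 * pi - x).
have cbb : continuous bb.
  move=> x; apply: (@is_derive_continuous _ _ _ (2 * pi - 2 * x)).
  apply: is_derive_eq; rewrite /GRing.scale/=; ring.
have bbC (x : R) : x \in `]0, 2 * pi[ -> bb x <= (2 * pi) ^+ 2.
  rewrite in_itv/= => /andP[x0 x2]; rewrite /bb expr2 ler_pM ?subr_ge0 ?ltW//; lra.
have Kb (x : R) : x \in `]0, 2 * pi[ -> `|K x| <= C * (2 * pi) ^+ 2 + `|K0|.
  move=> xI; have [h _ _] := bK x xI; rewrite -[K x](subrK K0).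
  apply: (le_trans (ler_normD _ _)); rewrite lerD2r; apply: (le_trans h).
  by rewrite ler_wpM2l// bbC.
have cosb (x : R) : `|cos (k%:R * x)| <= 1 :> R by rewrite ler_norml cos_geN1 cos_le1.
have sinb (x : R) : `|sin (k%:R * x)| <= 1 :> R by rewrite ler_norml sin_geN1 sin_le1.
have ib (f g : R -> R) (B : R) : {in `]0, 2 * pi[, continuous f} -> continuous g ->
   (forall x, x \in `]0, 2 * pi[ -> `|f x| <= B) -> (forall x, `|g x| <= 2) ->
   mu.-integrable `[0, 2 * pi] (EFin \o (fun x => f x * g x)).
  move=> cf cg bf bg; apply: (@bounded_integrable_oo _ _ _ (B * 2)).
    by move=> x xI; apply: contM; [exact: cf|exact: cg].
  by move=> x xI; rewrite normrM ler_pM// bf.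
have le12 (u : R) : `|u| <= 1 -> `|u| <= 2 by move=> h; apply: (le_trans h); lra.
have int_co (f : R -> R) : mu.-integrable `[0, 2 * pi] (EFin \o f) ->
    mu.-integrable `[0, 2 * pi[ (EFin \o f).
  by move=> fi; apply: integrableS fi => //; apply: subset_itvl; rewrite bnd_simp.
have cK2b (x : R) : x \in `]0, 2 * pi[ -> `|K2 x| <= C by move=> /bK[].
have cc1 : continuous (fun x : R => (1 - cos (k%:R * x))).
  by move=> x; apply: contB; [exact: contc|exact: cc].
have b1c (x : R) : `|1 - cos (k%:R * x)| <= 2.
  by apply: (le_trans (ler_normB _ _)); rewrite normr1 -[2]/(1 + 1) lerD2l.
split.
- pose g x := K2 x / k%:R ^+ 2 * (1 - cos (k%:R * x)).
  have ck2 : {in `]0, 2 * pi[, continuous (fun x => K2 x / k%:R ^+ 2)}.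
    by move=> x xI; apply: contM; [exact: cK2|exact: contc].
  have gi : mu.-integrable `[0, 2 * pi] (EFin \o g).
    apply: (@ib _ _ (C / k%:R ^+ 2)) => //.
    move=> x /cK2b xI; rewrite normrM normfV (gtr0_norm k20) ler_pM2r ?invr_gt0//.
  have fi : mu.-integrable `[0, 2 * pi] (EFin \o (fun x => K x * cos (k%:R * x))).
    by apply: ib Kb _ => // x; exact: le12.
  pose F x := K x * sin (k%:R * x) / k%:R - K1 x * (1 - cos (k%:R * x)) / k%:R ^+ 2.
  have E : \int[mu]_(x in `[0, 2 * pi[) (K x * cos (k%:R * x) - g x) = 0 - 0.
    apply: (@Rintegral_FTC_approx (fun x => K x * cos (k%:R * x) - g x) F (fun=> 0)
      (fun x => (C * (2 * pi) ^+ 2 + `|K0|) * `|sin (k%:R * x)| / k%:R +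
          C * (1 - cos (k%:R * x)) / k%:R ^+ 2) 0 (2 * pi) p20).
    + move=> x xI; have ? := dK x xI; have ? := dK1 x xI.
      rewrite /F; apply: is_derive_eq; rewrite /g /GRing.scale/=.
      by field.
    + by move=> x xI; apply: contB; apply: contM;
        [exact: cK|exact: cc|exact: ck2|exact: cc1].
    + have := integrableB (measurable_itv _) fi gi (mu := mu).
      by apply: eq_integrable => // x _ /=; rewrite EFinB.
    + exact: contc.
    + move=> x; apply: contD; apply: contM; try exact: contc.
        apply: contM; first exact: contc.
        by apply: cont_norm; exact: cs.
      by apply: contM; [exact: contc|exact: cc1].
    + by rewrite mulr0 sin0 cos0 normr0; ring.
    + by rewrite s2 c2 normr0; ring.
    + move=> x xI; rewrite /= subr0 /F; apply: (le_trans (ler_normB _ _)).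
      have [_ h1 _] := bK x xI.
      have c10 : 0 <= 1 - cos (k%:R * x) by rewrite subr_ge0 cos_le1.
      rewrite !normrM !normfV (ger0_norm c10) (gtr0_norm k20) (ger0_norm (_ : 0 <= k%:R :> R))// lerD//.
        by rewrite ler_wpM2r ?invr_ge0// ler_wpM2r// Kb.
      by rewrite ler_wpM2r ?invr_ge0 ?(ltW k20)// ler_wpM2r.
  move: E; rewrite RintegralB ?subr0//; [|exact: int_co..] => /eqP; rewrite subr_eq0 => /eqP ->.
  rewrite (_ : 4 * pi * C / _ = C / k%:R ^+ 2 * 2 * (2 * pi - 0)); last by field.
  apply: le_Rintegral_cst => // x xI; rewrite /g normrM ler_pM//.
  by rewrite normrM normfV (gtr0_norm k20) ler_pM2r ?invr_gt0// cK2b.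
- pose g x := K2 x / k%:R ^+ 2 * sin (k%:R * x).
  have ck2 : {in `]0, 2 * pi[, continuous (fun x => K2 x / k%:R ^+ 2)}.
    by move=> x xI; apply: contM; [exact: cK2|exact: contc].
  have gi : mu.-integrable `[0, 2 * pi] (EFin \o g).
    apply: (@ib _ _ (C / k%:R ^+ 2)) => //; last by move=> x; exact: le12.
    move=> x /cK2b xI; rewrite normrM normfV (gtr0_norm k20) ler_pM2r ?invr_gt0//.
  have fi : mu.-integrable `[0, 2 * pi] (EFin \o (fun x => K x * sin (k%:R * x))).
    by apply: ib Kb _ => // x; exact: le12.
  pose F x := K1 x * sin (k%:R * x) / k%:R ^+ 2 - K x * cos (k%:R * x) / k%:R.
  pose L x := - (K0 * cos (k%:R * x) / k%:R).
  have E : \int[mu]_(x in `[0, 2 * pi[) (K x * sin (k%:R * x) + g x) = L (2 * pi) - L 0.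
    apply: (@Rintegral_FTC_approx (fun x => K x * sin (k%:R * x) + g x) F L
      (fun x => C * `|sin (k%:R * x)| / k%:R ^+ 2 + C * bb x / k%:R) 0 (2 * pi) p20).
    + move=> x xI; have ? := dK x xI; have ? := dK1 x xI.
      rewrite /F; apply: is_derive_eq; rewrite /g /GRing.scale/=.
      by field.
    + by move=> x xI; apply: contD; apply: contM;
        [exact: cK|exact: cs|exact: ck2|exact: cs].
    + have := integrableD (measurable_itv _) fi gi (mu := mu).
      by apply: eq_integrable => // x _ /=; rewrite EFinD.
    + move=> x; apply: contN; apply: contM; last exact: contc.
      by apply: contM; [exact: contc|exact: cc].
    + move=> x; apply: contD; apply: contM; try exact: contc.
        apply: contM; first exact: contc.
        by apply: cont_norm; exact: cs.
      by apply: contM; [exact: contc|exact: cbb].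
    + by rewrite mulr0 sin0 /bb normr0; ring.
    + by rewrite s2 /bb normr0; ring.
    + move=> x xI; have [h0 h1 _] := bK x xI.
      rewrite (_ : F x - L x = K1 x * sin (k%:R * x) / k%:R ^+ 2 - (K x - K0) * cos (k%:R * x) / k%:R).
        apply: (le_trans (ler_normB _ _)).
        rewrite !normrM !normfV (gtr0_norm k20) (ger0_norm (_ : 0 <= k%:R :> R))// lerD//.
          by rewrite ler_wpM2r ?invr_ge0 ?(ltW k20)// ler_wpM2r.
        rewrite ler_wpM2r ?invr_ge0// -[leRHS]mulr1 ler_pM//.
      by rewrite /F /L; ring.
  move: E; rewrite /L c2 mulr0 cos0 subrr RintegralD//; [|exact: int_co..] => /eqP; rewrite addr_eq0 => /eqP ->.
  rewrite normrN (_ : 4 * pi * C / _ = C / k%:R ^+ 2 * 2 * (2 * pi - 0)); last by field.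
  apply: le_Rintegral_cst => // x xI; rewrite /g normrM ler_pM// ?le12//.
  by rewrite normrM normfV (gtr0_norm k20) ler_pM2r ?invr_gt0// cK2b.
Qed.

End singular_integrals.

Lemma cont_comp {R : realType} {T : topologicalType} (h : R -> R) (f : T -> R) x :
  continuous_at (f x) h -> continuous_at x f -> continuous_at x (fun y => h (f y)).
Proof. by move=> ch cf; apply: (@continuous_comp _ _ _ f h). Qed.

(** * Integrability of logarithmic singularities *)

Section log_singularity.
Context {R : realType}.
Local Notation mu := (@lebesgue_measure R).

Let p0 : 0 < pi :> R. Proof. exact: pi_gt0. Qed.
Let p20 : 0 < 2 * pi :> R. Proof. by rewrite mulr_gt0. Qed.

(** An integrable majorant, up to constants, of the square of a logarithm that is
    singular at both ends of the period. *)
Definition inv_sqrt_ends (x : R) : R := (Num.sqrt x)^-1 + (Num.sqrt (2 * pi - x))^-1.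

Lemma inv_sqrt_ends_ge0 (x : R) : 0 <= inv_sqrt_ends x.
Proof. by rewrite addr_ge0 ?invr_ge0 ?sqrtr_ge0. Qed.

Lemma integrable_inv_sqrt_ends : mu.-integrable `[0, 2 * pi] (EFin \o inv_sqrt_ends).
Proof.
apply: integrable_oo_cc.
apply: (@ge0_integrable_FTC R inv_sqrt_ends (fun x => 2 * Num.sqrt x - 2 * Num.sqrt (2 * pi - x))).
- exact: p20.
- move=> x; rewrite in_itv/= => /andP[x0 x2].
  have x20 : 0 < 2 * pi - x by rewrite subr_gt0.
  have d1 := is_derive1_sqrt x0; have d2 := is_derive1_sqrt x20.
  have d3 : is_derive x 1 (fun x => 2 * pi - x) (- 1).
    apply: is_derive_eq; ring.
  have d4 := @is_derive1_comp _ Num.sqrt (fun x => 2 * pi - x) x _ _ d2 d3.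
  apply: is_derive_eq; rewrite /inv_sqrt_ends /GRing.scale/=.
  by field; rewrite !gt_eqF ?sqrtr_gt0.
- move=> x; rewrite in_itv/= => /andP[x0 x2].
  have x20 : 0 < 2 * pi - x by rewrite subr_gt0.
  apply: contD; apply: contV; try by rewrite gt_eqF// sqrtr_gt0.
    exact: sqrt_continuous.
  apply: (@continuous_comp _ _ _ (fun x => 2 * pi - x) Num.sqrt); last exact: sqrt_continuous.
  by apply: contB; [exact: contc|].
- by move=> x _; exact: inv_sqrt_ends_ge0.
- apply: continuous_subspaceT => x; apply: contB; apply: contM; try exact: contc.
    exact: sqrt_continuous.
  apply: (@continuous_comp _ _ _ (fun x => 2 * pi - x) Num.sqrt); last exact: sqrt_continuous.
  by apply: contB; [exact: contc|].
Qed.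

(** For y < 1 let s = y^(1/8); then ln y = 8 ln s and |ln s| <= 1 / s, whence 64.
    For y >= 1 the logarithm is at most y <= B. *)
Lemma ln_sqr_le (c x y B : R) : 0 < c -> 0 < x -> c * x ^+ 2 <= y -> y <= B ->
  ln y ^+ 2 <= 64 / Num.sqrt (Num.sqrt c) * (Num.sqrt x)^-1 + B ^+ 2.
Proof.
move=> c0 x0 cy yB.
have y0 : 0 < y by apply: lt_le_trans cy; rewrite mulr_gt0// exprn_gt0.
have main0 : 0 <= 64 / Num.sqrt (Num.sqrt c) * (Num.sqrt x)^-1.
  by rewrite !mulr_ge0 ?invr_ge0 ?sqrtr_ge0.
have [y1|y1] := leP 1 y.
  rewrite -[leLHS]add0r lerD//.
  have l0 : 0 <= ln y by exact: ln_ge0.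
  by rewrite lerXn2r ?nnegrE// ?(le_trans (ltW (ln_sublinear y0)))// (le_trans _ yB)// ltW.
rewrite -[leLHS]addr0 lerD ?sqr_ge0//.
pose s : R := Num.sqrt (Num.sqrt (Num.sqrt y)).
have s0 : 0 < s by rewrite !sqrtr_gt0.
have s2 : s ^+ 2 = Num.sqrt (Num.sqrt y) by rewrite sqr_sqrtr// sqrtr_ge0.
have ys : y = s ^+ 8.
  rewrite (_ : 8 = 2 * (2 * 2))%N// !exprM s2.
  by rewrite sqr_sqrtr ?sqrtr_ge0// sqr_sqrtr// ltW.
have lns : `|ln s| <= s^-1.
  have s1 : s <= 1.
    by rewrite -(@expr_le1 _ 8 s isT (ltW s0)) -ys ltW.
  rewrite ler0_norm ?ln_le0// -lnV ?posrE//.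
  by apply/ltW/ln_sublinear; rewrite invr_gt0.
rewrite ys lnXn// (_ : (ln s *+ 8) ^+ 2 = 64 * ln s ^+ 2); last by ring.
rewrite -mulrA ler_wpM2l// -real_normK ?num_real//.
apply: (@le_trans _ _ (s^-1 ^+ 2)); first by rewrite lerXn2r ?nnegrE ?invr_ge0// ltW.
rewrite exprVn s2 -invfM lef_pV2 ?posrE ?mulr_gt0 ?sqrtr_gt0//.
rewrite -sqrtrM ?sqrtr_ge0// ler_wsqrtr//.
have -> : Num.sqrt c * x = Num.sqrt (c * x ^+ 2) by rewrite sqrtrM ?(ltW c0)// sqrtr_sqr gtr0_norm.
exact: ler_wsqrtr.
Qed.

(** P dominates a multiple of the squared distance to the ends of the period. *)
Definition quadratic_ends (c : R) (P : R -> R) :=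
  forall x : R, x \in `]0, 2 * pi[ ->
    (x <= pi -> c * x ^+ 2 <= P x) /\ (pi <= x -> c * (2 * pi - x) ^+ 2 <= P x).

Lemma quadratic_ends_gt0 (c : R) (P : R -> R) : 0 < c -> quadratic_ends c P ->
  forall x : R, x \in `]0, 2 * pi[ -> 0 < P x.
Proof.
move=> c0 cP x xI; have [h1 h2] := cP x xI; move: xI; rewrite in_itv/= => /andP[x0 x2].
have [/h1|/ltW/h2] := leP x pi; apply: lt_le_trans; rewrite mulr_gt0// exprn_gt0// subr_gt0//.
Qed.

Lemma ln_sqr_le_ends (c B : R) (P : R -> R) (x : R) : 0 < c -> quadratic_ends c P ->
  x \in `]0, 2 * pi[ -> P x <= B ->
  ln (P x) ^+ 2 <= 64 / Num.sqrt (Num.sqrt c) * inv_sqrt_ends x + B ^+ 2.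
Proof.
move=> c0 cP xI PB; have [h1 h2] := cP x xI; move: xI; rewrite in_itv/= => /andP[x0 x2].
have k0 : 0 <= 64 / Num.sqrt (Num.sqrt c) by rewrite mulr_ge0 ?invr_ge0 ?sqrtr_ge0.
have [xp|/ltW xp] := leP x pi.
- apply: (le_trans (ln_sqr_le c0 x0 (h1 xp) PB)).
  by rewrite lerD2r ler_wpM2l// lerDl invr_ge0 sqrtr_ge0.
- have x20 : 0 < 2 * pi - x by rewrite subr_gt0.
  apply: (le_trans (ln_sqr_le c0 x20 (h2 xp) PB)).
  by rewrite lerD2r ler_wpM2l// lerDr invr_ge0 sqrtr_ge0.
Qed.

(** It depends on P only through c and B, so that it is uniform over all base
    points of a curve. *)
Definition log_bound (c B : R) :=
  64 / Num.sqrt (Num.sqrt c) * (\int[mu]_(x in `[0, 2 * pi[) inv_sqrt_ends x) + B ^+ 2 * (2 * pi).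

Lemma integrable_cst_period (a : R) : mu.-integrable `[0, 2 * pi] (EFin \o (fun=> a)).
Proof.
by apply: (@bounded_integrable_oo _ _ _ _ `|a|) => // x _; exact: contc.
Qed.

Lemma integrable_co (f : R -> R) : mu.-integrable `[0, 2 * pi] (EFin \o f) ->
  mu.-integrable `[0, 2 * pi[ (EFin \o f).
Proof. by move=> fi; apply: integrableS fi => //; apply: subset_itvl; rewrite bnd_simp. Qed.

Lemma log_integrable (c B : R) (P : R -> R) : 0 < c -> quadratic_ends c P ->
  {in `]0, 2 * pi[, continuous P} ->
  (forall x : R, x \in `]0, 2 * pi[ -> P x <= B) ->
  [/\ mu.-integrable `[0, 2 * pi] (EFin \o (fun x => ln (P x))),
      mu.-integrable `[0, 2 * pi] (EFin \o (fun x => ln (P x) ^+ 2)) &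
      \int[mu]_(x in `[0, 2 * pi[) (ln (P x) ^+ 2) <= log_bound c B].
Proof.
move=> c0 cP contP PB.
have contl : {in `]0, 2 * pi[, continuous (fun x => ln (P x))}.
  move=> x xI; apply: cont_comp; last exact: contP.
  by apply: continuous_ln; exact: (quadratic_ends_gt0 c0 cP xI).
pose A := 64 / Num.sqrt (Num.sqrt c).
have A0 : 0 <= A by rewrite mulr_ge0 ?invr_ge0 ?sqrtr_ge0.
pose w x := A * inv_sqrt_ends x + B ^+ 2.
have iAw : mu.-integrable `[0, 2 * pi] (EFin \o (fun x => A * inv_sqrt_ends x)).
  have := integrableZl (measurable_itv _) A integrable_inv_sqrt_ends (mu := mu).
  by apply: eq_integrable => // x _ /=; rewrite EFinM.
have iw : mu.-integrable `[0, 2 * pi] (EFin \o w).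
  have := integrableD (measurable_itv _) iAw (integrable_cst_period (B ^+ 2)) (mu := mu).
  by apply: eq_integrable => // x _ /=; rewrite EFinD.
have w0 (x : R) : 0 <= w x by rewrite addr_ge0 ?sqr_ge0// mulr_ge0// inv_sqrt_ends_ge0.
have lw (x : R) : x \in `]0, 2 * pi[ -> ln (P x) ^+ 2 <= w x.
  by move=> xI; apply: ln_sqr_le_ends => //; exact: PB.
have i2 : mu.-integrable `[0, 2 * pi] (EFin \o (fun x => ln (P x) ^+ 2)).
  apply: integrable_oo_cc.
  apply: (@le_integrable _ _ _ mu _ _ _ (EFin \o w)) => //.
  - apply/measurable_EFinP; apply: open_continuous_measurable_fun => // x /set_mem xI.
    by apply: contX; exact: contl.
  - move=> x xI /=; rewrite lee_fin (ger0_norm (sqr_ge0 _)) (ger0_norm (w0 _)).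
    exact: lw.
  - by apply: integrableS iw => //; exact: subset_itv_oo_cc.
split => //.
- apply: integrable_oo_cc.
  apply: (@le_integrable _ _ _ mu _ _ _ (EFin \o (fun x => w x + 1))) => //.
  + apply/measurable_EFinP; apply: open_continuous_measurable_fun => // x /set_mem xI.
    exact: contl.
  + move=> x xI /=; rewrite lee_fin (ger0_norm (addr_ge0 (w0 x) ler01)).
    have := lw x xI; have := w0 x; have := sqr_ge0 (`|ln (P x)| - 1).
    by rewrite sqrrB1 real_normK ?num_real//; lra.
  + apply: (@integrableS _ _ _ mu `[0, 2 * pi]) => //; first exact: subset_itv_oo_cc.
    have := integrableD (measurable_itv _) iw (integrable_cst_period 1) (mu := mu).
    by apply: eq_integrable => // x _ /=; rewrite EFinD.
- have -> : log_bound c B = \int[mu]_(x in `[0, 2 * pi[) w x.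
    rewrite /w RintegralD//; [|exact: integrable_co|exact/integrable_co/integrable_cst_period].
    rewrite RintegralZl//; last exact/integrable_co/integrable_inv_sqrt_ends.
    rewrite Rintegral_cst// [X in fine X]lebesgue_measure_itv/= lte_fin p20 -EFinB subr0.
    by [].
  rewrite -Rintegral_itv_obnd_cbnd; last first.
    by apply: integrableS i2 => //; exact: subset_itv_oo_cc.
  rewrite -[leRHS]Rintegral_itv_obnd_cbnd; last first.
    by apply: integrableS iw => //; exact: subset_itv_oo_cc.
  apply: le_Rintegral => //.
    by apply: integrableS i2 => //; exact: subset_itv_oo_cc.
  by apply: integrableS iw => //; exact: subset_itv_oo_cc.
Qed.

End log_singularity.

(** * The logarithm of the chord length of the unit circle *)

Section circle.
Context {R : realType}.
Local Notation mu := (@lebesgue_measure R).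

Let p0 : 0 < pi :> R. Proof. exact: pi_gt0. Qed.
Let p20 : 0 < 2 * pi :> R. Proof. by rewrite mulr_gt0. Qed.

Lemma C3_cos : C3fun (@cos R) (fun x => - sin x) (fun x => - cos x) (@sin R) 1.
Proof.
split => x.
- exact: is_derive_cos.
- exact: is_deriveN.
- by rewrite -[sin x]opprK; exact: is_deriveN.
- by rewrite !normrN !ler_norml !cos_geN1 !cos_le1 !sin_geN1 !sin_le1.
Qed.

Lemma C3_sin : C3fun (@sin R) (@cos R) (fun x => - sin x) (fun x => - cos x) 1.
Proof.
split => x.
- exact: is_derive_sin.
- exact: is_derive_cos.
- exact: is_deriveN.
- by rewrite !normrN !ler_norml !cos_geN1 !cos_le1 !sin_geN1 !sin_le1.
Qed.

Lemma cosD2 (x : R) : cos (x + 2 * pi) = cos x.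
Proof. by rewrite mulr_natl cosD2pi. Qed.

Lemma sinD2 (x : R) : sin (x + 2 * pi) = sin x.
Proof. by rewrite mulr_natl sinD2pi. Qed.

Lemma cos_sin_inj (s t : R) : 0 <= s < 2 * pi -> 0 <= t < 2 * pi ->
  cos s = cos t -> sin s = sin t -> s = t.
Proof.
move=> /andP[s0 s2] /andP[t0 t2] cst sst.
pose d := (s - t) / 2.
have cd : cos (d *+ 2) = 1.
  rewrite (_ : d *+ 2 = s - t); last by rewrite /d; field.
  by rewrite cosB cst sst -!expr2 cos2Dsin2.
have sd : sin d = 0.
  by apply/eqP; rewrite -sqrf_eq0; move: cd; rewrite cos_mulr2n sin2cos2 => h; apply/eqP; lra.
have [d0|d0|d0] := ltgtP d 0; last by move: d0; rewrite /d => h; lra.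
- have : 0 < sin (- d) by apply: sin_gt0_pi; rewrite /d; apply/andP; split; rewrite /d in d0; lra.
  by rewrite sinN sd oppr0 ltxx.
- have : 0 < sin d by apply: sin_gt0_pi; rewrite /d; apply/andP; split; rewrite /d in d0; lra.
  by rewrite sd ltxx.
Qed.

Lemma chord_circle (t tau : R) : chord cos sin t tau = 2 - 2 * cos tau.
Proof.
rewrite /chord -[in RHS](addKr t tau) (addrC (- t)) cosB.
have := cos2Dsin2 (t + tau); have := cos2Dsin2 t => h1 h2.
lra.
Qed.

Lemma circle_reg (t : R) : 0 < (- sin t) ^+ 2 + cos t ^+ 2.
Proof. by rewrite sqrrN addrC cos2Dsin2. Qed.

Lemma circle_arc : exists2 c : R, 0 < c &
  forall t tau : R, `|tau| <= pi -> c * tau ^+ 2 <= chord cos sin t tau.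
Proof.
apply: (chord_arc ler01 C3_cos C3_sin cosD2 sinD2 _ circle_reg).
exact: cos_sin_inj.
Qed.

Lemma sin_le_norm (u : R) : `|sin u| <= `|u|.
Proof.
have := @mean_value_bound R sin cos 1 u 0 (sin0 R) (@is_derive_sin R) _ ler01.
rewrite expr1 mul1r; apply=> x; rewrite expr0 mulr1 ler_norml.
by rewrite cos_geN1 cos_le1.
Qed.

Lemma cos_le_norm (u : R) : `|1 - cos u| <= `|u|.
Proof.
have d (x : R) : is_derive x 1 (fun x => 1 - cos x) (sin x).
  apply: is_derive_eq; ring.
have := @mean_value_bound R (fun x => 1 - cos x) sin 1 u 0 _ d _ ler01.
rewrite expr1 mul1r; apply; first by rewrite cos0 subrr.
by move=> x; rewrite expr0 mulr1 ler_norml sin_geN1 sin_le1.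
Qed.

End circle.

Section quadratic_ends_chord.
Context {R : realType}.

Lemma chord_quadratic_ends (x y : R -> R) (c t : R) :
  (forall t, x (t + 2 * pi) = x t) -> (forall t, y (t + 2 * pi) = y t) ->
  (forall tau : R, `|tau| <= pi -> c * tau ^+ 2 <= chord x y t tau) ->
  quadratic_ends c (chord x y t).
Proof.
move=> px py H tau; rewrite in_itv/= => /andP[t0 t2]; split => h.
  by apply: H; rewrite ger0_norm// ltW.
rewrite -sqrrN opprB (_ : chord x y t tau = chord x y t (tau - 2 * pi)).
  by apply: H; rewrite ler0_norm; lra.
by rewrite /chord addrA -[x (t + tau - _)]px -[y (t + tau - _)]py !subrK.
Qed.

Local Notation mu := (@lebesgue_measure R).

Lemma is_derive_ln_comp (P : R -> R) (P' x : R) : 0 < P x -> is_derive x 1 P P' ->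
  is_derive x 1 (fun y => ln (P y)) (P' / P x).
Proof.
move=> Px dP; rewrite mulrC.
have dl : is_derive (P x) 1 (@ln R) (P x)^-1 by exact: is_derive1_ln.
exact: (is_derive1_comp dl dP).
Qed.

Lemma intgZ (a b : itv_bound R) (c : R) (f : R -> R) :
  mu.-integrable [set` Interval a b] (EFin \o f) ->
  mu.-integrable [set` Interval a b] (EFin \o (fun x => c * f x)).
Proof.
move=> fi; have := integrableZl (measurable_itv _) c fi (mu := mu).
by apply: eq_integrable => // x _ /=; rewrite EFinM.
Qed.

Lemma intgD (a b : itv_bound R) (f g : R -> R) :
  mu.-integrable [set` Interval a b] (EFin \o f) ->
  mu.-integrable [set` Interval a b] (EFin \o g) ->
  mu.-integrable [set` Interval a b] (EFin \o (fun x => f x + g x)).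
Proof.
move=> fi gi; have := integrableD (measurable_itv _) fi gi (mu := mu).
by apply: eq_integrable => // x _ /=; rewrite EFinD.
Qed.

Lemma intgB (a b : itv_bound R) (f g : R -> R) :
  mu.-integrable [set` Interval a b] (EFin \o f) ->
  mu.-integrable [set` Interval a b] (EFin \o g) ->
  mu.-integrable [set` Interval a b] (EFin \o (fun x => f x - g x)).
Proof.
move=> fi gi; have := integrableB (measurable_itv _) fi gi (mu := mu).
by apply: eq_integrable => // x _ /=; rewrite EFinB.
Qed.

Lemma intgM_bounded (a b : itv_bound R) (f g : R -> R) (C : R) :
  mu.-integrable [set` Interval a b] (EFin \o f) ->
  measurable_fun [set` Interval a b] g ->
  (forall x, [set` Interval a b] x -> `|g x| <= C) ->
  mu.-integrable [set` Interval a b] (EFin \o (fun x => f x * g x)).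
Proof.
move=> fi mg gC.
have mf : measurable_fun [set` Interval a b] f by apply/measurable_EFinP; exact: measurable_int fi.
apply: (@le_integrable _ _ _ mu _ _ _ (EFin \o (fun x => `|C| * f x))) => //.
- by apply/measurable_EFinP; apply: measurable_funM.
- move=> x Ax /=; rewrite lee_fin !normrM mulrC normr_id ler_wpM2r//.
  exact: le_trans (gC x Ax) (ler_norm _).
- exact: intgZ.
Qed.

End quadratic_ends_chord.

Section log_sine.
Context {R : realType}.
Local Notation mu := (@lebesgue_measure R).

Let p0 : 0 < pi :> R. Proof. exact: pi_gt0. Qed.
Let p20 : 0 < 2 * pi :> R. Proof. by rewrite mulr_gt0. Qed.
Let P (x : R) : R := 2 - 2 * cos x.

Lemma is_derive_circle (x : R) : is_derive x 1 P (2 * sin x).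
Proof. by apply: is_derive_eq; rewrite /GRing.scale/=; ring. Qed.

Lemma circle_quadratic_ends : exists2 c : R, 0 < c & quadratic_ends c P.
Proof.
have [c c0 H] := @circle_arc R; exists c => // x.
have := @chord_quadratic_ends R cos sin c 0 cosD2 sinD2 (H 0) x.
by rewrite chord_circle.
Qed.

Lemma circle_le4 (x : R) : P x <= 4.
Proof. by rewrite /P; have := cos_geN1 x; lra. Qed.

Lemma circle_continuous : continuous P.
Proof. move=> x; exact: is_derive_continuous (is_derive_circle x). Qed.

Lemma circle_log_integrable : mu.-integrable `[0, 2 * pi] (EFin \o (fun x => ln (P x))).
Proof.
have [c c0 H] := circle_quadratic_ends.
have [] // := @log_integrable R c 4 P c0 H _ (fun x _ => circle_le4 x).
by move=> x _; exact: circle_continuous.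
Qed.

(** cot (x/2) sin (k x) and cot (x/2) (1 - cos (k x)) as trigonometric polynomials, by [TCE] and [TSE]. *)
Let TC (k : nat) (x : R) := \sum_(j < k) (cos (j.+1%:R * x) + cos (j%:R * x)).
Let TS (k : nat) (x : R) := \sum_(j < k) (sin (j.+1%:R * x) + sin (j%:R * x)).

Let TCE k x : sin x * sin (k%:R * x) = (1 - cos x) * TC k x.
Proof.
elim: k => [|k IH]; first by rewrite /TC big_ord0 mul0r sin0 !mulr0.
rewrite /TC big_ord_recr/= mulrDr -/(TC k x) -IH -natr1 mulrDl mul1r sinD cosD.
set C := cos (k%:R * x); set S := sin (k%:R * x).
have h : sin x * sin x = (1 - cos x) * (1 + cos x) by have := cos2Dsin2 x; rewrite !expr2; lra.
transitivity (sin x * S * cos x + C * (sin x * sin x)); first by ring.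
rewrite h; ring.
Qed.

Let TSE k x : sin x * (1 - cos (k%:R * x)) = (1 - cos x) * TS k x.
Proof.
elim: k => [|k IH]; first by rewrite /TS big_ord0 mul0r cos0 subrr !mulr0.
rewrite /TS big_ord_recr/= -/(TS k x) [RHS]mulrDr -IH -natr1 mulrDl mul1r sinD cosD.
set C := cos (k%:R * x); set S := sin (k%:R * x).
have h : sin x * sin x = (1 - cos x) * (1 + cos x) by have := cos2Dsin2 x; rewrite !expr2; lra.
transitivity (sin x - sin x * C * cos x + S * (sin x * sin x)); first by ring.
rewrite h; ring.
Qed.

Let TCa (k : nat) (x : R) := \sum_(j < k)
  (sin (j.+1%:R * x) / j.+1%:R + if j == 0 :> nat then x else sin (j%:R * x) / j%:R).
Let TSa (k : nat) (x : R) := - \sum_(j < k)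
  (cos (j.+1%:R * x) / j.+1%:R + if j == 0 :> nat then 0 else cos (j%:R * x) / j%:R).

Let is_derive_TCa k (x : R) : is_derive x 1 (TCa k) (TC k x).
Proof.
elim: k => [|k IH].
  rewrite /TC big_ord0 (_ : TCa 0 = cst 0); last by apply/funext => y; rewrite /TCa big_ord0.
  exact: is_derive_cst.
rewrite (_ : TCa k.+1 = fun y => TCa k y + (sin (k.+1%:R * y) / k.+1%:R +
    if k == 0 :> nat then y else sin (k%:R * y) / k%:R)); last first.
  by apply/funext => y; rewrite /TCa big_ord_recr.
have ? := is_derive_sinM k.+1%:R x; have ? := is_derive_sinM k%:R x.
rewrite /TC big_ord_recr/= -/(TC k x).
have [k0|k0] := eqVneq k 0.
  by subst k; apply: is_derive_eq; rewrite /GRing.scale/= mul0r cos0; field.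
apply: is_derive_eq; rewrite /GRing.scale/=; field.
by rewrite nat1r !pnatr_eq0 k0.
Qed.

Let is_derive_TSa k (x : R) : is_derive x 1 (TSa k) (TS k x).
Proof.
elim: k => [|k IH].
  rewrite /TS big_ord0 (_ : TSa 0 = cst 0); last by apply/funext => y; rewrite /TSa big_ord0 oppr0.
  exact: is_derive_cst.
rewrite (_ : TSa k.+1 = fun y => TSa k y - (cos (k.+1%:R * y) / k.+1%:R +
    if k == 0 :> nat then 0 else cos (k%:R * y) / k%:R)); last first.
  by apply/funext => y; rewrite /TSa big_ord_recr/= opprD.
have ? := is_derive_cosM k.+1%:R x; have ? := is_derive_cosM k%:R x.
rewrite /TS big_ord_recr/= -/(TS k x).
have [k0|k0] := eqVneq k 0.
  by subst k; apply: is_derive_eq; rewrite /GRing.scale/= mul0r sin0; field.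
apply: is_derive_eq; rewrite /GRing.scale/=; field.
by rewrite nat1r !pnatr_eq0 k0.
Qed.

Let TCa_period k : (0 < k)%N -> TCa k (2 * pi) - TCa k 0 = 2 * pi.
Proof.
case: k => // k _; rewrite /TCa -sumrB big_ord_recl big1 => [|j _].
  by rewrite /= sin_natM2pi mulr0 sin0 mul0r; ring.
by rewrite /= !sin_natM2pi !mulr0 sin0 !mul0r; ring.
Qed.

Let TSa_period k : TSa k (2 * pi) - TSa k 0 = 0.
Proof.
rewrite /TSa -opprD -sumrB big1 ?oppr0// => j _.
by rewrite !cos_natM2pi !mulr0 cos0 subrr.
Qed.

(** Integration by parts against sin (k x), or against cos (k x) - 1: the
    derivative of ln (2 - 2 cos x) is cot (x/2), and the products of cot (x/2)
    with these functions are trigonometric polynomials. *)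
Lemma log_circle_fourier (k : nat) : (0 < k)%N ->
  \int[mu]_(x in `[0, 2 * pi[) (ln (2 - 2 * cos x) * cos (k%:R * x)) = - (2 * pi / k%:R) /\
  \int[mu]_(x in `[0, 2 * pi[) (ln (2 - 2 * cos x) * sin (k%:R * x)) = 0.
Proof.
move=> k0.
have kn0 : k%:R != 0 :> R by rewrite pnatr_eq0 -lt0n.
have [c c0 cP] := circle_quadratic_ends.
have Pp (x : R) : x \in `]0, 2 * pi[ -> 0 < P x := quadratic_ends_gt0 c0 cP (x := x).
have dlnP (x : R) : x \in `]0, 2 * pi[ -> is_derive x 1 (fun x => ln (P x)) (2 * sin x / P x).
  by move=> /Pp Px; apply: is_derive_ln_comp => //; exact: is_derive_circle.
have clnP : {in `]0, 2 * pi[, continuous (fun x => ln (P x))}.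
  by move=> x /dlnP; exact: is_derive_continuous.
have ck : continuous (fun x : R => cos (k%:R * x)).
  by move=> x; exact: is_derive_continuous (is_derive_cosM _ _).
have sk : continuous (fun x : R => sin (k%:R * x)).
  by move=> x; exact: is_derive_continuous (is_derive_sinM _ _).
have cosb (x : R) : `|cos (k%:R * x)| <= 1 :> R by rewrite ler_norml cos_geN1 cos_le1.
have sinb (x : R) : `|sin (k%:R * x)| <= 1 :> R by rewrite ler_norml sin_geN1 sin_le1.
have ii (g : R -> R) : continuous g -> (forall x, `|g x| <= 1) ->
    mu.-integrable `[0, 2 * pi] (EFin \o (fun x => ln (P x) * g x)).
  move=> cg g1; apply: (@intgM_bounded _ _ _ _ _ 1) => //; first exact: circle_log_integrable.
  by apply: measurable_funTS; exact: continuous_measurable_fun.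
pose H x : R := (4 * (Num.sqrt (Num.sqrt (P x))) + 4 * Num.sqrt (P x)) * (k%:R / Num.sqrt c).
have cH : continuous H.
  have c1 : continuous (fun x => Num.sqrt (P x)).
    by move=> x; apply: cont_comp; [exact: sqrt_continuous|exact: circle_continuous].
  have c2 : continuous (fun x => Num.sqrt (Num.sqrt (P x))).
    by move=> x; apply: cont_comp; [exact: sqrt_continuous|exact: c1].
  by move=> x; apply: contM; [apply: contD; apply: contM; try exact: contc; [exact: c2|exact: c1]|exact: contc].
have H0 : H 0 = 0 by rewrite /H /P cos0 mulr1 subrr !sqrtr0 !mulr0 addr0 mul0r.
have H2 : H (2 * pi) = 0 by rewrite -H0 -[2 * pi]add0r /H /P cosD2.
have vanish (x u : R) : x \in `]0, 2 * pi[ -> `|u| <= `|k%:R * x| -> `|u| <= `|k%:R * (x - 2 * pi)| ->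
    `|ln (P x) * u| <= H x.
  move=> xI u1 u2.
  have Px := Pp x xI.
  have uP : `|u| <= Num.sqrt (P x) * (k%:R / Num.sqrt c).
    have cs0 : 0 < Num.sqrt c by rewrite sqrtr_gt0.
    have aux (z : R) : `|u| <= `|k%:R * z| -> c * z ^+ 2 <= P x ->
        `|u| <= Num.sqrt (P x) * (k%:R / Num.sqrt c).
      move=> uz cz; apply: (le_trans uz); rewrite normrM ger0_norm// mulrCA ler_wpM2l//.
      rewrite ler_pdivlMr// -sqrtr_sqr -sqrtrM ?sqr_ge0// ler_wsqrtr// mulrC//.
    have [h1 h2] := cP x xI.
    have [/h1|/ltW/h2] := leP x pi; first exact: aux.
    by rewrite -sqrrN opprB; exact: aux.
  have lnb : `|ln (P x)| <= 4 / Num.sqrt (Num.sqrt (P x)) + 4.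
    have [P1|P1] := leP 1 (P x).
      rewrite ger0_norm ?ln_ge0// -[leLHS]add0r lerD// ?divr_ge0 ?sqrtr_ge0//.
      by rewrite (le_trans (ltW (ln_sublinear Px)))// circle_le4.
    pose s : R := Num.sqrt (Num.sqrt (P x)).
    have s0 : 0 < s by rewrite !sqrtr_gt0.
    have Ps : P x = s ^+ 4.
      by rewrite (_ : 4 = 2 * 2)%N// exprM !sqr_sqrtr ?sqrtr_ge0// ltW.
    have s1 : s <= 1 by rewrite -(@expr_le1 _ 4 s isT (ltW s0)) -Ps ltW.
    rewrite -/s Ps lnXn// (_ : ln s *+ 4 = 4 * ln s); last by ring.
    rewrite normrM ger0_norm// -[leLHS]addr0 lerD//.
    rewrite ler_wpM2l// ler0_norm ?ln_le0// -lnV ?posrE//.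
    by apply/ltW/ln_sublinear; rewrite invr_gt0.
  rewrite normrM; apply: (le_trans (ler_pM _ _ lnb uP)) => //.
  rewrite /H mulrA ler_wpM2r ?divr_ge0 ?sqrtr_ge0// mulrDl lerD2r.
  rewrite -mulrA ler_wpM2l//.
  have s0 : 0 < Num.sqrt (Num.sqrt (P x)) by rewrite !sqrtr_gt0.
  by rewrite mulrC ler_pdivrMr// -expr2 sqr_sqrtr ?sqrtr_ge0.
split.
- have E : \int[mu]_(x in `[0, 2 * pi[) (k%:R * (ln (P x) * cos (k%:R * x))) =
      - TCa k (2 * pi) - - TCa k 0.
    apply: (@Rintegral_FTC_approx R (fun x => k%:R * (ln (P x) * cos (k%:R * x)))
      (fun x => ln (P x) * sin (k%:R * x) - TCa k x) (fun x => - TCa k x) H 0 (2 * pi) p20).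
    + move=> x xI; have ? := dlnP x xI; have ? := is_derive_sinM k%:R x.
      have ? := is_derive_TCa k x.
      apply: is_derive_eq; rewrite /GRing.scale/=.
      have Pn : 1 - cos x != 0.
        have := Pp x xI; rewrite /P => h; rewrite gt_eqF//; lra.
      have -> : TC k x = sin x * sin (k%:R * x) / (1 - cos x).
        by rewrite TCE mulrC mulrA mulVf// mul1r.
      rewrite /P; field.
      by rewrite Pn gt_eqF//; exact: (Pp x xI).
    + by move=> x xI; apply: contM; [exact: contc|apply: contM; [exact: clnP|exact: ck]].
    + exact: intgZ (ii _ ck cosb).
    + move=> x; apply: contN; exact: is_derive_continuous (is_derive_TCa k x).
    + exact: cH.
    + exact: H0.
    + exact: H2.
    + move=> x xI; rewrite opprK subrK; apply: vanish => //; first exact: sin_le_norm.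
      rewrite (_ : sin (k%:R * x) = sin (k%:R * (x - 2 * pi))); first exact: sin_le_norm.
      by rewrite mulrBr sinB sin_natM2pi cos_natM2pi mulr1 mulr0 subr0.
  move: E; rewrite RintegralZl//; last exact/integrable_co/ii.
  rewrite -opprD TCa_period// => E; apply: (mulfI kn0); rewrite E; field.
  exact: kn0.
- have E : \int[mu]_(x in `[0, 2 * pi[) (k%:R * (ln (P x) * sin (k%:R * x))) =
      - TSa k (2 * pi) - - TSa k 0.
    apply: (@Rintegral_FTC_approx R (fun x => k%:R * (ln (P x) * sin (k%:R * x)))
      (fun x => ln (P x) * (1 - cos (k%:R * x)) - TSa k x) (fun x => - TSa k x) H 0 (2 * pi) p20).
    + move=> x xI; have ? := dlnP x xI; have ? := is_derive_cosM k%:R x.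
      have ? := is_derive_TSa k x.
      apply: is_derive_eq; rewrite /GRing.scale/=.
      have Pn : 1 - cos x != 0.
        have := Pp x xI; rewrite /P => h; rewrite gt_eqF//; lra.
      have -> : TS k x = sin x * (1 - cos (k%:R * x)) / (1 - cos x).
        by rewrite TSE mulrC mulrA mulVf// mul1r.
      rewrite /P; field.
      by rewrite Pn gt_eqF//; exact: (Pp x xI).
    + by move=> x xI; apply: contM; [exact: contc|apply: contM; [exact: clnP|exact: sk]].
    + exact: intgZ (ii _ sk sinb).
    + move=> x; apply: contN; exact: is_derive_continuous (is_derive_TSa k x).
    + exact: cH.
    + exact: H0.
    + exact: H2.
    + move=> x xI.
      rewrite (_ : _ - TSa k x - - TSa k x = ln (P x) * (1 - cos (k%:R * x))); last by ring.
      apply: vanish => //; first exact: cos_le_norm.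
      rewrite (_ : cos (k%:R * x) = cos (k%:R * (x - 2 * pi))); first exact: cos_le_norm.
      by rewrite mulrBr cosB sin_natM2pi cos_natM2pi mulr1 mulr0 addr0.
  move: E; rewrite RintegralZl//; last exact/integrable_co/ii.
  rewrite -opprD TSa_period oppr0 => /eqP; rewrite mulf_eq0 (negbTE kn0)/= => /eqP.
  exact.
Qed.

End log_sine.

(** * The logarithm of the chord length of a curve *)

Section log_ratio.
Context {R : realType}.
Local Notation mu := (@lebesgue_measure R).

Let p0 : 0 < pi :> R. Proof. exact: pi_gt0. Qed.
Let p20 : 0 < 2 * pi :> R. Proof. by rewrite mulr_gt0. Qed.

Lemma is_derive_div (f g : R -> R) (f' g' x : R) : g x != 0 ->
  is_derive x 1 f f' -> is_derive x 1 g g' ->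
  is_derive x 1 (fun y => f y / g y) (f' / g x - f x * g' / g x ^+ 2).
Proof.
move=> gx0 df dg; have dV := is_deriveV gx0 dg.
apply: is_derive_eq; rewrite /GRing.scale/=.
by field.
Qed.

Lemma ln_lipschitz (a b m : R) : 0 < m -> m <= a -> m <= b -> `|ln a - ln b| <= `|a - b| / m.
Proof.
move=> m0.
wlog ab : a b / b <= a.
  move=> H ma mb; have [/H|/ltW/H] := leP b a; first exact.
  by rewrite distrC [`|a - b|]distrC; exact.
move=> ma mb; have b0 : 0 < b by apply: lt_le_trans mb.
have a0 : 0 < a by apply: lt_le_trans ma.
rewrite [`|a - b|]ger0_norm ?subr_ge0//.
rewrite ger0_norm ?subr_ge0 ?ler_ln ?posrE// -ln_div ?posrE//.
have -> : a / b = 1 + (a - b) / b by field; rewrite gt_eqF.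
have d0 : 0 <= (a - b) / b by rewrite divr_ge0 ?subr_ge0// ltW.
apply: (le_trans (le_ln1Dx _)); first by apply: lt_le_trans d0; rewrite oppr_lt0.
by rewrite ler_wpM2l ?subr_ge0// lef_pV2.
Qed.

Lemma C3fun_periodic (f f1 f2 f3 : R -> R) (M T : R) : C3fun f f1 f2 f3 M ->
  (forall t, f (t + T) = f t) ->
  (forall t, f1 (t + T) = f1 t) /\ (forall t, f2 (t + T) = f2 t).
Proof.
move=> [d0 d1 _ _] pf.
have E (g g1 : R -> R) : (forall t : R, is_derive t 1 g (g1 t)) ->
    (forall t, g (t + T) = g t) -> forall t, g1 (t + T) = g1 t.
  move=> dg pg t.
  have F u : derive1 g u = g1 u by rewrite derive1E; move: (dg u) => /@derive_val.
  by rewrite -!F periodic_derive// => u; have [] := dg u.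
have p1 := E _ _ d0 pf; split => //; exact: E d1 p1.
Qed.

Variables (x x1 x2 x3 y y1 y2 y3 : R -> R) (M : R).
Hypotheses (M0 : 0 <= M) (Cx : C3fun x x1 x2 x3 M) (Cy : C3fun y y1 y2 y3 M).
Hypotheses (px : forall t, x (t + 2 * pi) = x t) (py : forall t, y (t + 2 * pi) = y t).
Hypothesis inj : forall s t : R, 0 <= s < 2 * pi -> 0 <= t < 2 * pi -> x s = x t -> y s = y t -> s = t.
Hypothesis reg : forall t : R, 0 < x1 t ^+ 2 + y1 t ^+ 2.

Let L1 (t tau : R) := dchord x x1 y y1 t tau / chord x y t tau.
Let L2 (t tau : R) := ddchord x x1 x2 y y1 y2 t tau / chord x y t tau - L1 t tau ^+ 2.

Lemma chord_shift (t tau : R) : [/\ chord x y t (tau - 2 * pi) = chord x y t tau,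
  dchord x x1 y y1 t (tau - 2 * pi) = dchord x x1 y y1 t tau &
  ddchord x x1 x2 y y1 y2 t (tau - 2 * pi) = ddchord x x1 x2 y y1 y2 t tau].
Proof.
have [px1 px2] := C3fun_periodic Cx px; have [py1 py2] := C3fun_periodic Cy py.
have sh (f : R -> R) : (forall t, f (t + 2 * pi) = f t) -> f (t + (tau - 2 * pi)) = f (t + tau).
  by move=> pf; rewrite addrA -[LHS]pf subrK.
by rewrite /chord /dchord /ddchord !sh.
Qed.

Lemma chord_continuous (t : R) : continuous (chord x y t).
Proof. by move=> tau; exact: is_derive_continuous (is_derive_chord Cx Cy t tau). Qed.

Let ddchord_continuous (t : R) : continuous (ddchord x x1 x2 y y1 y2 t).
Proof.
have [dx0 dx1 dx2 _] := Cx; have [dy0 dy1 dy2 _] := Cy.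
have c (f f' : R -> R) (d : forall x : R, is_derive x 1 f (f' x)) u :=
  is_derive_continuous (is_derive_translate t u d).
move=> u; rewrite /ddchord; apply: contM; first exact: contc.
by apply: contD; apply: contD; [apply: contX|apply: contM; first apply: contB|
  apply: contX|apply: contM; first apply: contB]; try exact: contc;
  [exact: (c _ _ dx1)|exact: (c _ _ dx0)|exact: (c _ _ dx2)|exact: (c _ _ dy1)|exact: (c _ _ dy0)|exact: (c _ _ dy2)].
Qed.

Lemma log_chord_derivatives (t tau : R) : chord x y t tau != 0 -> 0 < chord x y t tau ->
  [/\ is_derive tau 1 (fun tau => ln (chord x y t tau)) (L1 t tau),
     is_derive tau 1 (L1 t) (L2 t tau) & continuous_at tau (L2 t)].
Proof.
move=> n0 P0.
have d1 := is_derive_chord Cx Cy t tau; have d2 := is_derive_dchord Cx Cy t tau.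
have dL1 : is_derive tau 1 (L1 t) (L2 t tau).
  have := is_derive_div n0 d2 d1; rewrite -/(L1 t).
  by move=> D; apply: is_derive_eq; rewrite /L2 /L1; field.
split=> //; first exact: is_derive_ln_comp.
have cP : continuous_at tau (fun u => (chord x y t u)^-1).
  by apply: contV => //; exact: chord_continuous.
apply: contB; first by apply: contM => //; exact: ddchord_continuous.
by apply: contX; exact: is_derive_continuous dL1.
Qed.

(** The same constant K0 serves for tau > 0 and tau < 0: the limit of
    ln P - ln tau^2 at 0 is the logarithm of the squared speed. *)
Lemma log_chord_bounds : exists2 C : R, 0 <= C & forall t : R, exists K0 : R,
  forall tau : R, tau != 0 -> `|tau| <= pi ->
  [/\ `|ln (chord x y t tau) - ln (tau ^+ 2) - K0| <= C * `|tau|,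
      `|L1 t tau - 2 / tau| <= C & `|L2 t tau + 2 / tau ^+ 2| <= C].
Proof.
have [c c0 cP] := chord_arc M0 Cx Cy px py inj reg.
have [m m0 mS] := speed_lower_bound Cx Cy px py reg.
have [C C0 H] := chord_log_bounds M0 Cx Cy c0.
pose m' := Num.min c m.
have m'0 : 0 < m' by rewrite lt_min c0.
exists (C + C / m'); first by rewrite addr_ge0// divr_ge0// ltW.
move=> t; exists (ln (x1 t ^+ 2 + y1 t ^+ 2)) => tau tau0 taupi.
have [h1 h2 h3] := H t tau tau0 (cP t tau taupi).
have t20 : 0 < tau ^+ 2 by rewrite exprn_even_gt0.
have Cm : 0 <= C / m' by rewrite divr_ge0// ltW.
have P0 : 0 < chord x y t tau by apply: lt_le_trans (cP t tau taupi); rewrite mulr_gt0.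
split.
- rewrite -ln_div ?posrE//; apply: (le_trans (ln_lipschitz m'0 _ _)).
  + by rewrite ge_min ler_pdivlMr// cP.
  + by rewrite ge_min mS orbT.
  + apply: (@le_trans _ _ (C * `|tau| / m')); first by rewrite ler_wpM2r// invr_ge0 ltW.
    by rewrite [leRHS]mulrDl mulrAC lerDr mulr_ge0.
- by apply: (le_trans h1); rewrite lerDl.
- by rewrite /L2 /L1; apply: (le_trans h2); rewrite lerDl.
Qed.

End log_ratio.

Section kernel_fourier.
Context {R : realType}.
Local Notation mu := (@lebesgue_measure R).

Let p0 : 0 < pi :> R. Proof. exact: pi_gt0. Qed.
Let p20 : 0 < 2 * pi :> R. Proof. by rewrite mulr_gt0. Qed.

Variables (x x1 x2 x3 y y1 y2 y3 : R -> R) (M : R).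
Hypotheses (M0 : 0 <= M) (Cx : C3fun x x1 x2 x3 M) (Cy : C3fun y y1 y2 y3 M).
Hypotheses (px : forall t, x (t + 2 * pi) = x t) (py : forall t, y (t + 2 * pi) = y t).
Hypothesis inj : forall s t : R, 0 <= s < 2 * pi -> 0 <= t < 2 * pi -> x s = x t -> y s = y t -> s = t.
Hypothesis reg : forall t : R, 0 < x1 t ^+ 2 + y1 t ^+ 2.

Lemma chord_bounded : exists B : R, forall t tau, chord x y t tau <= B.
Proof.
have [dx _ _ _] := Cx; have [dy _ _ _] := Cy.
have [B1 [B10 H1]] := periodic_bounded p20 px (fun t => is_derive_continuous (dx t)).
have [B2 [B20 H2]] := periodic_bounded p20 py (fun t => is_derive_continuous (dy t)).
exists ((2 * B1) ^+ 2 + (2 * B2) ^+ 2) => t tau; rewrite /chord.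
have aux (a b B : R) : `|a| <= B -> `|b| <= B -> (a - b) ^+ 2 <= (2 * B) ^+ 2.
  move=> aB bB; rewrite -[leLHS]real_normK ?num_real// lerXn2r ?nnegrE//.
    by rewrite mulr_ge0// (le_trans _ aB).
  by apply: (le_trans (ler_normB _ _)); lra.
by rewrite lerD// aux.
Qed.

Lemma log_chord_integrable : exists A : R, forall t : R,
  [/\ mu.-integrable `[0, 2 * pi] (EFin \o (fun tau => ln (chord x y t tau))),
      mu.-integrable `[0, 2 * pi] (EFin \o (fun tau => ln (chord x y t tau) ^+ 2)) &
      \int[mu]_(tau in `[0, 2 * pi[) (ln (chord x y t tau) ^+ 2) <= A].
Proof.
have [c c0 cP] := chord_arc M0 Cx Cy px py inj reg.
have [B HB] := chord_bounded.
exists (log_bound c B) => t; apply: log_integrable => //.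
- exact: chord_quadratic_ends (cP t).
- by move=> tau _; exact: chord_continuous Cx Cy _ _.
Qed.

(** After subtraction of the logarithm for the unit circle the singularities at
    both ends of the period cancel, and the difference falls under
    [fourier_decay]. *)
Lemma log_chord_fourier : exists2 C : R, 0 <= C & forall (t : R) (k : nat), (0 < k)%N ->
  `|\int[mu]_(tau in `[0, 2 * pi[) (ln (chord x y t tau) * cos (k%:R * tau)) + 2 * pi / k%:R|
     <= C / k%:R ^+ 2 /\
  `|\int[mu]_(tau in `[0, 2 * pi[) (ln (chord x y t tau) * sin (k%:R * tau))| <= C / k%:R ^+ 2.
Proof.
have [C1 C10 H1] := log_chord_bounds M0 Cx Cy px py inj reg.
have [C2 C20 H2] := log_chord_bounds ler01 (@C3_cos R) (@C3_sin R) cosD2 sinD2 (@cos_sin_inj R) (@circle_reg R).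
exists (4 * pi * (C1 + C2)); first by apply: mulr_ge0; [rewrite mulr_ge0// ltW|exact: addr_ge0].
move=> t k k0.
have [A1 H1t] := H1 t; have [A2 H2t] := H2 t.
pose Q := chord (@cos R) sin t.
pose K tau := ln (chord x y t tau) - ln (Q tau).
pose L1 tau := dchord x x1 y y1 t tau / chord x y t tau.
pose L1c tau := dchord (@cos R) (fun x => - sin x) sin cos t tau / Q tau.
pose L2 tau := ddchord x x1 x2 y y1 y2 t tau / chord x y t tau - L1 tau ^+ 2.
pose L2c tau := ddchord (@cos R) (fun x => - sin x) (fun x => - cos x) sin cos (fun x => - sin x) t tau / Q tau
   - L1c tau ^+ 2.
have P0 tau : tau \in `]0, 2 * pi[ -> 0 < chord x y t tau.
  by rewrite in_itv/=; exact: (chord_gt0 px py inj).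
have Q0 tau : tau \in `]0, 2 * pi[ -> 0 < Q tau.
  by rewrite in_itv/=; exact: (chord_gt0 cosD2 sinD2 (@cos_sin_inj R)).
have near (tau : R) : tau != 0 -> `|tau| <= pi ->
    [/\ `|K tau - (A1 - A2)| <= (C1 + C2) * `|tau|,
        `|L1 tau - L1c tau| <= C1 + C2 & `|L2 tau - L2c tau| <= C1 + C2].
  move=> tau0 taupi; have [a1 a2 a3] := H1t tau tau0 taupi; have [b1 b2 b3] := H2t tau tau0 taupi.
  split.
  - rewrite (_ : K tau - _ = (ln (chord x y t tau) - ln (tau ^+ 2) - A1) -
      (ln (Q tau) - ln (tau ^+ 2) - A2)); last by rewrite /K; ring.
    by apply: (le_trans (ler_normB _ _)); rewrite mulrDl lerD.
  - rewrite (_ : L1 tau - _ = (L1 tau - 2 / tau) - (L1c tau - 2 / tau)); last by ring.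
    by apply: (le_trans (ler_normB _ _)); rewrite lerD.
  - rewrite (_ : L2 tau - _ = (L2 tau + 2 / tau ^+ 2) - (L2c tau + 2 / tau ^+ 2)); last by ring.
    by apply: (le_trans (ler_normB _ _)); rewrite lerD.
have C120 : 0 <= C1 + C2 by rewrite addr_ge0.
have bK tau : tau \in `]0, 2 * pi[ -> [/\ `|K tau - (A1 - A2)| <= (C1 + C2) * (tau * (2 * pi - tau)),
      `|L1 tau - L1c tau| <= C1 + C2 & `|L2 tau - L2c tau| <= C1 + C2].
  rewrite in_itv/= => /andP[t0 t2].
  have pi1 : 1 <= pi :> R by have := pi_ge2 R; lra.
  have [tp|tp] := leP tau pi.
    have [||h1 h2 h3] := near tau; [by rewrite gt_eqF|by rewrite ger0_norm// ltW|].
    split=> //; apply: (le_trans h1); rewrite ler_wpM2l// ger0_norm ?(ltW t0)//.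
    rewrite -[leLHS]mulr1 ler_wpM2l ?(ltW t0)//; lra.
  have [||h1 h2 h3] := near (tau - 2 * pi); [by rewrite lt_eqF// subr_lt0|by rewrite ler0_norm; lra|].
  have [e1 e2 e3] := chord_shift Cx Cy px py t tau.
  have [f1 f2 f3] := chord_shift (@C3_cos R) (@C3_sin R) cosD2 sinD2 t tau.
  move: h1 h2 h3; rewrite /K /L2 /L2c /L1 /L1c /Q e1 e2 e3 f1 f2 f3 => h1 h2 h3.
  split=> //; apply: (le_trans h1); rewrite ler_wpM2l// ler0_norm; last lra.
  rewrite opprB -[leLHS]mul1r ler_wpM2r//; lra.
have D1 tau (tI : tau \in `]0, 2 * pi[) :=
  log_chord_derivatives Cx Cy (lt0r_neq0 (P0 tau tI)) (P0 tau tI).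
have D2 tau (tI : tau \in `]0, 2 * pi[) :=
  log_chord_derivatives (@C3_cos R) (@C3_sin R) (lt0r_neq0 (Q0 tau tI)) (Q0 tau tI).
have [||| F1 F2] := @fourier_decay R K (fun tau => L1 tau - L1c tau) (fun tau => L2 tau - L2c tau)
    (A1 - A2) (C1 + C2) k k0 C120 _ _ _ bK.
- by move=> tau tI; have [? _ _] := D1 tau tI; have [? _ _] := D2 tau tI; apply: is_derive_eq.
- by move=> tau tI; have [_ ? _] := D1 tau tI; have [_ ? _] := D2 tau tI; apply: is_derive_eq.
- by move=> tau tI; have [_ _ ?] := D1 tau tI; have [_ _ ?] := D2 tau tI; apply: contB.
have [A /(_ t)[il _ _]] := log_chord_integrable.
have ilc : mu.-integrable `[0, 2 * pi] (EFin \o (fun tau => ln (Q tau))).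
  have -> : (fun tau => ln (Q tau)) = (fun tau => ln (2 - 2 * cos tau)).
    by apply/funext => tau; rewrite /Q chord_circle.
  exact: circle_log_integrable.
have ck : continuous (fun x : R => cos (k%:R * x)).
  by move=> z; exact: is_derive_continuous (is_derive_cosM _ _).
have sk : continuous (fun x : R => sin (k%:R * x)).
  by move=> z; exact: is_derive_continuous (is_derive_sinM _ _).
have cosb (z : R) : `|cos (k%:R * z)| <= 1 :> R by rewrite ler_norml cos_geN1 cos_le1.
have sinb (z : R) : `|sin (k%:R * z)| <= 1 :> R by rewrite ler_norml sin_geN1 sin_le1.
have ii (f g : R -> R) : mu.-integrable `[0, 2 * pi] (EFin \o f) -> continuous g -> (forall x, `|g x| <= 1) ->
    mu.-integrable `[0, 2 * pi[ (EFin \o (fun x => f x * g x)).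
  move=> fi cg g1; apply: (@intgM_bounded _ _ _ _ _ 1) => //; first exact: integrable_co.
  by apply: measurable_funTS; exact: continuous_measurable_fun.
have split_int (g : R -> R) : continuous g -> (forall x, `|g x| <= 1) ->
   \int[mu]_(tau in `[0, 2 * pi[) (ln (chord x y t tau) * g tau) =
   \int[mu]_(tau in `[0, 2 * pi[) (K tau * g tau) + \int[mu]_(tau in `[0, 2 * pi[) (ln (2 - 2 * cos tau) * g tau).
  move=> cg g1; rewrite -RintegralD//.
  - apply: eq_Rintegral => tau _; rewrite /K /Q chord_circle; ring.
  - apply: ii => //; exact: intgB.
  - apply: ii => //; exact: circle_log_integrable.
have [G1 G2] := @log_circle_fourier R k k0.
rewrite !split_int// G1 G2 addr0 subrK; split; first exact: F1.
exact: F2.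
Qed.

End kernel_fourier.

(** * Kernels of finite rank and their energies *)

Section kernels.
Context {R : realType}.
Local Notation mu := (@lebesgue_measure R).
Local Notation D := (`[0, 2 * pi[%classic : set R).
Local Notation intg f := (mu.-integrable D (EFin \o f)).

Let p0 : 0 < pi :> R. Proof. exact: pi_gt0. Qed.
Let p20 : 0 < 2 * pi :> R. Proof. by rewrite mulr_gt0. Qed.

Implicit Types (u v a b : R -> R) (F G : R -> R -> R).

(** The integral over a period. *)
Definition pint (f : R -> R) : R := \int[mu]_(x in D) f x.

Lemma cont_intg (f : R -> R) : continuous f -> intg f.
Proof.
move=> cf; apply: integrable_co; apply: continuous_compact_integrable; first exact: segment_compact.
exact: continuous_subspaceT.
Qed.

Lemma pintD (f g : R -> R) : intg f -> intg g -> pint (fun x => f x + g x) = pint f + pint g.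
Proof. by move=> fi gi; rewrite /pint RintegralD. Qed.

Lemma pintB (f g : R -> R) : intg f -> intg g -> pint (fun x => f x - g x) = pint f - pint g.
Proof. by move=> fi gi; rewrite /pint RintegralB. Qed.

Lemma pintZ (c : R) (f : R -> R) : intg f -> pint (fun x => c * f x) = c * pint f.
Proof. by move=> fi; rewrite /pint RintegralZl. Qed.

Lemma pint_cst (c : R) : pint (fun=> c) = c * (2 * pi).
Proof. by rewrite /pint Rintegral_cst// [X in fine X]lebesgue_measure_itv/= lte_fin p20 -EFinB subr0. Qed.

Lemma le_pint (f g : R -> R) : intg f -> intg g -> (forall x, x \in `[0, 2 * pi[ -> f x <= g x) ->
  pint f <= pint g.
Proof. by move=> fi gi fg; apply: le_Rintegral. Qed.

Lemma pint_ge0 (f : R -> R) : (forall x, x \in `[0, 2 * pi[ -> 0 <= f x) -> 0 <= pint f.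
Proof. by move=> f0; apply: Rintegral_ge0. Qed.

Lemma eq_pint (f g : R -> R) : (forall x, x \in `[0, 2 * pi[ -> f x = g x) -> pint f = pint g.
Proof. by move=> fg; apply: eq_Rintegral => x /set_mem; exact: fg. Qed.

(** For finite sums of products u(t) v(s) the order of integration can be
    exchanged by linearity, without product measures. *)
Inductive finite_rank : (R -> R -> R) -> Prop :=
| finite_rank1 (u v : R -> R) : continuous u -> continuous v -> finite_rank (fun t s => u t * v s)
| finite_rankD F G : finite_rank F -> finite_rank G -> finite_rank (fun t s => F t s + G t s).

Definition pint2 (F : R -> R -> R) : R := pint (fun t => pint (F t)).

Lemma finite_rank_continuous F : finite_rank F ->
  (forall t, continuous (F t)) /\ continuous (fun t => pint (F t)).
Proof.
elim=> [u v cu cv|{}F G _ [cF cF'] _ [cG cG']]; split.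
- by move=> t s; apply: contM; [exact: contc|exact: cv].
- have -> : (fun t => pint (fun s => u t * v s)) = (fun t => u t * pint v).
    by apply/funext => t; rewrite pintZ//; exact: cont_intg.
  by move=> t; apply: contM; [exact: cu|exact: contc].
- by move=> t s; apply: contD; [exact: cF|exact: cG].
- have -> : (fun t => pint (fun s => F t s + G t s)) = (fun t => pint (F t) + pint (G t)).
    by apply/funext => t; rewrite pintD//; exact: cont_intg.
  by move=> t; apply: contD; [exact: cF'|exact: cG'].
Qed.

Lemma pint2D F G : finite_rank F -> finite_rank G ->
  pint2 (fun t s => F t s + G t s) = pint2 F + pint2 G.
Proof.
move=> /finite_rank_continuous[cF cF'] /finite_rank_continuous[cG cG'].
rewrite /pint2 -pintD; [|exact: cont_intg..].
by apply: eq_pint => t _; rewrite pintD//; exact: cont_intg.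
Qed.

Lemma pint2M u v : continuous u -> continuous v -> pint2 (fun t s => u t * v s) = pint u * pint v.
Proof.
move=> cu cv; rewrite mulrC -pintZ; last exact: cont_intg.
by apply: eq_pint => t _; rewrite mulrC pintZ//; exact: cont_intg.
Qed.

Lemma pint2_swap F : finite_rank F -> pint2 (fun t s => F s t) = pint2 F.
Proof.
have sw G : finite_rank G -> finite_rank (fun t s => G s t).
  elim=> [u v cu cv|{}G H _ IG _ IH]; last exact: finite_rankD.
  rewrite (_ : (fun t s => _) = (fun t s => v t * u s)); first exact: finite_rank1.
  by apply/funext => t; apply/funext => s; rewrite mulrC.
elim=> [u v cu cv|{}F G fF IF fG IG].
  rewrite (_ : (fun t s => _) = (fun t s => v t * u s)).
    by rewrite !pint2M// mulrC.
  by apply/funext => t; apply/funext => s; rewrite mulrC.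
by rewrite (@pint2D (fun t s => F s t) (fun t s => G s t)) ?pint2D ?IF ?IG//; exact: sw.
Qed.

Lemma le_pint2 F G : finite_rank F -> finite_rank G ->
  (forall t s, t \in `[0, 2 * pi[ -> s \in `[0, 2 * pi[ -> F t s <= G t s) -> pint2 F <= pint2 G.
Proof.
move=> /finite_rank_continuous[cF cF'] /finite_rank_continuous[cG cG'] FG.
apply: le_pint; [exact: cont_intg..|move=> t tD; apply: le_pint; [exact: cont_intg..|]].
by move=> s sD; exact: FG.
Qed.

Lemma finite_rankM F G : finite_rank F -> finite_rank G -> finite_rank (fun t s => F t s * G t s).
Proof.
move=> fF fG; elim: fF => [u v cu cv|{}F F' _ IF _ IF']; last first.
  rewrite (_ : (fun t s => _) = (fun t s => F t s * G t s + F' t s * G t s)); first exact: finite_rankD.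
  by apply/funext => t; apply/funext => s; rewrite mulrDl.
elim: fG => [u' v' cu' cv'|{}G G' _ IG _ IG']; last first.
  rewrite (_ : (fun t s => _) = (fun t s => u t * v s * G t s + u t * v s * G' t s)); first exact: finite_rankD.
  by apply/funext => t; apply/funext => s; rewrite mulrDr.
rewrite (_ : (fun t s => _) = (fun t s => (u t * u' t) * (v s * v' s))).
  apply: (@finite_rank1 (fun t => u t * u' t) (fun s => v s * v' s)) => t; apply: contM => //;
  by [exact: cu|exact: cu'|exact: cv|exact: cv'].
by apply/funext => t; apply/funext => s; rewrite mulrACA.
Qed.

Lemma finite_rank_l u : continuous u -> finite_rank (fun t _ => u t).
Proof.
move=> cu; rewrite (_ : (fun t _ => _) = (fun t s => u t * (fun=> 1) s)).
  by apply: finite_rank1 => // t; exact: contc.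
by apply/funext => t; apply/funext => s; rewrite mulr1.
Qed.

Lemma finite_rank_r u : continuous u -> finite_rank (fun _ s => u s).
Proof.
move=> cu; rewrite (_ : (fun _ s => _) = (fun t s => (fun=> 1) t * u s)).
  by apply: finite_rank1 => // t; exact: contc.
by apply/funext => t; apply/funext => s; rewrite mul1r.
Qed.

Lemma finite_rankZ c F : finite_rank F -> finite_rank (fun t s => c * F t s).
Proof. by move=> fF; apply: finite_rankM => //; apply: finite_rank_l => t; exact: contc. Qed.

Lemma pint2Z c F : finite_rank F -> pint2 (fun t s => c * F t s) = c * pint2 F.
Proof.
move=> /finite_rank_continuous[cF cF'].
rewrite /pint2 -pintZ; last exact: cont_intg.
by apply: eq_pint => t _; rewrite pintZ//; exact: cont_intg.
Qed.

(** Positivity is encoded by a decomposition into squares, which makes the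
    closure under products (Schur's theorem) a matter of expanding. *)
Inductive psd_kernel : (R -> R -> R) -> Prop :=
| psd_kernel1 (u : R -> R) : continuous u -> psd_kernel (fun t s => u t * u s)
| psd_kernelD F G : psd_kernel F -> psd_kernel G -> psd_kernel (fun t s => F t s + G t s).

Lemma psd_finite_rank F : psd_kernel F -> finite_rank F.
Proof. by elim=> *; [exact: finite_rank1|exact: finite_rankD]. Qed.

Lemma psd_kernelM F G : psd_kernel F -> psd_kernel G -> psd_kernel (fun t s => F t s * G t s).
Proof.
move=> fF fG; elim: fF => [u cu|{}F F' _ IF _ IF']; last first.
  rewrite (_ : (fun t s => _) = (fun t s => F t s * G t s + F' t s * G t s)); first exact: psd_kernelD.
  by apply/funext => t; apply/funext => s; rewrite mulrDl.
elim: fG => [u' cu'|{}G G' _ IG _ IG']; last first.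
  rewrite (_ : (fun t s => _) = (fun t s => u t * u s * G t s + u t * u s * G' t s)); first exact: psd_kernelD.
  by apply/funext => t; apply/funext => s; rewrite mulrDr.
rewrite (_ : (fun t s => _) = (fun t s => (u t * u' t) * (u s * u' s))).
  by apply: (@psd_kernel1 (fun t => u t * u' t)) => t; apply: contM; [exact: cu|exact: cu'].
by apply/funext => t; apply/funext => s; rewrite mulrACA.
Qed.

Lemma psd_kernelX F m : psd_kernel F -> psd_kernel (fun t s => F t s ^+ m).
Proof.
move=> fF; elim: m => [|m IH].
  rewrite (_ : (fun t s => _) = (fun t s => (fun=> 1) t * (fun=> 1) s)).
    by apply: psd_kernel1 => t; exact: contc.
  by apply/funext => t; apply/funext => s; rewrite mulr1 expr0.
rewrite (_ : (fun t s => _) = (fun t s => F t s * F t s ^+ m)); first exact: psd_kernelM.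
by apply/funext => t; apply/funext => s; rewrite exprS.
Qed.

Definition energy (F : R -> R -> R) (a : R -> R) := pint2 (fun t s => F t s * (a t * a s)).

Lemma finite_rank_energy F a : finite_rank F -> continuous a -> finite_rank (fun t s => F t s * (a t * a s)).
Proof. by move=> fF ca; apply: finite_rankM => //; exact: finite_rank1. Qed.

Lemma energy1 u a : continuous u -> continuous a ->
  energy (fun t s => u t * u s) a = pint (fun t => u t * a t) ^+ 2.
Proof.
move=> cu ca; rewrite /energy expr2 -pint2M.
- by congr (pint2 _); apply/funext => t; apply/funext => s; rewrite mulrACA.
- by move=> t; apply: contM; [exact: cu|exact: ca].
- by move=> t; apply: contM; [exact: cu|exact: ca].
Qed.

Lemma energyD F G a : finite_rank F -> finite_rank G -> continuous a ->
  energy (fun t s => F t s + G t s) a = energy F a + energy G a.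
Proof.
move=> fF fG ca; rewrite /energy -pint2D; [|exact: finite_rank_energy..].
by congr (pint2 _); apply/funext => t; apply/funext => s; rewrite mulrDl.
Qed.

Lemma energyZ c F a : finite_rank F -> continuous a ->
  energy (fun t s => c * F t s) a = c * energy F a.
Proof.
move=> fF ca; rewrite /energy -pint2Z; last exact: finite_rank_energy.
by congr (pint2 _); apply/funext => t; apply/funext => s; rewrite -mulrA.
Qed.

#[local] Opaque energy pint2 pint.

Lemma energy_ge0 F a : psd_kernel F -> continuous a -> 0 <= energy F a.
Proof.
move=> pF ca; elim: pF => [u cu|{}F G pF IF pG IG]; first by rewrite energy1// sqr_ge0.
by rewrite (energyD (psd_finite_rank pF) (psd_finite_rank pG) ca) addr_ge0.
Qed.

(** For a single square this is p^2 <= 2 (p + r)^2 + 2 r^2. *)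
Lemma energy_quasi_triangle F a b : psd_kernel F -> continuous a -> continuous b ->
  energy F a <= 2 * energy F (fun t => a t + b t) + 2 * energy F b.
Proof.
move=> pF ca cb.
have cab : continuous (fun t => a t + b t) by move=> t; apply: contD; [exact: ca|exact: cb].
elim: pF => [u cu|{}F G pF IF pG IG]; last first.
  have fF := psd_finite_rank pF; have fG := psd_finite_rank pG.
  rewrite (energyD fF fG ca) (energyD fF fG cb) (energyD fF fG cab) !mulrDr addrACA.
  exact: lerD.
have ci (g : R -> R) : continuous g -> intg (fun t => u t * g t).
  by move=> cg; apply: cont_intg => t; apply: contM; [exact: cu|exact: cg].
rewrite !energy1//.
rewrite (_ : pint (fun t => u t * (a t + b t)) = pint (fun t => u t * a t) + pint (fun t => u t * b t)).
  set A := pint _; set B := pint _; have := sqr_ge0 (A + 2 * B); rewrite !expr2; lra.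
by rewrite -pintD; [|exact: ci..]; apply: eq_pint => t _; rewrite mulrDr.
Qed.

#[local] Transparent energy pint2 pint.

Let halfD (A : R) : 2^-1 * (A + A) = A.
Proof. by field. Qed.

(** Schur's test: a(t) a(s) <= (a(t)^2 + a(s)^2) / 2. *)
Lemma energy_upper F a C : finite_rank F -> continuous a ->
  (forall t s, F t s = F s t) -> (forall t s, 0 <= F t s) ->
  (forall t, t \in `[0, 2 * pi[ -> pint (F t) <= C) ->
  energy F a <= C * pint (fun t => a t ^+ 2).
Proof.
move=> fF ca symF F0 FC.
have ca2 : continuous (fun t => a t ^+ 2) by move=> t; apply: contX; exact: ca.
have f1 : finite_rank (fun t s => a t ^+ 2 * F t s).
  by apply: finite_rankM => //; exact: finite_rank_l.
have f2 : finite_rank (fun t s => a s ^+ 2 * F s t).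
  rewrite (_ : (fun t s => _) = (fun t s => a s ^+ 2 * F t s)).
    by apply: finite_rankM => //; exact: (finite_rank_r ca2).
  by apply/funext => t; apply/funext => s; rewrite symF.
apply: (@le_trans _ _ (pint2 (fun t s => a t ^+ 2 * F t s))).
  rewrite (_ : pint2 (fun t s => a t ^+ 2 * F t s) =
     pint2 (fun t s => 2^-1 * (a t ^+ 2 * F t s + a s ^+ 2 * F s t))); last first.
    rewrite pint2Z ?pint2D//; last exact: finite_rankD.
    by rewrite (pint2_swap f1) halfD.
  apply: le_pint2; [exact: finite_rank_energy|apply: finite_rankZ; exact: finite_rankD|].
  move=> t s _ _; rewrite [F s t]symF.
  have := mulr_ge0 (F0 t s) (sqr_ge0 (a t - a s)); rewrite !expr2.
  by move: (F t s) (a t) (a s) => f p q; lra.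
have [cF cF'] := finite_rank_continuous fF.
rewrite -pintZ; last exact: cont_intg.
apply: le_pint.
- by apply: cont_intg; have [] := finite_rank_continuous f1.
- by apply: cont_intg => t; apply: contM; [exact: contc|exact: ca2].
- move=> t tD; rewrite pintZ; last exact: cont_intg.
  by rewrite mulrC ler_wpM2r ?sqr_ge0// FC.
Qed.

(** The defect in Schur's test is F(t,s) (a(t) - a(s))^2 / 2. *)
Lemma energy_lower F a c e : finite_rank F -> continuous a ->
  (forall t s, F t s = F s t) ->
  (forall t, t \in `[0, 2 * pi[ -> c <= pint (F t)) ->
  (forall t s, F t s * (a t - a s) ^+ 2 <= e) ->
  c * pint (fun t => a t ^+ 2) - e * (2 * pi) ^+ 2 <= energy F a.
Proof.
move=> fF ca symF cF Fe.
have ca2 : continuous (fun t => a t ^+ 2) by move=> t; apply: contX; exact: ca.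
have f1 : finite_rank (fun t s => a t ^+ 2 * F t s).
  by apply: finite_rankM => //; exact: finite_rank_l.
have f2 : finite_rank (fun t s => a s ^+ 2 * F s t).
  rewrite (_ : (fun t s => _) = (fun t s => a s ^+ 2 * F t s)).
    by apply: finite_rankM => //; exact: (finite_rank_r ca2).
  by apply/funext => t; apply/funext => s; rewrite symF.
have fe : finite_rank (fun _ _ => - (e / 2)) by apply: finite_rank_l => t; exact: contc.
have [cfF cfF'] := finite_rank_continuous fF.
apply: (@le_trans _ _ (pint2 (fun t s => a t ^+ 2 * F t s) - e / 2 * (2 * pi) ^+ 2)).
  apply: lerB.
    rewrite -pintZ; last exact: cont_intg.
    apply: le_pint.
    - by apply: cont_intg => t; apply: contM; [exact: contc|exact: ca2].
    - by apply: cont_intg; have [] := finite_rank_continuous f1.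
    - move=> t tD; rewrite pintZ; last exact: cont_intg.
      by rewrite [leRHS]mulrC ler_wpM2r ?sqr_ge0// cF.
  rewrite ler_wpM2r ?sqr_ge0//.
  have e0 : 0 <= e by have := Fe 0 0; rewrite subrr expr0n/= mulr0.
  lra.
rewrite (_ : pint2 (fun t s => a t ^+ 2 * F t s) - _ =
   pint2 (fun t s => 2^-1 * (a t ^+ 2 * F t s + a s ^+ 2 * F s t) + - (e / 2))).
  apply: le_pint2; [apply: finite_rankD => //; apply: finite_rankZ; exact: finite_rankD|exact: finite_rank_energy|].
  move=> t s _ _; rewrite [F s t]symF; have := Fe t s; rewrite !expr2.
  by move: (F t s) (a t) (a s) => f p q; lra.
rewrite pint2D//; last by apply: finite_rankZ; exact: finite_rankD.
rewrite pint2Z ?pint2D//; last exact: finite_rankD.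
have -> : pint2 (fun _ _ => - (e / 2)) = - (e / 2 * (2 * pi) ^+ 2).
  by rewrite /pint2 pint_cst pint_cst; ring.
by rewrite (pint2_swap f1) halfD.
Qed.

End kernels.

(** * A positive semidefinite kernel that concentrates on the diagonal *)

Section power_bounds.
Context {R : realType}.

Lemma bernoulli_lower (u : R) (m : nat) : 0 <= u <= 1 -> 1 - m%:R * u <= (1 - u) ^+ m.
Proof.
move=> /andP[u0 u1]; elim: m => [|m IH]; first by rewrite mul0r subr0 expr0.
rewrite exprS -natr1; apply: (@le_trans _ _ ((1 - u) * (1 - m%:R * u))).
  have : 0 <= m%:R * u * u by rewrite !mulr_ge0.
  lra.
by rewrite ler_wpM2l// subr_ge0.
Qed.

Lemma bernoulli_upper (u : R) (m : nat) : 0 <= u <= 1 -> (1 - u) ^+ m * (1 + m%:R * u) <= 1.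
Proof.
move=> /andP[u0 u1]; elim: m => [|m IH]; first by rewrite expr0 mul0r addr0 mulr1.
apply: le_trans IH; rewrite exprSr -mulrA ler_wpM2l ?exprn_ge0 ?subr_ge0//.
rewrite -natr1; have : 0 <= m%:R * u * u + u * u by rewrite !(addr_ge0, mulr_ge0).
lra.
Qed.

(** (m + 1) q^m (1 - q) is at most the telescoping sum of the q^j (1 - q), j <= m. *)
Lemma power_gap (q : R) (m : nat) : 0 <= q <= 1 -> q ^+ m * (1 - q) <= m.+1%:R^-1.
Proof.
move=> /andP[q0 q1].
have H : m.+1%:R * (q ^+ m * (1 - q)) + q ^+ m.+1 <= 1.
  elim: m => [|m IH]; first by rewrite expr0 expr1; lra.
  rewrite (_ : _ + _ = q * (m.+1%:R * (q ^+ m * (1 - q)) + q ^+ m.+1) + q ^+ m.+1 * (1 - q)).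
    have : q * (m.+1%:R * (q ^+ m * (1 - q)) + q ^+ m.+1) <= q * 1 by rewrite ler_wpM2l.
    have : q ^+ m.+1 * (1 - q) <= 1 * (1 - q) by rewrite ler_wpM2r ?subr_ge0// exprn_ile1.
    lra.
  by rewrite -[m.+2%:R]natr1 !exprS; ring.
rewrite -[leRHS]mul1r ler_pdivlMr// mulrC; apply: le_trans H.
by rewrite lerDl exprn_ge0.
Qed.

(** The remainder of the logarithmic series has derivative u^M / (1 - u); the mean
    value theorem on [0, q] bounds it. *)
Lemma log_series (q : R) (M : nat) : 0 <= q < 1 ->
  0 <= - ln (1 - q) - \sum_(j < M) (q ^+ j.+1 / j.+1%:R) <= q ^+ M.+1 / (1 - q).
Proof.
move=> /andP[q0 q1].
pose G (u : R) : R := - ln (1 - u) - \sum_(j < M) (u ^+ j.+1 / j.+1%:R).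
have dG (u : R) : u < 1 -> is_derive u 1 G (u ^+ M / (1 - u)).
  move=> u1; have u10 : 0 < 1 - u by rewrite subr_gt0.
  have d1 : is_derive u 1 (fun u => 1 - u) (- 1) by apply: is_derive_eq; ring.
  have d2 := @is_derive_ln_comp R (fun u => 1 - u) (- 1) u u10 d1.
  have d3 N : is_derive u 1 (fun u => \sum_(j < N) (u ^+ j.+1 / j.+1%:R)) (\sum_(j < N) u ^+ j).
    elim: N => [|N IH].
      rewrite big_ord0 (_ : (fun _ => _) = cst 0); first exact: is_derive_cst.
      by apply/funext => v; rewrite big_ord0.
    rewrite big_ord_recr/=.
    rewrite (_ : (fun _ => _) = (fun u => (\sum_(j < N) (u ^+ j.+1 / j.+1%:R)) + u ^+ N.+1 * N.+1%:R^-1)).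
      have dX : is_derive u 1 (fun u : R => u ^+ N.+1 * N.+1%:R^-1) (u ^+ N).
        have d := is_deriveZ N.+1%:R^-1 (is_deriveX N (is_derive_id u (1 : R))).
        rewrite (_ : (fun v : R => v ^+ N.+1 * N.+1%:R^-1) = N.+1%:R^-1 *: (id ^+ N.+1)); last first.
          by apply/funext => v; rewrite /GRing.scale/= fctE mulrC.
        apply: is_derive_eq; rewrite /GRing.scale/=.
        by field; rewrite nat1r pnatr_eq0.
      exact: (is_deriveD IH dX).
    by apply/funext => v; rewrite big_ord_recr.
  have d4 := d3 M.
  have E : \sum_(j < M) u ^+ j = (1 - u ^+ M) / (1 - u).
    have n0 : 1 - u != 0 by rewrite gt_eqF.
    by apply: (mulIf n0); rewrite divfK// mulrC -[1 - u ^+ M]opprB subrX1 -mulNr opprB.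
  apply: is_derive_eq; rewrite E; field.
  by rewrite gt_eqF.
have G0 : G 0 = 0.
  by rewrite /G subr0 ln1 oppr0 big1 ?subr0// => j _; rewrite expr0n/= mul0r.
move: q0; rewrite le_eqVlt => /predU1P[<-|q0].
  by rewrite -/(G 0) G0 lexx expr0n/= mul0r.
have sub (u : R) : u \in `[0, q] -> u < 1 by rewrite in_itv/= => /andP[_ uq]; apply: le_lt_trans q1.
have [c cI E] := @MVT _ G (fun u => u ^+ M / (1 - u)) 0 q q0
  (fun u uI => dG u (sub u (subset_itv_oo_cc uI))) (derivable_within_continuous (fun u uI => let: DeriveDef H _ := dG u (sub u uI) in H)).
move: E; rewrite G0 !subr0 -/(G q) => ->.
move: cI; rewrite in_itv/= => /andP[c0 cq].
have c1 : 0 < 1 - c by rewrite subr_gt0 (lt_trans cq).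
apply/andP; split; first by rewrite !mulr_ge0 ?invr_ge0 ?exprn_ge0// ltW.
rewrite exprSr -[leRHS]mulrAC; apply: (ler_wpM2r (ltW q0)).
rewrite ler_pM ?invr_ge0 ?exprn_ge0 ?(ltW c1) ?(ltW c0)//.
  by rewrite lerXn2r ?nnegrE ?(ltW c0) ?(ltW q0)// ltW.
by rewrite lef_pV2 ?posrE; lra.
Qed.

End power_bounds.

Section resolved_kernel.
Context {R : realType}.
Variables (x x1 x2 x3 y y1 y2 y3 : R -> R) (M : R).
Hypotheses (M0 : 0 <= M) (Cx : C3fun x x1 x2 x3 M) (Cy : C3fun y y1 y2 y3 M).
Hypotheses (px : forall t : R, x (t + 2 * pi) = x t) (py : forall t : R, y (t + 2 * pi) = y t).
Hypothesis inj : forall s t : R, 0 <= s < 2 * pi -> 0 <= t < 2 * pi -> x s = x t -> y s = y t -> s = t.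
Hypothesis reg : forall t : R, 0 < x1 t ^+ 2 + y1 t ^+ 2.
Local Notation mu := (@lebesgue_measure R).
Local Notation D := (`[0, 2 * pi[%classic : set R).
Local Notation intg f := (mu.-integrable D (EFin \o f)).

Let p0 : 0 < pi :> R. Proof. exact: pi_gt0. Qed.
Let p20 : 0 < 2 * pi :> R. Proof. by rewrite mulr_gt0. Qed.
Let cx : continuous x. Proof. by have [d _ _ _] := Cx; move=> t; exact: is_derive_continuous. Qed.
Let cy : continuous y. Proof. by have [d _ _ _] := Cy; move=> t; exact: is_derive_continuous. Qed.

Definition weight (t : R) : R := 1 + (x t ^+ 2 + y t ^+ 2).
(** One minus a quarter of the squared distance between the stereographic
    projections of the two points to the unit sphere, which is why its values
    lie in [0, 1] whatever the diameter of the curve. *)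
Definition proximity (t s : R) : R := 1 - ((x s - x t) ^+ 2 + (y s - y t) ^+ 2) / (weight t * weight s).

Lemma weight_ge1 t : 1 <= weight t.
Proof. by rewrite lerDl addr_ge0 ?sqr_ge0. Qed.

Lemma weight_gt0 t : 0 < weight t. Proof. by apply: lt_le_trans (weight_ge1 t). Qed.

Let wn0 t : weight t != 0. Proof. by rewrite gt_eqF// weight_gt0. Qed.

Lemma weight_continuous : continuous weight.
Proof.
move=> t; apply: contD; first exact: contc.
by apply: contD; apply: contX; [exact: cx|exact: cy].
Qed.

Lemma weight_bounded : exists2 B : R, 1 <= B & forall t, weight t <= B.
Proof.
have pw (t : R) : weight (t + 2 * pi) = weight t by rewrite /weight px py.
have [B [_ HB]] := periodic_bounded p20 pw weight_continuous.
exists B => [|t]; first by apply: le_trans (HB 0); apply: le_trans (ler_norm _); exact: weight_ge1.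
by apply: le_trans (HB t); exact: ler_norm.
Qed.

Lemma proximity_sym t s : proximity t s = proximity s t.
Proof. by rewrite /proximity [weight t * _]mulrC; congr (1 - _ / _); rewrite -[x s - _]opprB -[y s - _]opprB !sqrrN. Qed.

Lemma proximity_periodic t s : proximity t (s + 2 * pi) = proximity t s.
Proof. by rewrite /proximity /weight px py. Qed.

Lemma proximity_chord t tau : 1 - proximity t (t + tau) = chord x y t tau / (weight t * weight (t + tau)).
Proof. by rewrite /proximity /chord opprB addrC subrK. Qed.

(** weight(t) weight(s) minus the squared distance is |1 + z conj(z')|^2, where z
    and z' are the two points as complex numbers. *)
Lemma proximity_01 t s : 0 <= proximity t s <= 1.
Proof.
have ww : 0 < weight t * weight s by rewrite mulr_gt0 ?weight_gt0.
apply/andP; split; last first.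
  by rewrite lerBlDr lerDl divr_ge0 ?(ltW ww)// addr_ge0 ?sqr_ge0.
rewrite subr_ge0 ler_pdivrMr// mul1r -subr_ge0.
rewrite (_ : _ - _ = (1 + x t * x s + y t * y s) ^+ 2 + (x t * y s - y t * x s) ^+ 2).
  by rewrite addr_ge0 ?sqr_ge0.
by rewrite /weight; ring.
Qed.

(** Multiplying out, weight(t) weight(s) proximity(t,s) is
    1 + |gamma(t)|^2 |gamma(s)|^2 + 2 gamma(t) . gamma(s). *)
Lemma psd_proximity : psd_kernel proximity.
Proof.
have ci : continuous (fun t => (weight t)^-1) by move=> t; apply: contV => //; exact: weight_continuous.
have cm (f : R -> R) : continuous f -> continuous (fun t => f t / weight t).
  by move=> cf t; apply: contM; [exact: cf|exact: ci].
have cr : continuous (fun t => (x t ^+ 2 + y t ^+ 2) / weight t).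
  by apply: cm => t; apply: contD; apply: contX; [exact: cx|exact: cy].
have k1 := psd_kernelD (psd_kernel1 ci) (psd_kernel1 cr).
have k2 := psd_kernelD (psd_kernelD (psd_kernel1 (cm _ cx)) (psd_kernel1 (cm _ cx)))
  (psd_kernelD (psd_kernel1 (cm _ cy)) (psd_kernel1 (cm _ cy))).
have k := psd_kernelD k1 k2.
congr (psd_kernel _): k.
apply/funext => t; apply/funext => s; rewrite /proximity.
have := wn0 t; have := wn0 s; rewrite /weight => ws wt.
by field; rewrite ws wt.
Qed.

Lemma proximity_quadratic : exists2 k : R, 0 < k &
  forall t tau : R, `|tau| <= pi -> k * tau ^+ 2 <= 1 - proximity t (t + tau).
Proof.
have [c c0 cP] := chord_arc M0 Cx Cy px py inj reg.
have [B B1 HB] := weight_bounded; have B0 : 0 < B by apply: lt_le_trans B1.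
exists (c / B ^+ 2) => [|t tau tp]; first by rewrite divr_gt0 ?exprn_gt0.
rewrite proximity_chord mulrAC; apply: ler_pM; [|by rewrite invr_ge0 sqr_ge0|exact: cP|].
  by apply: mulr_ge0; [exact: ltW|exact: sqr_ge0].
rewrite lef_pV2 ?posrE ?mulr_gt0 ?exprn_gt0 ?weight_gt0//.
by rewrite expr2 ler_pM// ltW// weight_gt0.
Qed.

Lemma proximity_lipschitz : exists2 L : R, 0 < L &
  forall t tau : R, 1 - proximity t (t + tau) <= L * tau ^+ 2.
Proof.
exists (2 * M ^+ 2 + 1) => [|t tau]; first by rewrite ltr_wpDl//; apply: mulr_ge0; rewrite ?sqr_ge0.
have lip (f f1 f2 f3 : R -> R) : C3fun f f1 f2 f3 M -> (f (t + tau) - f t) ^+ 2 <= M ^+ 2 * tau ^+ 2.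
  move=> [df _ _ bf].
  have := @mean_value_bound R (fun u => f (t + u) - f t) (fun u => f1 (t + u)) M tau 0.
  rewrite expr1 addr0 subrr => /(_ erefl) H.
  rewrite -exprMn -[leLHS]real_normK ?num_real// -[leRHS]real_normK ?num_real//.
  rewrite lerXn2r ?nnegrE// normrM (ger0_norm M0); apply: H => //.
    move=> u; have d := is_derive_translate t u df.
    by apply: is_derive_eq; ring.
  by move=> u; rewrite expr0 mulr1; have [] := bf (t + u).
rewrite proximity_chord ler_pdivrMr ?mulr_gt0 ?weight_gt0//.
apply: (@le_trans _ _ ((2 * M ^+ 2 + 1) * tau ^+ 2)).
  have := lip _ _ _ _ Cx; have := lip _ _ _ _ Cy; rewrite /chord.
  have := sqr_ge0 tau; lra.
rewrite ler_peMr//.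
  by apply: mulr_ge0; rewrite ?sqr_ge0// addr_ge0//; apply: mulr_ge0; rewrite ?sqr_ge0.
by rewrite -[1]mulr1 ler_pM// weight_ge1.
Qed.

(** 1 - proximity dominates the square of the distance on the circle of
    parameters. *)
Lemma proximity_controls_lipschitz : exists2 K : R, 0 < K &
  forall (f : R -> R) (La : R), 0 <= La -> (forall t : R, f (t + 2 * pi) = f t) ->
  (forall t tau : R, `|f (t + tau) - f t| <= La * `|tau|) ->
  forall t s : R, (f t - f s) ^+ 2 <= La ^+ 2 * K * (1 - proximity t s).
Proof.
have [k k0 kP] := proximity_quadratic.
exists k^-1 => [|f La La0 pf Lf t s]; first by rewrite invr_gt0.
have [n [u /andP[u0 u2] E]] := period_reduction (s - t) p20.
have small (v : R) : `|v| <= pi -> f s = f (t + v) -> proximity t s = proximity t (t + v) ->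
    (f t - f s) ^+ 2 <= La ^+ 2 / k * (1 - proximity t s).
  move=> vp -> ->.
  rewrite -[leLHS]sqrrN opprB -[leLHS]real_normK ?num_real//.
  apply: (@le_trans _ _ ((La * `|v|) ^+ 2)).
    by rewrite lerXn2r ?nnegrE// mulr_ge0.
  rewrite exprMn -mulrA ler_wpM2l ?sqr_ge0// real_normK ?num_real//.
  by rewrite ler_pdivlMl// kP.
have es : s = (t + u) + n%:~R * (2 * pi) by rewrite -addrA -E addrC subrK.
have fs : f s = f (t + u) by rewrite es periodic_int.
have qs : proximity t s = proximity t (t + u) by rewrite es; apply: (periodic_int (proximity_periodic t)).
have [up|up] := leP u pi.
  by apply: (small u) => //; rewrite ger0_norm.
apply: (small (u - 2 * pi)).
- by rewrite ler_norml; apply/andP; split; lra.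
- by rewrite fs -[RHS]pf; congr f; lra.
- by rewrite qs -[RHS]proximity_periodic; congr (proximity t _); lra.
Qed.

Lemma proximity_continuous t : continuous (proximity t).
Proof. by have [c _] := finite_rank_continuous (psd_finite_rank psd_proximity). Qed.

Let qm (m : nat) (t tau : R) := proximity t (t + tau) ^+ m.

Let cqm m t : continuous (qm m t).
Proof.
move=> tau; apply: contX; apply: (@cont_comp _ _ (proximity t) (fun u => t + u)); first exact: proximity_continuous.
by apply: contD; [exact: contc|exact: cvg_id].
Qed.

Let pint_qm m t : t \in `[0, 2 * pi[ -> pint (fun s => proximity t s ^+ m) = pint (qm m t).
Proof.
rewrite in_itv/= => /andP[t0 t2].
rewrite /pint -(@Rintegral_periodic _ (fun s => proximity t s ^+ m) (2 * pi) t)//.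
- apply: continuous_measurable_fun => s; apply: contX; exact: proximity_continuous.
- by move=> s; rewrite proximity_periodic.
- by rewrite t0 ltW.
Qed.

Lemma pint_cauchy_density (a b : R) : 0 < a ->
  let f tau := (1 + (a * (tau - b)) ^+ 2)^-1 in continuous f /\ pint f <= pi / a.
Proof.
move=> a0 f.
have cf : continuous f.
  move=> tau; apply: contV; first by rewrite gt_eqF// ltr_wpDr// sqr_ge0.
  apply: contD; first exact: contc.
  apply: contX; apply: contM; first exact: contc.
  by apply: contB; [exact: cvg_id|exact: contc].
split=> //.
pose F (tau : R) := atan (a * (tau - b)) / a.
have dF (tau : R) : is_derive tau 1 F (f tau).
  have d1 : is_derive tau 1 (fun tau => a * (tau - b)) a.
    by apply: is_derive_eq; rewrite /GRing.scale/=; ring.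
  have d2 := @is_derive1_comp R atan (fun tau => a * (tau - b)) tau _ _ (is_derive1_atan _) d1.
  have d3 := is_deriveZ a^-1 d2.
  rewrite (_ : F = a^-1 *: (atan \o (fun tau => a * (tau - b)))); last first.
    by apply/funext => u; rewrite /F mulrC.
  apply: is_derive_eq; rewrite /GRing.scale/= /f; field.
  by rewrite !gt_eqF// ltr_wpDr// sqr_ge0.
have cF : continuous F by move=> u; exact: is_derive_continuous.
have E : pint f = F (2 * pi) - F 0.
  apply: (@Rintegral_FTC_approx _ f F F (fun=> 0)).
  - exact: p20.
  - by move=> u _; exact: cf.
  - apply: continuous_compact_integrable; first exact: segment_compact.
    exact: continuous_subspaceT.
  - exact: cF.
  - by move=> u; exact: contc.
  - by [].
  - by [].
  - by move=> u _; rewrite subrr normr0.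
rewrite E /F -mulrBl ler_wpM2r ?invr_ge0 ?(ltW a0)//.
have := atan_ltpi2 (a * (2 * pi - b)); have := atan_gtNpi2 (a * (0 - b)).
lra.
Qed.

(** With u = 1 - proximity >= k tau^2, Bernoulli's inequality gives
    (1 - u)^m <= 1 / (1 + m k tau^2), whose integral is at most pi / sqrt (m k).
    The two summands account for the two ends of the period. *)
Lemma pint_proximity_upper : exists2 C : R, 0 < C & forall (m : nat) (t : R), (0 < m)%N -> t \in `[0, 2 * pi[ ->
  pint (fun s => proximity t s ^+ m) <= C / Num.sqrt m%:R.
Proof.
have [k k0 kP] := proximity_quadratic.
exists (2 * pi / Num.sqrt k) => [|m t m0 tD]; first by rewrite divr_gt0// sqrtr_gt0.
rewrite pint_qm//.
have mR : 0 < m%:R :> R by rewrite ltr0n.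
pose a : R := Num.sqrt k * Num.sqrt m%:R.
have a0 : 0 < a by rewrite mulr_gt0 ?sqrtr_gt0.
have a2 : a ^+ 2 = k * m%:R by rewrite exprMn !sqr_sqrtr ?ltW.
have [c1 b1] := pint_cauchy_density 0 a0.
have [c2 b2] := pint_cauchy_density (2 * pi) a0.
have -> : 2 * pi / Num.sqrt k / Num.sqrt m%:R = pi / a + pi / a.
  by rewrite /a; field; rewrite !gt_eqF ?sqrtr_gt0.
apply: le_trans (lerD b1 b2).
rewrite -pintD; [|exact: cont_intg..].
have key (v : R) : `|v| <= pi -> qm m t v <= (1 + (a * v) ^+ 2)^-1.
  move=> vp; have /andP[q0 q1] := proximity_01 t (t + v).
  have u01 : 0 <= 1 - proximity t (t + v) <= 1 by apply/andP; split; lra.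
  have := bernoulli_upper m u01; rewrite opprB addrC subrK -/(qm m t v) => H.
  have pos : 0 < 1 + (a * v) ^+ 2 by rewrite ltr_wpDr// sqr_ge0.
  rewrite -[leRHS]mul1r ler_pdivlMr//; apply: le_trans H.
  rewrite ler_wpM2l ?exprn_ge0// lerD2l exprMn a2 [k * _]mulrC -mulrA ler_wpM2l ?ler0n//.
  exact: kP.
apply: le_pint; [exact: cont_intg| |].
  by apply: cont_intg => u; apply: contD; [exact: c1|exact: c2].
move=> u; rewrite in_itv/= => /andP[u0 u2].
have pos (v : R) : 0 <= (1 + (a * v) ^+ 2)^-1 by rewrite invr_ge0 addr_ge0 ?sqr_ge0.
have [up|up] := leP u pi.
  apply: (@le_trans _ _ ((1 + (a * (u - 0)) ^+ 2)^-1)); last by rewrite lerDl.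
  by rewrite subr0; apply: key; rewrite ger0_norm.
apply: (@le_trans _ _ ((1 + (a * (u - 2 * pi)) ^+ 2)^-1)); last by rewrite lerDr.
have <- : qm m t (u - 2 * pi) = qm m t u by rewrite /qm -(proximity_periodic t (t + (u - 2 * pi))) addrA subrK.
by apply: key; rewrite ler_norml; apply/andP; split; lra.
Qed.

(** proximity^m >= 1/2 on an interval of length of order 1 / sqrt m. *)
Lemma pint_proximity_lower : exists2 c : R, 0 < c & forall (m : nat) (t : R), (0 < m)%N -> t \in `[0, 2 * pi[ ->
  c / Num.sqrt m%:R <= pint (fun s => proximity t s ^+ m).
Proof.
have [L L0 LP] := proximity_lipschitz.
pose L' := 2 * L + 1.
have L'1 : 1 <= L' by rewrite lerDr mulr_ge0// ltW.
have L'0 : 0 < L' by apply: lt_le_trans L'1.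
exists (1 / 2 / Num.sqrt L') => [|m t m0 tD].
  by rewrite !divr_gt0// sqrtr_gt0.
rewrite pint_qm//.
have mR : 1 <= m%:R :> R by rewrite ler1n.
have mR0 : 0 < m%:R :> R by rewrite ltr0n.
pose h : R := (Num.sqrt L' * Num.sqrt m%:R)^-1.
have h0 : 0 < h by rewrite invr_gt0 mulr_gt0// sqrtr_gt0.
have h1 : h <= 1.
  have s1 (v : R) : 1 <= v -> 1 <= Num.sqrt v by move=> v1; rewrite -[leLHS]sqrtr1 ler_wsqrtr.
  by rewrite invf_le1 ?mulr_gt0 ?sqrtr_gt0// -[leLHS]mulr1 ler_pM// s1.
have hpi : h <= 2 * pi by apply: (le_trans h1); have := @pi_ge2 R; lra.
have h2 : h ^+ 2 * (L' * m%:R) = 1.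
  by rewrite exprVn exprMn !sqr_sqrtr ?ltW// mulVf// mulf_neq0// gt_eqF.
have -> : 1 / 2 / Num.sqrt L' / Num.sqrt m%:R = 1 / 2 * h.
  by rewrite /h; field; rewrite !gt_eqF ?sqrtr_gt0.
have sub : `[0, h] `<=` `[0, 2 * pi] by apply: subset_itvl; rewrite bnd_simp.
have ci A : A `<=` `[0, 2 * pi] -> measurable A -> mu.-integrable A (EFin \o qm m t).
  move=> sA mA; apply: (@integrableS _ _ _ mu `[0, 2 * pi]) => //.
  apply: continuous_compact_integrable; first exact: segment_compact.
  exact: continuous_subspaceT.
rewrite /pint Rintegral_itv_bndo_bndc; last first.
  by apply: ci => //; apply: subset_itvl; rewrite bnd_simp.
apply: (@le_trans _ _ (\int[mu]_(u in `[0, h]) qm m t u)).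
  have -> : 1 / 2 * h = \int[mu]_(u in `[0, h]) (1 / 2).
    by rewrite Rintegral_cst// [X in fine X]lebesgue_measure_itv/= lte_fin h0 -EFinB subr0.
  apply: le_Rintegral => //.
    by apply: continuous_compact_integrable; [exact: segment_compact|move=> ?; exact: contc].
    exact: ci.
  move=> u /=; rewrite in_itv/= => /andP[u0 uh].
  have /andP[q0 q1] := proximity_01 t (t + u).
  have u01 : 0 <= 1 - proximity t (t + u) <= 1 by apply/andP; split; lra.
  have -> : qm m t u = (1 - (1 - proximity t (t + u))) ^+ m by rewrite /qm; congr (_ ^+ m); lra.
  apply: le_trans (bernoulli_lower m u01).
  have : m%:R * (1 - proximity t (t + u)) <= m%:R * (L * h ^+ 2).
    rewrite ler_wpM2l ?ler0n//; apply: (le_trans (LP _ _)).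
    by rewrite ler_wpM2l ?(ltW L0)// lerXn2r ?nnegrE// ltW.
  have : 0 < h ^+ 2 * m%:R by rewrite mulr_gt0 ?exprn_gt0.
  move: h2; rewrite /L'; move: (proximity _ _) => q; lra.
rewrite /Rintegral fine_le//.
- by apply: integrable_fin_num => //; exact: ci.
- by apply: integrable_fin_num => //; exact: ci.
apply: ge0_subset_integral => //.
- by apply: measurable_int (ci _ _ _).
- by move=> u _; rewrite lee_fin exprn_ge0//; have /andP[] := proximity_01 t (t + u).
Qed.

End resolved_kernel.

(** * Square-integrable real functions *)

Section square_integrable.
Context {R : realType}.
Local Notation mu := (@lebesgue_measure R).
Local Notation D := (`[0, 2 * pi[%classic : set R).
Local Notation intg f := (mu.-integrable D (EFin \o f)).

Let p0 : 0 < pi :> R. Proof. exact: pi_gt0. Qed.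
Let p20 : 0 < 2 * pi :> R. Proof. by rewrite mulr_gt0. Qed.

Definition sqint (f : R -> R) : Prop := measurable_fun D f /\ intg (fun x => f x ^+ 2).

(** Dominated convergence off one point: the kernels below are singular on the
    diagonal. *)
Lemma pint_dominated (f_ : nat -> R -> R) (f g : R -> R) (t : R) :
  (forall n, measurable_fun D (f_ n)) -> measurable_fun D f ->
  (forall x : R, x \in `[0, 2 * pi[ -> x != t -> f_ ^~ x @ \oo --> f x) ->
  intg g -> (forall n (x : R), x \in `[0, 2 * pi[ -> x != t -> `|f_ n x| <= g x) ->
  intg f /\ pint (f_ n) @[n --> \oo] --> pint f.
Proof.
move=> mf_ mf cf ig fg.
have off (P : R -> Prop) : (forall x, x != t -> P x) -> {ae mu, forall x, P x}.
  move=> HP; exists [set t]; split; [exact: measurable_set1|exact: lebesgue_measure_set1|].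
  by move=> x /= nP; apply: contrapT => /eqP xt; apply: nP; exact: HP.
have mD : measurable D by exact: measurable_itv.
have [] := @dominated_convergence _ _ R mu D mD (fun n => EFin \o f_ n) (EFin \o f) (EFin \o g).
- by move=> n; apply/measurable_EFinP; exact: mf_.
- by apply/measurable_EFinP.
- by apply: off => x xt xD; apply: cvg_EFin; [exact: nearW|exact: cf].
- exact: ig.
- by apply: off => x xt n xD; exact: fg.
move=> fi _ ci.
split=> //; rewrite /pint /Rintegral.
apply: fine_cvg; rewrite fineK; last exact: integrable_fin_num.
exact: ci.
Qed.

Lemma intg_sqM (f g : R -> R) : sqint f -> sqint g -> intg (fun x => f x * g x).
Proof.
move=> [mf f2] [mg g2].
apply: (@le_integrable _ _ _ mu _ _ _ (EFin \o (fun x => f x ^+ 2 + g x ^+ 2))) => //.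
- by apply/measurable_EFinP; exact: measurable_funM.
- move=> x _ /=; rewrite lee_fin normrM [leRHS]ger0_norm ?addr_ge0 ?sqr_ge0//.
  rewrite -[f x ^+ 2]real_normK ?num_real// -[g x ^+ 2]real_normK ?num_real//.
  have := sqr_ge0 (`|f x| - `|g x|); have := sqr_ge0 (`|f x| + `|g x|).
  move: `|f x| `|g x| => a b; rewrite sqrrB sqrrD; lra.
- exact: intgD.
Qed.

Lemma cont_sqint (f : R -> R) : continuous f -> sqint f.
Proof.
move=> cf; split; first by apply: measurable_funS (continuous_measurable_fun cf).
by apply: cont_intg => x; apply: contX; exact: cf.
Qed.

Lemma sqint_cst (c : R) : sqint (fun=> c).
Proof. by apply: cont_sqint => x; exact: contc. Qed.

Lemma sqintD (f g : R -> R) : sqint f -> sqint g -> sqint (fun x => f x + g x).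
Proof.
move=> sf sg; have [mf f2] := sf; have [mg g2] := sg; split; first exact: measurable_funD.
have := intgD (intgD f2 g2) (intgZ 2 (intg_sqM sf sg)).
by apply: eq_integrable => // x _ /=; congr EFin; ring.
Qed.

Lemma sqintZ (c : R) (f : R -> R) : sqint f -> sqint (fun x => c * f x).
Proof.
move=> [mf f2]; split; first exact: measurable_funM.
have := intgZ (c ^+ 2) f2.
by apply: eq_integrable => // x _ /=; rewrite exprMn.
Qed.

Lemma sqint_norm (f : R -> R) : sqint f -> sqint (fun x => `|f x|).
Proof.
move=> [mf f2]; split; first exact: measurableT_comp.
by apply: eq_integrable f2 => // x _ /=; rewrite real_normK ?num_real.
Qed.

Lemma sqint_intg (f : R -> R) : sqint f -> intg f.
Proof.
move=> sf; have := intg_sqM sf (sqint_cst 1).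
by apply: eq_integrable => // x _ /=; rewrite mulr1.
Qed.

Lemma sqintM_bounded (f g : R -> R) (C : R) : sqint f -> measurable_fun D g ->
  (forall x, D x -> `|g x| <= C) -> sqint (fun x => f x * g x).
Proof.
move=> [mf f2] mg gC; split; first exact: measurable_funM.
have mg2 : measurable_fun D (fun x => g x ^+ 2) by exact: measurable_funX.
have i : intg (fun x => f x ^+ 2 * g x ^+ 2).
  apply: (@intgM_bounded _ _ _ _ _ (C ^+ 2)) => // x xD.
  rewrite normrX lerXn2r ?nnegrE//; last exact: gC.
  exact: le_trans (gC x xD).
by apply: eq_integrable i => // x _ /=; rewrite exprMn.
Qed.

Lemma bounded_sqint (f : R -> R) (C : R) : measurable_fun D f ->
  (forall x, D x -> `|f x| <= C) -> sqint f.
Proof.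
move=> mf fC; have := sqintM_bounded (sqint_cst 1) mf fC.
by rewrite (_ : (fun x => 1 * f x) = f)//; apply/funext => x; rewrite mul1r.
Qed.

Lemma le_norm_pint (f g : R -> R) (t : R) : intg f -> intg g -> (forall x, 0 <= g x) ->
  (forall x, x \in `[0, 2 * pi[ -> x != t -> `|f x| <= g x) -> `|pint f| <= pint g.
Proof.
move=> fi gi g0 fg; apply: le_trans (le_normr_Rintegral _ fi) _ => //.
have fi' : intg (fun x => `|f x|) by apply: eq_integrable (integrable_abse fi).
rewrite /Rintegral fine_le//; [exact: integrable_fin_num|exact: integrable_fin_num|].
apply: ae_ge0_le_integral => //.
- exact: measurable_int fi'.
- by move=> x _; rewrite lee_fin.
- exact: measurable_int gi.
exists [set t]; split; [exact: measurable_set1|exact: lebesgue_measure_set1|].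
move=> x /= nP; apply: contrapT => /eqP xt; apply: nP => xD.
by rewrite lee_fin; exact: fg.
Qed.

End square_integrable.

(** * The logarithmic potential and its energy *)

Section log_kernel.
Context {R : realType}.
Variables (x x1 x2 x3 y y1 y2 y3 : R -> R) (M : R).
Hypotheses (M0 : 0 <= M) (Cx : C3fun x x1 x2 x3 M) (Cy : C3fun y y1 y2 y3 M).
Hypotheses (px : forall t : R, x (t + 2 * pi) = x t) (py : forall t : R, y (t + 2 * pi) = y t).
Hypothesis inj : forall s t : R, 0 <= s < 2 * pi -> 0 <= t < 2 * pi -> x s = x t -> y s = y t -> s = t.
Hypothesis reg : forall t : R, 0 < x1 t ^+ 2 + y1 t ^+ 2.
Local Notation mu := (@lebesgue_measure R).
Local Notation D := (`[0, 2 * pi[%classic : set R).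
Local Notation intg f := (mu.-integrable D (EFin \o f)).
Local Notation proximity := (proximity x y).
Local Notation weight := (weight x y).

Let p0 : 0 < pi :> R. Proof. exact: pi_gt0. Qed.
Let p20 : 0 < 2 * pi :> R. Proof. by rewrite mulr_gt0. Qed.
Let cx : continuous x. Proof. by have [d _ _ _] := Cx; move=> t; exact: is_derive_continuous. Qed.
Let cy : continuous y. Proof. by have [d _ _ _] := Cy; move=> t; exact: is_derive_continuous. Qed.

(** The convention ln 0 = 0 affects only the diagonal. *)
Definition ln_sqdist (t s : R) : R := ln ((x s - x t) ^+ 2 + (y s - y t) ^+ 2).

Lemma ln_sqdist_measurable t : measurable_fun [set: R] (ln_sqdist t).
Proof.
apply: measurableT_comp; first exact: measurable_ln.
apply: continuous_measurable_fun => s; apply: contD; apply: contX; apply: contB.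
- exact: cx.
- exact: contc.
- exact: cy.
- exact: contc.
Qed.

Let ln_sqdist_measurableD t : measurable_fun D (ln_sqdist t).
Proof. by apply: measurable_funS (ln_sqdist_measurable t). Qed.

Lemma ln_sqdist_periodic t s : ln_sqdist t (s + 2 * pi) = ln_sqdist t s.
Proof. by rewrite /ln_sqdist px py. Qed.

Let translate (f : R -> R) t : t \in `[0, 2 * pi[ -> measurable_fun [set: R] f ->
  (forall s, f (s + 2 * pi) = f s) -> intg (fun tau => f (t + tau)) ->
  intg f /\ pint f = pint (fun tau => f (t + tau)).
Proof.
rewrite in_itv/= => /andP[t0 t2] mf pf fi.
have t02 : 0 <= t <= 2 * pi by rewrite t0 ltW.
by split; [apply/(integrable_periodic mf pf t02)|rewrite /pint (Rintegral_periodic mf pf t02)].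
Qed.

Lemma ln_sqdist_sqint : exists2 A : R, 0 <= A & forall t, t \in `[0, 2 * pi[ ->
  sqint (ln_sqdist t) /\ pint (fun s => ln_sqdist t s ^+ 2) <= A.
Proof.
have [A HA] := log_chord_integrable M0 Cx Cy px py inj reg.
exists `|A| => // t tD; have [i1 i2 i3] := HA t.
have m2 : measurable_fun [set: R] (fun s => ln_sqdist t s ^+ 2).
  by apply: measurable_funX; exact: ln_sqdist_measurable.
have [] := translate tD m2 _ (integrable_co i2).
  by move=> s; rewrite ln_sqdist_periodic.
by move=> i4 ->; split; [split|exact: le_trans (ler_norm _)].
Qed.

(** [log_chord_fourier] for the variable s = t + tau: the addition theorems move
    the phase t out of the integral. *)
Lemma ln_sqdist_fourier : exists2 C : R, 0 <= C & forall (k : nat) t, (0 < k)%N -> t \in `[0, 2 * pi[ ->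
  `|pint (fun s => ln_sqdist t s * cos (k%:R * s)) + 2 * pi / k%:R * cos (k%:R * t)| <= C / k%:R ^+ 2 /\
  `|pint (fun s => ln_sqdist t s * sin (k%:R * s)) + 2 * pi / k%:R * sin (k%:R * t)| <= C / k%:R ^+ 2.
Proof.
have [C C0 HC] := log_chord_fourier M0 Cx Cy px py inj reg.
exists (2 * C) => [|k t k0 tD]; first by rewrite mulr_ge0.
have [A HA] := log_chord_integrable M0 Cx Cy px py inj reg.
have [i1 _ _] := HA t.
have [hc hs] := HC t k k0.
have mcos : measurable_fun [set: R] (fun u : R => cos (k%:R * u)).
  apply: continuous_measurable_fun => u; apply: (@cont_comp _ _ cos).
    exact: continuous_cos.
  by apply: contM; [exact: contc|exact: cvg_id].
have msin : measurable_fun [set: R] (fun u : R => sin (k%:R * u)).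
  apply: continuous_measurable_fun => u; apply: (@cont_comp _ _ sin).
    exact: continuous_sin.
  by apply: contM; [exact: contc|exact: cvg_id].
have bcos (u : R) : `|cos u| <= 1 by rewrite ler_norml cos_geN1 cos_le1.
have bsin (u : R) : `|sin u| <= 1 by rewrite ler_norml sin_geN1 sin_le1.
have ic : intg (fun tau => ln (chord x y t tau) * cos (k%:R * tau)).
  apply: (intgM_bounded (integrable_co i1) (C := 1)) => //; exact: measurable_funS mcos.
have is' : intg (fun tau => ln (chord x y t tau) * sin (k%:R * tau)).
  apply: (intgM_bounded (integrable_co i1) (C := 1)) => //; exact: measurable_funS msin.
have pc (s : R) : cos (k%:R * (s + 2 * pi)) = cos (k%:R * s) by rewrite mulrDr cosD cos_natM2pi sin_natM2pi; ring.
have ps (s : R) : sin (k%:R * (s + 2 * pi)) = sin (k%:R * s) by rewrite mulrDr sinD cos_natM2pi sin_natM2pi; ring.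
have K0 : 0 <= C / k%:R ^+ 2 by rewrite divr_ge0 ?sqr_ge0.
move: hc hs; rewrite -/(pint _) -/(pint _).
set P := pint _; set Q := pint _ => hc hs.
have fin (u v a b c : R) : `|a| <= c -> `|b| <= c -> `|cos u * a + sin u * b| <= 2 * c.
  move=> ac bc; apply: (le_trans (ler_normD _ _)); rewrite !normrM.
  have : `|cos u| * `|a| <= 1 * c by rewrite ler_pM.
  have : `|sin u| * `|b| <= 1 * c by rewrite ler_pM.
  lra.
split.
- have E : (fun tau : R => ln_sqdist t (t + tau) * cos (k%:R * (t + tau))) = (fun tau =>
    cos (k%:R * t) * (ln (chord x y t tau) * cos (k%:R * tau)) -
    sin (k%:R * t) * (ln (chord x y t tau) * sin (k%:R * tau))).
    by apply/funext => tau; rewrite mulrDr cosD /ln_sqdist /chord; ring.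
  have [] := @translate (fun s => ln_sqdist t s * cos (k%:R * s)) t tD.
  - by apply: measurable_funM => //; exact: ln_sqdist_measurable.
  - by move=> s; rewrite ln_sqdist_periodic pc.
  - rewrite E; apply: intgB; exact: intgZ.
  move=> _ ->; rewrite E.
  rewrite pintB; [|exact: intgZ..].
  rewrite pintZ// pintZ// -/P -/Q.
  rewrite (_ : _ + _ = cos (k%:R * t) * (P + 2 * pi / k%:R) + sin (k%:R * t) * - Q); last by ring.
  by rewrite -(mulrA 2 C); apply: fin => //; rewrite normrN.
- have E : (fun tau : R => ln_sqdist t (t + tau) * sin (k%:R * (t + tau))) = (fun tau =>
    sin (k%:R * t) * (ln (chord x y t tau) * cos (k%:R * tau)) +
    cos (k%:R * t) * (ln (chord x y t tau) * sin (k%:R * tau))).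
    by apply/funext => tau; rewrite mulrDr sinD /ln_sqdist /chord; ring.
  have [] := @translate (fun s => ln_sqdist t s * sin (k%:R * s)) t tD.
  - by apply: measurable_funM => //; exact: ln_sqdist_measurable.
  - by move=> s; rewrite ln_sqdist_periodic ps.
  - rewrite E; apply: intgD; exact: intgZ.
  move=> _ ->; rewrite E.
  rewrite pintD; [|exact: intgZ..].
  rewrite pintZ// pintZ// -/P -/Q.
  rewrite (_ : _ + _ = cos (k%:R * t) * Q + sin (k%:R * t) * (P + 2 * pi / k%:R)); last by ring.
  by rewrite -(mulrA 2 C); apply: fin.
Qed.

Lemma proximity_lt1 t s : t \in `[0, 2 * pi[ -> s \in `[0, 2 * pi[ -> s != t ->
  proximity t s < 1 /\ - ln_sqdist t s = - ln (1 - proximity t s) - ln (weight t) - ln (weight s).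
Proof.
rewrite !in_itv/= => tD sD st.
have r0 : 0 < (x s - x t) ^+ 2 + (y s - y t) ^+ 2.
  rewrite lt_neqAle addr_ge0 ?sqr_ge0// andbT eq_sym paddr_eq0 ?sqr_ge0// !sqrf_eq0 !subr_eq0.
  by apply: contra st => /andP[/eqP ex /eqP ey]; apply/eqP; exact: inj.
have wt : 0 < weight t by exact: weight_gt0.
have ws : 0 < weight s by exact: weight_gt0.
rewrite /proximity; split; first by rewrite ltrBlDr ltrDl divr_gt0// mulr_gt0.
rewrite subKr ln_div ?posrE ?mulr_gt0// lnM ?posrE// /ln_sqdist.
by move: (ln _) (ln _) (ln _) => a b c; ring.
Qed.

(** Partial sums of the expansion of - ln |gamma(t) - gamma(s)|^2 in powers of
    the kernel [proximity]. *)
Definition ln_sqdist_trunc (N : nat) (t s : R) : R :=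
  \sum_(j < N) (proximity t s ^+ j.+1 / j.+1%:R) - ln (weight t) - ln (weight s).

Let lnw_continuous : continuous (fun t => ln (weight t)).
Proof.
move=> t; apply: (@cont_comp _ _ (@ln R)); last exact: (weight_continuous Cx Cy).
by apply: continuous_ln; exact: weight_gt0.
Qed.

Lemma ln_sqdist_trunc0 t s : ln_sqdist_trunc 0 t s = - ln (weight t) - ln (weight s).
Proof. by rewrite /ln_sqdist_trunc big_ord0 sub0r. Qed.

Lemma ln_sqdist_truncS N t s : ln_sqdist_trunc N.+1 t s = ln_sqdist_trunc N t s + N.+1%:R^-1 * proximity t s ^+ N.+1.
Proof.
by rewrite /ln_sqdist_trunc big_ord_recr/= -!addrA; congr (_ + _); rewrite addrC -!addrA mulrC.
Qed.

Let frX N : finite_rank (fun t s => N.+1%:R^-1 * proximity t s ^+ N.+1).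
Proof. by apply: finite_rankZ; apply: psd_finite_rank; apply: psd_kernelX; exact: psd_proximity Cx Cy. Qed.

Lemma ln_sqdist_trunc_finite_rank N : finite_rank (ln_sqdist_trunc N).
Proof.
elim: N => [|N IH].
  rewrite (_ : ln_sqdist_trunc 0 = (fun t s => - ln (weight t) + - ln (weight s))).
    have cn : continuous (fun t => - ln (weight t)).
      by move=> t; apply: contN; exact: lnw_continuous.
    by apply: finite_rankD; [exact: (finite_rank_l cn)|exact: (finite_rank_r cn)].
  by apply/funext => t; apply/funext => s; rewrite ln_sqdist_trunc0.
rewrite (_ : ln_sqdist_trunc N.+1 = (fun t s => ln_sqdist_trunc N t s + N.+1%:R^-1 * proximity t s ^+ N.+1)).
  exact: finite_rankD.
by apply/funext => t; apply/funext => s; rewrite ln_sqdist_truncS.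
Qed.

Let trunc_error t s N : t \in `[0, 2 * pi[ -> s \in `[0, 2 * pi[ -> s != t ->
  0 <= - ln_sqdist t s - ln_sqdist_trunc N t s <= proximity t s ^+ N.+1 / (1 - proximity t s).
Proof.
move=> tD sD st; have [q1 ->] := proximity_lt1 tD sD st.
have /andP[q0 _] := proximity_01 x y t s.
have q01 : 0 <= proximity t s < 1 by rewrite q0.
have /andP[e1 e2] := log_series N q01; rewrite /ln_sqdist_trunc.
by apply/andP; split; lra.
Qed.

Lemma ln_sqdist_trunc_cvg t s : t \in `[0, 2 * pi[ -> s \in `[0, 2 * pi[ -> s != t ->
  ln_sqdist_trunc N t s @[N --> \oo] --> - ln_sqdist t s.
Proof.
move=> tD sD st; have [q1 _] := proximity_lt1 tD sD st.
have /andP[q0 _] := proximity_01 x y t s.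
have qn : proximity t s ^+ N.+1 / (1 - proximity t s) @[N --> \oo] --> 0.
  have : geometric (proximity t s / (1 - proximity t s)) (proximity t s) N @[N --> \oo] --> 0.
    by apply: cvg_geometric; rewrite ger0_norm.
  by apply: cvg_trans; apply: near_eq_cvg; apply: nearW => N; rewrite /geometric/= exprS; ring.
have low : - ln_sqdist t s - proximity t s ^+ N.+1 / (1 - proximity t s) @[N --> \oo] --> - ln_sqdist t s.
  by rewrite -[X in _ --> X]subr0; apply: cvgB => //; exact: cvg_cst.
apply: squeeze_cvgr low (cvg_cst _); apply: nearW => N.
have /andP[e1 e2] := trunc_error N tD sD st.
by apply/andP; split; lra.
Qed.

Let log_majorant : exists2 c : R, 0 <= c & forall N t s,
  t \in `[0, 2 * pi[ -> s \in `[0, 2 * pi[ -> s != t -> `|ln_sqdist_trunc N t s| <= `|ln_sqdist t s| + c.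
Proof.
have [B B1 HB] := weight_bounded Cx Cy px py.
have lnB t : 0 <= ln (weight t) <= ln B.
  have w1 := weight_ge1 x y t.
  by rewrite ln_ge0//= ler_ln ?posrE ?weight_gt0// (lt_le_trans _ B1).
exists (2 * ln B) => [|N t s tD sD st]; first by rewrite mulr_ge0// ln_ge0.
have /andP[e1 e2] := trunc_error N tD sD st.
have h : - (ln (weight t) + ln (weight s)) <= ln_sqdist_trunc N t s.
  rewrite /ln_sqdist_trunc -addrA -opprD lerDr sumr_ge0// => j _.
  by rewrite divr_ge0// exprn_ge0//; have /andP[] := proximity_01 x y t s.
have /andP[a1 a2] := lnB t; have /andP[b1 b2] := lnB s.
have := ler_norm (- ln_sqdist t s); rewrite normrN => n1.
have n2 := normr_ge0 (ln_sqdist t s).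
rewrite ler_norml; apply/andP; split; lra.
Qed.

(** Twice the logarithmic potential of the density w. *)
Definition pot (w : R -> R) (t : R) : R := pint (fun s => - ln_sqdist t s * w s).

Let potN (w : R -> R) (N : nat) (t : R) : R := pint (fun s => ln_sqdist_trunc N t s * w s).

Lemma finite_rank_sqint F (w : R -> R) : finite_rank F -> sqint w ->
  (forall t, intg (fun s => F t s * w s)) /\ continuous (fun t => pint (fun s => F t s * w s)).
Proof.
move=> fF sw; elim: fF => [u v cu cv|{}F G fF [iF cF] fG [iG cG]].
  have iv : intg (fun s => v s * w s) by apply: intg_sqM => //; exact: cont_sqint.
  have E t : (fun s => u t * v s * w s) = (fun s => u t * (v s * w s)).
    by apply/funext => s; rewrite mulrA.
  split=> [t|]; first by rewrite E; exact: intgZ.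
  rewrite (_ : (fun t => _) = (fun t => u t * pint (fun s => v s * w s))).
    by move=> t; apply: contM; [exact: cu|exact: contc].
  by apply/funext => t; rewrite E pintZ.
have E t : (fun s => (F t s + G t s) * w s) = (fun s => F t s * w s + G t s * w s).
  by apply/funext => s; rewrite mulrDl.
split=> [t|]; first by rewrite E; exact: intgD.
rewrite (_ : (fun t => _) = (fun t => pint (fun s => F t s * w s) + pint (fun s => G t s * w s))).
  by move=> t; apply: contD; [exact: cF|exact: cG].
by apply/funext => t; rewrite E pintD.
Qed.

(** All partial sums are dominated by the logarithm itself plus a constant. Its
    square is integrable uniformly in t, which gives a bound on the potential
    that is uniform as well. *)
Let pot_limit (w : R -> R) : sqint w -> exists K : R, forall t, t \in `[0, 2 * pi[ ->
  [/\ intg (fun s => - ln_sqdist t s * w s), potN w N t @[N --> \oo] --> pot w t &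
     forall N, `|potN w N t| <= K].
Proof.
move=> sw; have [c c0 Hc] := log_majorant; have [A A0 HA] := ln_sqdist_sqint.
exists (2 * A + (2 * c ^+ 2) * (2 * pi) + pint (fun s => w s ^+ 2)) => t tD.
have [sl lA] := HA t tD.
pose g s := (`|ln_sqdist t s| + c) * `|w s|.
have ig : intg g.
  by apply: intg_sqM; [apply: sqintD; [exact: sqint_norm|exact: sqint_cst]|exact: sqint_norm].
have mw : measurable_fun D w by case: sw.
have mN N : measurable_fun D (fun s => ln_sqdist_trunc N t s * w s).
  have [i _] := finite_rank_sqint (ln_sqdist_trunc_finite_rank N) sw.
  by apply/measurable_EFinP; exact: measurable_int (i t).
have ml : measurable_fun D (fun s => - ln_sqdist t s * w s).
  by apply: measurable_funM => //; apply: measurableT_comp.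
have dom N s : s \in `[0, 2 * pi[ -> s != t -> `|ln_sqdist_trunc N t s * w s| <= g s.
  by move=> sD st; rewrite normrM ler_wpM2r//; exact: Hc.
have cvg s : s \in `[0, 2 * pi[ -> s != t ->
    (fun N s => ln_sqdist_trunc N t s * w s) ^~ s @ \oo --> - ln_sqdist t s * w s.
  by move=> sD st; apply: cvgM; [exact: ln_sqdist_trunc_cvg|exact: cvg_cst].
have [i cv] := pint_dominated mN ml cvg ig dom.
split=> // N.
have [iN _] := finite_rank_sqint (ln_sqdist_trunc_finite_rank N) sw.
apply: (@le_trans _ _ (pint g)).
  apply: (le_norm_pint (t := t)) => //.
    by move=> s; rewrite mulr_ge0// addr_ge0.
  by move=> s sD st; exact: dom.
have [_ l2] := sl; have [_ w2] := sw.
have ic : intg (fun=> 2 * c ^+ 2) by apply: cont_intg => ?; exact: contc.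
have -> : 2 * A + 2 * c ^+ 2 * (2 * pi) + pint (fun s => w s ^+ 2) =
    2 * A + pint (fun=> 2 * c ^+ 2) + pint (fun s => w s ^+ 2) by rewrite pint_cst.
apply: (@le_trans _ _ (2 * pint (fun s => ln_sqdist t s ^+ 2) + pint (fun=> 2 * c ^+ 2) + pint (fun s => w s ^+ 2))).
  rewrite -pintZ// -pintD//; last exact: intgZ.
  rewrite -pintD//; last by apply: intgD => //; exact: intgZ.
  apply: le_pint => //; first by apply: intgD => //; apply: intgD => //; exact: intgZ.
  move=> s _; rewrite /g -[ln_sqdist t s ^+ 2]real_normK ?num_real// -[w s ^+ 2]real_normK ?num_real//.
  move: `|ln_sqdist t s| `|w s| (normr_ge0 (ln_sqdist t s)) (normr_ge0 (w s)) => e v e0 v0.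
  have := sqr_ge0 (e - c); have := sqr_ge0 (e + c - v); have := sqr_ge0 e; have := sqr_ge0 c; have := sqr_ge0 v.
  by rewrite !sqrrB sqrrD; nra.
by rewrite !lerD// ler_wpM2l.
Qed.

Lemma pot_integrable (w : R -> R) t : sqint w -> t \in `[0, 2 * pi[ -> intg (fun s => - ln_sqdist t s * w s).
Proof. by move=> sw tD; have [K H] := pot_limit sw; have [] := H t tD. Qed.

Lemma pot_bounded (w : R -> R) : sqint w ->
  measurable_fun D (pot w) /\ exists K : R, forall t, t \in `[0, 2 * pi[ -> `|pot w t| <= K.
Proof.
move=> sw; have [K H] := pot_limit sw; split.
  apply: (@measurable_fun_cvg _ _ _ _ (potN w)) => [N|t tD].
    have [_ c] := finite_rank_sqint (ln_sqdist_trunc_finite_rank N) sw.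
    by apply: measurable_funS (continuous_measurable_fun c).
  by have [] := H t tD.
exists K => t tD; have [_ c b] := H t tD.
by apply: (cvgr_to_le (cvg_norm c)); exact: nearW.
Qed.

Lemma pot_sqint (w : R -> R) : sqint w -> sqint (pot w).
Proof.
move=> sw; have [mp [K HK]] := pot_bounded sw.
by apply: (bounded_sqint (C := K)) => // t tD; exact: HK.
Qed.

(** On functions of mean zero the terms ln weight(t) and ln weight(s) do not
    contribute, and all the others are nonnegative; so every single one is a
    lower bound. *)
Let energy_trunc N m (w : R -> R) : continuous w -> pint w = 0 -> (0 < m)%N ->
  0 <= energy (ln_sqdist_trunc N) w /\
  ((m <= N)%N -> energy (fun t s => proximity t s ^+ m) w / m%:R <= energy (ln_sqdist_trunc N) w).
Proof.
move=> cw w0 m0.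
have psX k : psd_kernel (fun t s => proximity t s ^+ k) by apply: psd_kernelX; exact: psd_proximity Cx Cy.
have eX k : 0 <= energy (fun t s => proximity t s ^+ k) w by exact: energy_ge0.
have ES N' : energy (ln_sqdist_trunc N'.+1) w =
    energy (ln_sqdist_trunc N') w + N'.+1%:R^-1 * energy (fun t s => proximity t s ^+ N'.+1) w.
  rewrite -(energyZ _ (psd_finite_rank (psX N'.+1)) cw).
  rewrite -(energyD (ln_sqdist_trunc_finite_rank N') (frX N') cw).
  by congr (energy _ w); apply/funext => t; apply/funext => s; rewrite ln_sqdist_truncS.
elim: N => [|N [IH1 IH2]].
  split; last by rewrite leqn0 => /eqP m00; rewrite m00 in m0.
  have cl : continuous (fun t => - ln (weight t)).
    by move=> t; apply: contN; exact: lnw_continuous.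
  rewrite (_ : ln_sqdist_trunc 0 = (fun t s => - ln (weight t) + - ln (weight s))); last first.
    by apply/funext => t; apply/funext => s; rewrite ln_sqdist_trunc0.
  rewrite (energyD (finite_rank_l cl) (finite_rank_r cl) cw).
  have clw : continuous (fun t => - ln (weight t) * w t).
    by move=> t; apply: contM; [exact: cl|exact: cw].
  rewrite /energy.
  rewrite (_ : (fun t s => _ * _) = (fun t s => (fun t => - ln (weight t) * w t) t * w s)); last first.
    by apply/funext => t; apply/funext => s; rewrite mulrA.
  rewrite (_ : (fun t s => - ln (weight s) * _) = (fun t s => w t * (fun t => - ln (weight t) * w t) s)); last first.
    by apply/funext => t; apply/funext => s; rewrite mulrCA.
  by rewrite (pint2M clw cw) (pint2M cw clw) w0 mulr0 mul0r addr0.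
rewrite ES; have h : 0 <= N.+1%:R^-1 * energy (fun t s => proximity t s ^+ N.+1) w.
  by apply: mulr_ge0; [rewrite invr_ge0|exact: eX].
split; first exact: addr_ge0.
rewrite leq_eqVlt => /predU1P[->|mN]; first by rewrite mulrC lerDr.
by apply: (le_trans (IH2 _)) => //; rewrite lerDl.
Qed.

Lemma energy_le_pot (w : R -> R) m : continuous w -> pint w = 0 -> (0 < m)%N ->
  energy (fun t s => proximity t s ^+ m) w / m%:R <= pint (fun t => w t * pot w t).
Proof.
move=> cw w0 m0; have sw := cont_sqint cw.
have [K H] := pot_limit sw.
have [mp _] := pot_bounded sw.
have cN N := (finite_rank_sqint (ln_sqdist_trunc_finite_rank N) sw).2.
have [] := @pint_dominated _ (fun N t => w t * potN w N t) (fun t => w t * pot w t) (fun t => K * `|w t|) 0.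
- move=> N; apply: measurable_funS (continuous_measurable_fun _) => // t.
  by apply: contM; [exact: cw|exact: cN].
- by apply: measurable_funM => //; case: sw.
- by move=> t tD _; have [_ c _] := H t tD; apply: cvgM => //; exact: cvg_cst.
- by apply: intgZ; apply: sqint_intg; exact: sqint_norm.
- move=> N t tD _; have [_ _ b] := H t tD.
  by rewrite normrM mulrC ler_wpM2r.
move=> _ cv.
have E N : pint (fun t => w t * potN w N t) = energy (ln_sqdist_trunc N) w.
  rewrite /energy /pint2; congr (pint _); apply/funext => t; rewrite /potN -pintZ.
    by congr (pint _); apply/funext => s; rewrite mulrCA.
  by have [i _] := finite_rank_sqint (ln_sqdist_trunc_finite_rank N) sw; exact: i.
apply: (cvgr_to_ge cv); exists m => // N /= mN; rewrite E.
by have [_] := energy_trunc N cw w0 m0; exact.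
Qed.

End log_kernel.

(** * Real trigonometric polynomials *)

Section trigonometric.
Context {R : realType}.
Local Notation mu := (@lebesgue_measure R).
Local Notation D := (`[0, 2 * pi[%classic : set R).
Local Notation intg f := (mu.-integrable D (EFin \o f)).

Let p0 : 0 < pi :> R. Proof. exact: pi_gt0. Qed.
Let p20 : 0 < 2 * pi :> R. Proof. by rewrite mulr_gt0. Qed.

Lemma cont_cosM (c : R) : continuous (fun t => cos (c * t) : R).
Proof.
move=> u; apply: (@cont_comp _ _ cos); first exact: continuous_cos.
by apply: contM; [exact: contc|exact: cvg_id].
Qed.

Lemma cont_sinM (c : R) : continuous (fun t => sin (c * t) : R).
Proof.
move=> u; apply: (@cont_comp _ _ sin); first exact: continuous_sin.
by apply: contM; [exact: contc|exact: cvg_id].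
Qed.

Lemma pint_cos (k : nat) : (0 < k)%N -> pint (fun t : R => cos (k%:R * t)) = 0.
Proof.
move=> k0; have kn0 : k%:R != 0 :> R by rewrite pnatr_eq0 -lt0n.
pose F (t : R) := sin (k%:R * t) / k%:R.
have dF (t : R) : is_derive t 1 F (cos (k%:R * t)).
  have d := is_deriveZ k%:R^-1 (is_derive_sinM k%:R t).
  have -> : F = k%:R^-1 *: (fun t => sin (k%:R * t)) by apply/funext => u; rewrite /F mulrC.
  by apply: is_derive_eq; rewrite /GRing.scale/=; field.
have cF : continuous F by move=> u; exact: is_derive_continuous.
have -> : pint (fun t : R => cos (k%:R * t)) = F (2 * pi) - F 0.
  apply: (@Rintegral_FTC_approx _ _ F F (fun=> 0)) => //.
  - by move=> u _; exact: cont_cosM.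
  - apply: continuous_compact_integrable; first exact: segment_compact.
    by apply: continuous_subspaceT; exact: cont_cosM.
  - by move=> u; exact: contc.
  - by move=> u _; rewrite subrr normr0.
by rewrite /F sin_natM2pi mulr0 sin0 mul0r subrr.
Qed.

Lemma pint_sin (k : nat) : pint (fun t : R => sin (k%:R * t)) = 0.
Proof.
have [->|k0] := posnP k.
  by rewrite (_ : (fun _ => _) = (fun=> 0)) ?pint_cst ?mul0r//; apply/funext => t; rewrite mul0r sin0.
have kn0 : k%:R != 0 :> R by rewrite pnatr_eq0 -lt0n.
pose F (t : R) := - cos (k%:R * t) / k%:R.
have dF (t : R) : is_derive t 1 F (sin (k%:R * t)).
  have d := is_deriveZ (- k%:R^-1) (is_derive_cosM k%:R t).
  have -> : F = (- k%:R^-1) *: (fun t => cos (k%:R * t)).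
    by apply/funext => u; rewrite /F mulNr -mulrN mulrC.
  by apply: is_derive_eq; rewrite /GRing.scale/=; field.
have cF : continuous F by move=> u; exact: is_derive_continuous.
have -> : pint (fun t : R => sin (k%:R * t)) = F (2 * pi) - F 0.
  apply: (@Rintegral_FTC_approx _ _ F F (fun=> 0)) => //.
  - by move=> u _; exact: cont_sinM.
  - apply: continuous_compact_integrable; first exact: segment_compact.
    by apply: continuous_subspaceT; exact: cont_sinM.
  - by move=> u; exact: contc.
  - by move=> u _; rewrite subrr normr0.
by rewrite /F cos_natM2pi mulr0 cos0 subrr.
Qed.

(** The index (j, b) stands for the frequency j + 1; b selects the cosine. *)
Definition trig (n : nat) (p : 'I_n * bool) (t : R) : R :=
  if p.2 then cos (p.1.+1%:R * t) else sin (p.1.+1%:R * t).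

Lemma trig_continuous n (p : 'I_n * bool) : continuous (trig p).
Proof. by rewrite /trig; case: p => k [] /=; [exact: cont_cosM|exact: cont_sinM]. Qed.

Lemma pint_trig n (p : 'I_n * bool) : pint (trig p) = 0.
Proof. by case: p => k [] ; [exact: pint_cos|exact: pint_sin]. Qed.

Let cosM (a b : R) : cos a * cos b = (1 / 2) * (cos (a - b) + cos (a + b)).
Proof. by rewrite cosB cosD; field. Qed.
Let sinM (a b : R) : sin a * sin b = (1 / 2) * (cos (a - b) - cos (a + b)).
Proof. by rewrite cosB cosD; field. Qed.
Let sincosM (a b : R) : sin a * cos b = (1 / 2) * (sin (a + b) + sin (a - b)).
Proof. by rewrite sinB sinD; field. Qed.

Let pint_cosB (j k : nat) : pint (fun t : R => cos (j%:R * t - k%:R * t)) = (2 * pi) *+ (j == k).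
Proof.
wlog kj : j k / (k <= j)%N.
  move=> H; have [/H//|/ltnW/H] := leqP k j.
  rewrite eq_sym => <-; congr pint; apply/funext => t; by rewrite -cosN opprB.
have -> : (fun t : R => cos (j%:R * t - k%:R * t)) = (fun t => cos ((j - k)%:R * t)).
  by apply/funext => t; rewrite -mulrBl natrB.
case: eqVneq => [->|jk]; last by rewrite pint_cos ?subn_gt0 ?ltn_neqAle 1?eq_sym ?jk.
rewrite subnn (_ : (fun _ => _) = (fun=> 1)) ?pint_cst ?mul1r//.
by apply/funext => t; rewrite mul0r cos0.
Qed.

Let pint_sinB (j k : nat) : pint (fun t : R => sin (j%:R * t - k%:R * t)) = 0.
Proof.
have [kj|/ltnW kj] := leqP k j.
  have -> : (fun t : R => sin (j%:R * t - k%:R * t)) = (fun t => sin ((j - k)%:R * t)).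
    by apply/funext => t; rewrite -mulrBl natrB.
  exact: pint_sin.
have -> : (fun t : R => sin (j%:R * t - k%:R * t)) = (fun t => (- 1) * sin ((k - j)%:R * t)).
  by apply/funext => t; rewrite natrB// mulrBl -opprB sinN mulN1r.
by rewrite pintZ ?pint_sin ?mulr0//; apply: cont_intg; exact: cont_sinM.
Qed.

Let cont_cosB (j k : nat) : continuous (fun t : R => cos (j%:R * t - k%:R * t)).
Proof. by rewrite (_ : (fun _ => _) = (fun t : R => cos ((j%:R - k%:R) * t))); [exact: cont_cosM|apply/funext => t; rewrite mulrBl]. Qed.
Let cont_sinB (j k : nat) : continuous (fun t : R => sin (j%:R * t - k%:R * t)).
Proof. by rewrite (_ : (fun _ => _) = (fun t : R => sin ((j%:R - k%:R) * t))); [exact: cont_sinM|apply/funext => t; rewrite mulrBl]. Qed.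

Lemma trig_orthogonal n (p q : 'I_n * bool) : pint (fun t => trig p t * trig q t) = pi *+ (p == q).
Proof.
have E (j k : 'I_n) (t : R) : j.+1%:R * t + k.+1%:R * t = (j.+1 + k.+1)%:R * t by rewrite natrD mulrDl.
have h (r : R) (b : bool) : 1 / 2 * ((2 * r) *+ b) = r *+ b by case: b; rewrite ?mulr1n ?mulr0n; [field|ring].
have cD (j k : nat) : continuous (fun t : R => cos ((j + k)%:R * t)) by exact: cont_cosM.
have sD (j k : nat) : continuous (fun t : R => sin ((j + k)%:R * t)) by exact: cont_sinM.
have nz (j k : 'I_n) : (0 < j.+1 + k.+1)%N by [].
case: p q => [j []] [k []]; rewrite /trig/= xpair_eqE.
- under [X in pint X]eq_fun do rewrite cosM E.
  rewrite pintZ; last by apply: cont_intg => t; apply: contD; [exact: cont_cosB|exact: cD].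
  rewrite pintD; [|exact/cont_intg/cont_cosB|exact/cont_intg/cD].
  by rewrite pint_cos// pint_cosB addr0 eqSS h andbT.
- under [X in pint X]eq_fun do rewrite mulrC sincosM addrC E.
  rewrite andbF pintZ; last by apply: cont_intg => t; apply: contD; [exact: cont_sinB|exact: sD].
  rewrite pintD; [|exact/cont_intg/cont_sinB|exact/cont_intg/sD].
  by rewrite pint_sin pint_sinB addr0 mulr0.
- under [X in pint X]eq_fun do rewrite sincosM addrC E.
  rewrite andbF pintZ; last by apply: cont_intg => t; apply: contD; [exact: cont_sinB|exact: sD].
  rewrite pintD; [|exact/cont_intg/cont_sinB|exact/cont_intg/sD].
  by rewrite pint_sin pint_sinB addr0 mulr0.
- under [X in pint X]eq_fun do rewrite sinM E.
  rewrite pintZ; last by apply: cont_intg => t; apply: contB; [exact: cont_cosB|exact: cD].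
  rewrite pintB; [|exact/cont_intg/cont_cosB|exact/cont_intg/cD].
  by rewrite pint_cos// pint_cosB subr0 eqSS h andbT.
Qed.

Lemma intg_sum (I : finType) (F : I -> R -> R) : (forall i, intg (F i)) ->
  intg (fun t => \sum_i F i t) /\ pint (fun t => \sum_i F i t) = \sum_i pint (F i).
Proof.
move=> iF.
have H (r : seq I) : intg (fun t => \sum_(i <- r) F i t) /\
    pint (fun t => \sum_(i <- r) F i t) = \sum_(i <- r) pint (F i).
  elim: r => [|i r [IH1 IH2]].
    rewrite big_nil (_ : (fun _ => _) = (fun=> 0)); last by apply/funext => t; rewrite big_nil.
    by split; [apply: cont_intg => t; exact: contc|rewrite pint_cst mul0r].
  rewrite big_cons (_ : (fun _ => _) = (fun t => F i t + \sum_(i <- r) F i t)).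
    by split; [exact: intgD|rewrite pintD// IH2].
  by apply/funext => t; rewrite big_cons.
exact: H.
Qed.

(** For G = 0 a large s shows that d = 0; otherwise s = d / G is optimal. *)
Lemma quadratic_discriminant (F G d : R) : 0 <= G ->
  (forall s : R, 0 <= F - (2 * s) * d + s ^+ 2 * G) -> d ^+ 2 <= F * G.
Proof.
move=> G0 H.
move: G0; rewrite le_eqVlt => /predU1P[G0|G0].
  rewrite -G0 mulr0; have [->|d0] := eqVneq d 0; first by rewrite expr0n.
  have := H ((F + 1) / (2 * d)); rewrite -G0 mulr0 addr0.
  rewrite (_ : F - _ = - 1); first by rewrite ler0N1.
  by field.
have := H (d / G).
rewrite (_ : _ + _ = F - d ^+ 2 / G); last by field; rewrite gt_eqF.
by rewrite subr_ge0 ler_pdivrMr.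
Qed.

Lemma pint_cauchy_schwarz (f g : R -> R) : sqint f -> sqint g ->
  pint (fun t => f t * g t) ^+ 2 <= pint (fun t => f t ^+ 2) * pint (fun t => g t ^+ 2).
Proof.
move=> sf sg; have [_ f2] := sf; have [_ g2] := sg; have fg := intg_sqM sf sg.
apply: quadratic_discriminant => [|s]; first by apply: pint_ge0 => t _; exact: sqr_ge0.
rewrite -pintZ// -pintZ// -pintB//; last exact: intgZ.
rewrite -pintD; [|by apply: intgB => //; exact: intgZ|exact: intgZ].
apply: pint_ge0 => t _.
have -> : f t ^+ 2 - 2 * s * (f t * g t) + s ^+ 2 * g t ^+ 2 = (f t - s * g t) ^+ 2 by ring.
exact: sqr_ge0.
Qed.

Definition tpoly (n : nat) (a : 'I_n * bool -> R) (t : R) : R := \sum_p a p * trig p t.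

Lemma tpoly_continuous n (a : 'I_n * bool -> R) : continuous (tpoly a).
Proof. by move=> t; apply: cont_sum => p; apply: contM; [exact: contc|exact: trig_continuous]. Qed.

Lemma pint_tpolyM n (a : 'I_n * bool -> R) (h : R -> R) :
  (forall p : 'I_n * bool, intg (fun t => trig p t * h t)) ->
  pint (fun t => tpoly a t * h t) = \sum_p a p * pint (fun t => trig p t * h t).
Proof.
move=> ih.
have -> : (fun t => tpoly a t * h t) = (fun t => \sum_p a p * (trig p t * h t)).
  by apply/funext => t; rewrite mulr_suml; apply: eq_bigr => p _; rewrite mulrA.
have [//|_ ->] := intg_sum (F := fun p t => a p * (trig p t * h t)).
  by move=> p; exact: intgZ.
by apply: eq_bigr => p _; rewrite pintZ.
Qed.

Lemma pint_trigM_tpoly n (a : 'I_n * bool -> R) p : pint (fun t => trig p t * tpoly a t) = a p * pi.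
Proof.
under [X in pint X]eq_fun do rewrite mulrC.
rewrite pint_tpolyM.
  rewrite (bigD1 p)//= trig_orthogonal eqxx mulr1n big1 ?addr0// => q qp.
  by rewrite trig_orthogonal (negbTE qp) mulr0n mulr0.
by move=> q; apply: cont_intg => t; apply: contM; exact: trig_continuous.
Qed.

Lemma pint_tpoly n (a : 'I_n * bool -> R) : pint (tpoly a) = 0.
Proof.
have [|_ ->] := intg_sum (F := fun p t => a p * trig p t).
  by move=> p; apply: intgZ; apply: cont_intg; exact: trig_continuous.
rewrite big1// => p _; rewrite pintZ ?pint_trig ?mulr0//.
by apply: cont_intg; exact: trig_continuous.
Qed.

Lemma parseval n (a : 'I_n * bool -> R) : pint (fun t => tpoly a t ^+ 2) = pi * \sum_p a p ^+ 2.
Proof.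
under [X in pint X]eq_fun do rewrite expr2.
rewrite pint_tpolyM; last first.
  by move=> p; apply: cont_intg => t; apply: contM; [exact: trig_continuous|exact: tpoly_continuous].
rewrite mulr_sumr; apply: eq_bigr => p _; rewrite pint_trigM_tpoly; ring.
Qed.

Lemma bessel n (h : R -> R) : sqint h ->
  \sum_(p : 'I_n * bool) pint (fun t => trig p t * h t) ^+ 2 <= pi * pint (fun t => h t ^+ 2).
Proof.
move=> sh; have [_ h2] := sh.
have pn0 : pi != 0 :> R by rewrite gt_eqF.
pose b (p : 'I_n * bool) := pint (fun t => trig p t * h t) / pi.
have st (p : 'I_n * bool) : sqint (trig p) by apply: cont_sqint; exact: trig_continuous.
have sb : sqint (tpoly b) by apply: cont_sqint; exact: tpoly_continuous.
have bh := intg_sqM sb sh; have [_ b2] := sb.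
have : 0 <= pint (fun t => h t ^+ 2) - 2 * pint (fun t => tpoly b t * h t) + pint (fun t => tpoly b t ^+ 2).
  rewrite -pintZ// -pintB//; last exact: intgZ.
  rewrite -pintD//; last by apply: intgB => //; exact: intgZ.
  apply: pint_ge0 => t _.
  have -> : h t ^+ 2 - 2 * (tpoly b t * h t) + tpoly b t ^+ 2 = (h t - tpoly b t) ^+ 2 by ring.
  exact: sqr_ge0.
rewrite pint_tpolyM; last by move=> p; exact: intg_sqM.
rewrite parseval; set S := \sum_p pint _ ^+ 2.
have aux (P z : R) : P != 0 ->
  [/\ z / P * z = z ^+ 2 / P, (z / P) ^+ 2 = z ^+ 2 / P ^+ 2 & P * (z / P ^+ 2) = z / P].
  by move=> P0; split; field.
have -> : \sum_p b p * pint (fun t => trig p t * h t) = S / pi.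
  rewrite /S mulr_suml; apply: eq_bigr => p _.
  by rewrite /b; have [-> _ _] := aux pi (pint (fun t => trig p t * h t)) pn0.
have -> : \sum_p b p ^+ 2 = S / pi ^+ 2.
  rewrite /S mulr_suml; apply: eq_bigr => p _.
  by rewrite /b; have [_ -> _] := aux pi (pint (fun t => trig p t * h t)) pn0.
have [_ _ ->] := aux pi S pn0; move: (pint _) => A H.
rewrite mulrC -ler_pdivrMr// -/S; move: (S / pi) H => z; lra.
Qed.

Lemma sum_trig_index n (F : nat -> R) : \sum_(p : 'I_n * bool) F p.1 = 2 * \sum_(j < n) F j.
Proof.
rewrite -(pair_bigA _ (fun (j : 'I_n) (b : bool) => F j))/= mulr_sumr.
by apply: eq_bigr => j _; rewrite big_bool/=; ring.
Qed.

Lemma sum_low n N (c : R) : 0 <= c -> \sum_(j < n) (if (j < N)%N then c else 0) <= N%:R * c.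
Proof.
move=> c0; have H : \sum_(j < n) (if (j < N)%N then c else 0) = (minn n N)%:R * c.
  elim: n => [|n IH]; first by rewrite big_ord0 min0n mul0r.
  rewrite big_ord_recr/= IH; case: ltnP => h.
    by rewrite (minn_idPl h) -natr1; ring.
  by rewrite (minn_idPr (leqW h)) addr0.
by rewrite H ler_wpM2r// ler_nat geq_minr.
Qed.

(** 1 / (j + 1)^2 <= 1 / j - 1 / (j + 1), and the sum telescopes. *)
Lemma sum_high n N : (0 < N)%N ->
  \sum_(j < n) (if (j < N)%N then 0 else j.+1%:R ^- 2) <= N%:R^-1 :> R.
Proof.
move=> N0; have Np : 0 < N%:R :> R by rewrite ltr0n.
have H : \sum_(j < n) (if (j < N)%N then 0 else j.+1%:R ^- 2) <= N%:R^-1 - (maxn n N)%:R^-1 :> R.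
  elim: n => [|n IH]; first by rewrite big_ord0 max0n subrr.
  rewrite big_ord_recr/=; have [h|h] := boolP (n < N)%N; last rewrite -leqNgt in h.
    by rewrite addr0; move: IH; rewrite (maxn_idPr (ltnW h)) (maxn_idPr h).
  apply: (le_trans (lerD IH (lexx _))); rewrite (maxn_idPl h) (maxn_idPl (leqW h)).
  have n0 : 0 < n%:R :> R by rewrite (lt_le_trans Np)// ler_nat.
  rewrite -natr1; set z : R := n%:R in n0 *.
  rewrite -subr_ge0 (_ : _ - _ = (z * (z + 1) ^+ 2)^-1); first by rewrite invr_ge0 mulr_ge0 ?sqr_ge0 ?ltW.
  have z1 : z + 1 != 0 by rewrite gt_eqF// addr_gt0.
  by move: n0 => /lt0r_neq0 n0; move: Np => /lt0r_neq0 Np'; field; rewrite ?z1 ?n0 ?Np'.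
by apply: (le_trans H); rewrite gerBl invr_ge0.
Qed.

End trigonometric.

(** * Stability on trigonometric polynomials *)

Section absorption.
Context {R : realType}.

Let nat_above (z : R) : exists2 N : nat, (0 < N)%N & z <= N%:R.
Proof.
exists (Num.truncn `|z|).+1 => //; apply: le_trans (ler_norm z) _; apply: ltW.
by have /andP[] := truncn_itv (normr_ge0 z).
Qed.

(** X is the square of the degree, W the sum of the squares of all coefficients,
    Wh N that of the coefficients of frequency above N, and E m the energy for
    the m-th power of the kernel. The tail is absorbed by the choice of N, the
    Lipschitz error by that of m, and the first summand of the upper bound for
    E m by that of e. *)
Lemma absorb (c1 Cu C3 K4 : R) : 0 < c1 -> 0 <= Cu -> 0 <= C3 -> 0 <= K4 ->
  exists2 C : R, 0 <= C & forall (X W B : R) (E : nat -> R) (Wh : nat -> R), 1 <= X -> 0 <= W -> 0 <= B ->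
  (forall N, (0 < N)%N -> Wh N <= C3 * (X * B + 2 * W / N%:R)) ->
  (forall N m, (0 < m)%N -> (c1 * (W - Wh N) - Cu * Wh N) / Num.sqrt m%:R - K4 * N%:R ^+ 4 * W / m%:R <= E m) ->
  (forall m (e : R), (0 < m)%N -> 0 < e -> E m <= m%:R * (e * W + B / e)) ->
  W <= C * (X * B).
Proof.
move=> c10 Cu0 C30 K40; pose b := c1 + Cu.
have b0 : 0 <= b by rewrite addr_ge0// ltW.
have [N N0 HN] := nat_above (8 * b * C3 / c1).
have [m m0 Hm] := nat_above ((4 * K4 * N%:R ^+ 4 / c1) ^+ 2).
have NR : 0 < N%:R :> R by rewrite ltr0n.
have mR : 0 < m%:R :> R by rewrite ltr0n.
pose s : R := Num.sqrt m%:R.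
have s0 : 0 < s by rewrite sqrtr_gt0.
have s2 : m%:R = s ^+ 2 by rewrite sqr_sqrtr// ltW.
(* e makes s^3 e W a quarter of c1 W *)
pose e := c1 / (4 * s ^+ 3).
have e0 : 0 < e by rewrite divr_gt0// mulr_gt0// exprn_gt0.
exists ((b * C3 + s ^+ 3 / e) * 4 / c1).
  have se : 0 <= s ^+ 3 / e by apply: divr_ge0; [apply: exprn_ge0|]; exact: ltW.
  have bC : 0 <= b * C3 by exact: mulr_ge0.
  by apply: divr_ge0; [apply: mulr_ge0; [exact: addr_ge0|]|exact: ltW].
move=> X W B E Wh X1 W0 B0 H1 H2 H3.
have := le_trans (H2 N m m0) (H3 m e m0 e0); rewrite -/s s2 => H.
have {}H : c1 * W - b * Wh N - K4 * N%:R ^+ 4 * W / s <= s ^+ 3 * (e * W + B / e).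
  rewrite (_ : s ^+ 3 * _ = s ^+ 2 * (e * W + B / e) * s); last by rewrite !exprS expr0; ring.
  rewrite -ler_pdivrMr//; apply: le_trans H.
  by rewrite /b le_eqVlt; apply/orP; left; apply/eqP; field; rewrite gt_eqF.
have h1 : K4 * N%:R ^+ 4 * W / s <= c1 / 4 * W.
  rewrite mulrAC ler_wpM2r// ler_pdivrMr//.
  have : 4 * K4 * N%:R ^+ 4 / c1 <= s.
    by rewrite -[leRHS]ger0_norm ?(ltW s0)// -[leRHS]sqrtr_sqr -s2 -[leLHS]ger0_norm -?sqrtr_sqr ?ler_wsqrtr//
      !mulr_ge0 ?exprn_ge0 ?invr_ge0// ltW.
  rewrite ler_pdivrMr//; lra.
have h2 : b * Wh N <= b * C3 * (X * B) + c1 / 4 * W.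
  apply: (@le_trans _ _ (b * (C3 * (X * B + 2 * W / N%:R)))); first by rewrite ler_wpM2l// H1.
  have : 8 * b * C3 / N%:R <= c1.
    by rewrite ler_pdivrMr// [c1 * _]mulrC -ler_pdivrMr.
  move=> h; have := ler_wpM2r W0 h; lra.
have h3 : s ^+ 3 * (e * W + B / e) <= c1 / 4 * W + s ^+ 3 / e * (X * B).
  have -> : s ^+ 3 * (e * W + B / e) = c1 / 4 * W + s ^+ 3 / e * B.
    by rewrite {1}/e /e; field; rewrite !gt_eqF.
  have se : 0 <= s ^+ 3 / e by apply: divr_ge0; [apply: exprn_ge0|]; exact: ltW.
  by rewrite lerD2l; apply: (ler_wpM2l se); rewrite ler_peMl.
have h : c1 * W <= 4 * ((b * C3 + s ^+ 3 / e) * (X * B)).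
  rewrite (mulrDl (b * C3)); move: (s ^+ 3 / e * (X * B)) (b * C3 * (X * B)) H h1 h2 h3.
  move: (s ^+ 3 * _) (b * Wh N) (_ / s) => *; lra.
rewrite (_ : _ * (X * B) = 4 * ((b * C3 + s ^+ 3 / e) * (X * B)) / c1); last by ring.
by rewrite ler_pdivlMr// mulrC.
Qed.

End absorption.

Section stability.
Context {R : realType}.
Variables (x x1 x2 x3 y y1 y2 y3 : R -> R) (M : R).
Hypotheses (M0 : 0 <= M) (Cx : C3fun x x1 x2 x3 M) (Cy : C3fun y y1 y2 y3 M).
Hypotheses (px : forall t : R, x (t + 2 * pi) = x t) (py : forall t : R, y (t + 2 * pi) = y t).
Hypothesis inj : forall s t : R, 0 <= s < 2 * pi -> 0 <= t < 2 * pi -> x s = x t -> y s = y t -> s = t.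
Hypothesis reg : forall t : R, 0 < x1 t ^+ 2 + y1 t ^+ 2.
Variable sp : R -> R.
Hypotheses (csp : continuous sp) (sp0 : 0 < pint sp).
Local Notation mu := (@lebesgue_measure R).
Local Notation D := (`[0, 2 * pi[%classic : set R).
Local Notation intg f := (mu.-integrable D (EFin \o f)).
Local Notation proximity := (proximity x y).
Local Notation ln_sqdist := (ln_sqdist x y).
Local Notation pot := (pot x y).

Let p0 : 0 < pi :> R. Proof. exact: pi_gt0. Qed.
Let p20 : 0 < 2 * pi :> R. Proof. by rewrite mulr_gt0. Qed.
Let p1 : 1 <= pi :> R. Proof. by have := @pi_ge2 R; lra. Qed.

(** The part of the kernel that is independent of the integration variable. *)
Definition mean_shift (t : R) : R := (pint sp)^-1 * (1 - (4 * pi)^-1 * pot sp t).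
(** The operator on real functions; see [symm_op_real]. *)
Definition symm_real (f : R -> R) (t : R) : R := (4 * pi)^-1 * pot f t + mean_shift t * pint f.

Let ssp : sqint sp. Proof. exact: cont_sqint. Qed.

Let pots (f : R -> R) : sqint f -> sqint (pot f).
Proof. exact: pot_sqint M0 Cx Cy px py inj reg f. Qed.

Lemma symm_real_sqint (f : R -> R) : sqint f -> sqint (symm_real f).
Proof.
move=> sf; apply: sqintD; first by apply: sqintZ; exact: pots.
have s1 : sqint mean_shift.
  have := sqintZ (pint sp)^-1 (sqintD (sqint_cst 1) (sqintZ (- (4 * pi)^-1) (pots ssp))).
  congr sqint; apply/funext => t; rewrite /mean_shift; congr (_ * _).
  by rewrite mulNr.
have := sqintZ (pint f) s1; congr sqint; apply/funext => t; exact: mulrC.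
Qed.

Lemma symm_real_weight t : symm_real sp t = 1.
Proof.
rewrite /symm_real /mean_shift; move: (pot sp t) ((4 * pi)^-1) => a b.
by field; rewrite gt_eqF.
Qed.

Let strig n (p : 'I_n * bool) : sqint (trig p : R -> R).
Proof. by apply: cont_sqint; exact: trig_continuous. Qed.

Let stpoly n (a : 'I_n * bool -> R) : sqint (tpoly a).
Proof. by apply: cont_sqint; exact: tpoly_continuous. Qed.

(** The main part is the Fourier multiplier 1 / (2k) of the unit circle. *)
Lemma symm_real_trig : exists2 C : R, 0 <= C & forall n (p : 'I_n * bool) t, t \in `[0, 2 * pi[ ->
  `|symm_real (trig p) t - trig p t / (2 * p.1.+1%:R)| <= C / p.1.+1%:R ^+ 2.
Proof.
have [C C0 HC] := ln_sqdist_fourier M0 Cx Cy px py inj reg.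
exists C => // n p t tD.
have k0 : p.1.+1%:R != 0 :> R by rewrite pnatr_eq0.
have := HC p.1.+1 t isT tD.
have E : pot (trig p) t = - pint (fun s => ln_sqdist t s * trig p s).
  have i := pot_integrable M0 Cx Cy px py inj reg (strig p) tD.
  have := pintZ (- 1) i; rewrite mulN1r => H; rewrite /pot -[LHS]opprK -H.
  by congr (- _); congr pint; apply/funext => s; ring.
rewrite /symm_real pint_trig mulr0 addr0 E => -[hc hs].
have H : `|pint (fun s => ln_sqdist t s * trig p s) + 2 * pi / p.1.+1%:R * trig p t| <= C / p.1.+1%:R ^+ 2.
  by rewrite /trig; case: ifP.
have aux (P A T k : R) : P != 0 -> k != 0 ->
    (4 * P)^-1 * - A - T / (2 * k) = - ((4 * P)^-1 * (A + 2 * P / k * T)).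
  by move=> P0 kn0; field; rewrite P0 kn0.
rewrite aux//; last by rewrite gt_eqF.
rewrite normrN normrM ger0_norm ?invr_ge0 ?mulr_ge0 ?(ltW p0)//.
apply: le_trans H; rewrite ler_piMl//.
by rewrite invf_le1 ?mulr_gt0//; move: p1; lra.
Qed.

Lemma pot_tpoly n (a : 'I_n * bool -> R) t : t \in `[0, 2 * pi[ ->
  pot (tpoly a) t = \sum_p a p * pot (trig p) t.
Proof.
move=> tD.
have i p := pot_integrable M0 Cx Cy px py inj reg (@strig n p) tD.
rewrite /pot.
have -> : (fun s => - ln_sqdist t s * tpoly a s) = (fun s => tpoly a s * - ln_sqdist t s).
  by apply/funext => s; rewrite mulrC.
rewrite pint_tpolyM.
  by apply: eq_bigr => p _; congr (_ * pint _); apply/funext => s; rewrite mulrC.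
move=> p; apply: eq_integrable (i p) => // s _ /=.
by rewrite mulrC.
Qed.

Definition low_part n N (a : 'I_n * bool -> R) (p : 'I_n * bool) : R := if (p.1 < N)%N then a p else 0.
Definition high_part n N (a : 'I_n * bool -> R) (p : 'I_n * bool) : R := if (p.1 < N)%N then 0 else a p.

Let trig_lipschitz n (p : 'I_n * bool) (t tau : R) :
  `|trig p (t + tau) - trig p t| <= p.1.+1%:R * `|tau|.
Proof.
have := @mean_value_bound R (fun u => trig p (t + u) - trig p t)
  (fun u => if p.2 then - (p.1.+1%:R * sin (p.1.+1%:R * (t + u))) else p.1.+1%:R * cos (p.1.+1%:R * (t + u)))
  p.1.+1%:R tau 0.
rewrite expr1 addr0 subrr => /(_ erefl); apply.
- move=> u.
  have d : forall v : R, is_derive v 1 (trig p) (if p.2 then - (p.1.+1%:R * sin (p.1.+1%:R * v)) else p.1.+1%:R * cos (p.1.+1%:R * v)).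
    move=> v; rewrite /trig; case: ifP => _.
      by have d := is_derive_cosM p.1.+1%:R v; apply: is_derive_eq; ring.
    by have d := is_derive_sinM p.1.+1%:R v; apply: is_derive_eq; ring.
  have d' := is_derive_translate t u d.
  by apply: is_derive_eq; ring.
- move=> u; rewrite expr0 mulr1; case: ifP => _; rewrite ?normrN normrM ger0_norm// ler_piMr// ler_norml.
    by rewrite sin_geN1 sin_le1.
  by rewrite cos_geN1 cos_le1.
- by [].
Qed.

Let low_lipschitz n N (a : 'I_n * bool -> R) (t tau : R) :
  `|tpoly (low_part N a) (t + tau) - tpoly (low_part N a) t| <=
    2 * N%:R ^+ 2 * Num.sqrt (\sum_p a p ^+ 2) * `|tau|.
Proof.
set W := \sum_p _.
have aW p : `|a p| <= Num.sqrt W.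
  rewrite -sqrtr_sqr ler_wsqrtr// /W (bigD1 p)//= lerDl sumr_ge0// => q _.
  exact: sqr_ge0.
rewrite /tpoly -sumrB; apply: (le_trans (ler_norm_sum _ _ _)).
apply: (@le_trans _ _ (\sum_(p : 'I_n * bool) (fun j => if (j < N)%N then Num.sqrt W * N%:R * `|tau| else 0) p.1)).
  apply: ler_sum => p _; rewrite /low_part; case: ifP => pN; last by rewrite !mul0r subrr normr0.
  rewrite -mulrBr normrM -mulrA; apply: ler_pM => //.
  by apply: (le_trans (trig_lipschitz _ _ _)); rewrite ler_wpM2r// ler_nat.
rewrite (sum_trig_index _ (fun j => if (j < N)%N then Num.sqrt W * N%:R * `|tau| else 0)).
have c0 : 0 <= Num.sqrt W * N%:R * `|tau| by rewrite !mulr_ge0// sqrtr_ge0.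
have := sum_low n N c0; lra.
Qed.

Let sum_low_high n N (a : 'I_n * bool -> R) :
  \sum_p a p ^+ 2 = \sum_p low_part N a p ^+ 2 + \sum_p high_part N a p ^+ 2.
Proof.
rewrite -big_split/=; apply: eq_bigr => p _; rewrite /low_part /high_part.
by case: ifP => _; ring.
Qed.

Let tpoly_low_high n N (a : 'I_n * bool -> R) t : tpoly a t = tpoly (low_part N a) t + tpoly (high_part N a) t.
Proof.
rewrite /tpoly -big_split/=; apply: eq_bigr => p _; rewrite /low_part /high_part.
by case: ifP => _; ring.
Qed.

(** The tail enters only through its square norm, by [energy_upper]; the low part
    has Lipschitz constant at most 2 N^2 sqrt W, and [power_gap] makes its
    defect in Schur's test of order 1 / m. *)
Lemma energy_tpoly_lower : exists c1 Cu K4 : R, [/\ 0 < c1, 0 <= Cu, 0 <= K4 &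
  forall n (a : 'I_n * bool -> R) N m, (0 < m)%N ->
  (c1 * (\sum_p a p ^+ 2 - \sum_p high_part N a p ^+ 2) - Cu * \sum_p high_part N a p ^+ 2) / Num.sqrt m%:R
    - K4 * N%:R ^+ 4 * (\sum_p a p ^+ 2) / m%:R <= energy (fun t s => proximity t s ^+ m) (tpoly a)].
Proof.
have [c c0 Hc] := pint_proximity_lower M0 Cx Cy px py.
have [U U0 HU] := pint_proximity_upper M0 Cx Cy px py inj reg.
have [K K0 HK] := proximity_controls_lipschitz M0 Cx Cy px py inj reg.
exists (c * pi / 2), (U * pi), (2 * K * (2 * pi) ^+ 2); split.
- by rewrite divr_gt0// mulr_gt0.
- by rewrite mulr_ge0// ltW.
- by rewrite !mulr_ge0 ?sqr_ge0// ltW.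
move=> n a N m m0.
set W := \sum_p _; set Wh := \sum_p _.
have mR : 0 < m%:R :> R by rewrite ltr0n.
have W0 : 0 <= W by rewrite sumr_ge0// => p _; exact: sqr_ge0.
have psX : psd_kernel (fun t s => proximity t s ^+ m) by apply: psd_kernelX; exact: psd_proximity Cx Cy.
have frX := psd_finite_rank psX.
have cl := @tpoly_continuous _ n (low_part N a); have ch := @tpoly_continuous _ n (high_part N a).
have sy t s : proximity t s ^+ m = proximity s t ^+ m by rewrite proximity_sym.
have q0 t s : 0 <= proximity t s ^+ m by rewrite exprn_ge0//; have /andP[] := proximity_01 x y t s.
have e1 := energy_quasi_triangle psX cl ch.
have e2 := energy_upper frX ch sy q0 (fun t tD => HU m t m0 tD).
have La0 : 0 <= 2 * N%:R ^+ 2 * Num.sqrt W by rewrite !mulr_ge0 ?sqr_ge0 ?sqrtr_ge0.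
have pl t : tpoly (low_part N a) (t + 2 * pi) = tpoly (low_part N a) t.
  apply: eq_bigr => p _; congr (_ * _); rewrite /trig mulrDr; case: ifP => _.
    by rewrite cosD cos_natM2pi sin_natM2pi; ring.
  by rewrite sinD cos_natM2pi sin_natM2pi; ring.
have Fe t s : proximity t s ^+ m * (tpoly (low_part N a) t - tpoly (low_part N a) s) ^+ 2 <= 4 * N%:R ^+ 4 * W * K / m%:R.
  have h1 := HK _ _ La0 pl (low_lipschitz N a) t s.
  have h2 := power_gap m (proximity_01 x y t s).
  apply: (le_trans (ler_wpM2l (q0 t s) h1)).
  have E : (2 * N%:R ^+ 2 * Num.sqrt W) ^+ 2 * K = 4 * N%:R ^+ 4 * W * K.
    by rewrite [LHS](_ : _ = 4 * N%:R ^+ 4 * (Num.sqrt W) ^+ 2 * K); [rewrite sqr_sqrtr|ring].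
  rewrite E mulrCA; apply: ler_wpM2l.
    by rewrite mulr_ge0 ?(ltW K0)// mulr_ge0// mulr_ge0// exprn_ge0.
  by apply: (le_trans h2); rewrite lef_pV2 ?posrE// ler_nat.
have e3 := energy_lower frX cl sy (fun t tD => Hc m t m0 tD) Fe.
rewrite (_ : (fun t => tpoly (low_part N a) t + tpoly (high_part N a) t) = tpoly a) in e1; last first.
  by apply/funext => t; rewrite -tpoly_low_high.
move: e1 e2 e3; rewrite !parseval (_ : \sum_p low_part N a p ^+ 2 = W - Wh); last first.
  by rewrite /W (@sum_low_high n N a) addrK.
move: (energy _ _) (energy _ _) (energy _ _) => E1 E2 E3 e1 e2 e3.
have -> : (c * pi / 2 * (W - Wh) - U * pi * Wh) / Num.sqrt m%:R - 2 * K * (2 * pi) ^+ 2 * N%:R ^+ 4 * W / m%:R =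
  (c / Num.sqrt m%:R * (pi * (W - Wh)) - 4 * N%:R ^+ 4 * W * K / m%:R * (2 * pi) ^+ 2) / 2 -
   U / Num.sqrt m%:R * (pi * Wh).
  have s0 : Num.sqrt m%:R != 0 :> R by rewrite gt_eqF ?sqrtr_gt0.
  have mn : m%:R != 0 :> R by rewrite gt_eqF.
  move: (Num.sqrt _) s0 => s s0; move: (pi) (m%:R) mn => P mm mn.
  by field; rewrite s0 mn.
rewrite -/Wh in e2; lra.
Qed.

Section coefficients.
Variables (C1 : R) (n : nat).
Hypotheses (C10 : 0 <= C1) (HC1 : forall (p : 'I_n * bool) t, t \in `[0, 2 * pi[ ->
  `|symm_real (trig p) t - trig p t / (2 * p.1.+1%:R)| <= C1 / p.1.+1%:R ^+ 2).
Local Notation k p := (p.1.+1%:R : R).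

Let r (p : 'I_n * bool) t := symm_real (trig p) t - trig p t / (2 * k p).

Let sr p : sqint (r p).
Proof.
have := sqintD (symm_real_sqint (strig p)) (sqintZ (- (2 * k p)^-1) (strig p)).
by congr sqint; apply/funext => t; rewrite /r; ring.
Qed.

Let symm_realE p t : symm_real (trig p) t = (2 * k p)^-1 * trig p t + r p t.
Proof. by rewrite /r; ring. Qed.

Let r2 p : pint (fun t => r p t ^+ 2) <= 2 * pi * (C1 / k p ^+ 2) ^+ 2.
Proof.
have [_ i2] := sr p; rewrite mulrC -pint_cst; apply: le_pint => //.
  by apply: cont_intg => t; exact: contc.
move=> t tD; rewrite -[leLHS]real_normK ?num_real// lerXn2r ?nnegrE//.
  by rewrite divr_ge0 ?sqr_ge0.
exact: HC1.
Qed.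

Lemma pint_symm_real_trigM (p : 'I_n * bool) (g : R -> R) : sqint g ->
  (pint (fun t => symm_real (trig p) t * g t) - (2 * k p)^-1 * pint (fun t => trig p t * g t)) ^+ 2
    <= 2 * pi * (C1 / k p ^+ 2) ^+ 2 * pint (fun t => g t ^+ 2).
Proof.
move=> sg.
have -> : pint (fun t => symm_real (trig p) t * g t) =
    (2 * k p)^-1 * pint (fun t => trig p t * g t) + pint (fun t => r p t * g t).
  rewrite -pintZ; last exact: intg_sqM.
  rewrite -pintD; [|by apply: intgZ; exact: intg_sqM|exact: intg_sqM].
  by congr pint; apply/funext => t; rewrite symm_realE mulrDl mulrA.
rewrite addrC addKr; apply: (le_trans (pint_cauchy_schwarz (sr p) sg)).
by rewrite ler_wpM2r// pint_ge0// => t _; exact: sqr_ge0.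
Qed.

(** The integral of S trig_p against the polynomial is pi a_p / (2k) up to an
    error of order sqrt W / k^2. *)
Lemma coefficient_bound (a : 'I_n * bool -> R) p :
  a p ^+ 2 <= (8 + 16 * C1 ^+ 2) * (k p ^+ 2 * pint (fun t => symm_real (trig p) t * tpoly a t) ^+ 2
                                    + (\sum_q a q ^+ 2) / k p ^+ 2).
Proof.
have := pint_symm_real_trigM p (stpoly a); rewrite pint_trigM_tpoly parseval.
set W := \sum_q _; move: (pint _) => b H.
have W0 : 0 <= W by rewrite sumr_ge0// => q _; exact: sqr_ge0.
have kp : 0 < k p by rewrite ltr0n.
move: (k p) kp H => z z0 H.
pose X := (2 * z)^-1 * (a p * pi).
have h1 : X ^+ 2 <= 2 * b ^+ 2 + 2 * (b - X) ^+ 2.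
  have := sqr_ge0 (b + (b - X)); rewrite sqrrD; lra.
have h2 : (b - X) ^+ 2 <= 2 * (pi * C1) ^+ 2 * W / z ^+ 4.
  apply: (le_trans H); rewrite le_eqVlt; apply/orP; left; apply/eqP.
  have zn0 : z != 0 by rewrite gt_eqF.
  by move: pi => P; field.
have zpi : 0 < pi ^+ 2 :> R by rewrite exprn_gt0.
have h3 : pi ^+ 2 * a p ^+ 2 <= pi ^+ 2 * (8 * z ^+ 2 * b ^+ 2 + 16 * C1 ^+ 2 * W / z ^+ 2).
  have E : pi ^+ 2 * a p ^+ 2 = 4 * z ^+ 2 * X ^+ 2.
    rewrite /X; have zn0 : z != 0 by rewrite gt_eqF.
    by move: pi => P; field.
  rewrite E; apply: (@le_trans _ _ (4 * z ^+ 2 * (2 * b ^+ 2 + 2 * (2 * (pi * C1) ^+ 2 * W / z ^+ 4)))).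
    apply: ler_wpM2l; first by apply: mulr_ge0; rewrite ?sqr_ge0.
    by apply: (le_trans h1); lra.
  have -> : 4 * z ^+ 2 * (2 * b ^+ 2 + 2 * (2 * (pi * C1) ^+ 2 * W / z ^+ 4)) =
      8 * (z ^+ 2 * b ^+ 2) + pi ^+ 2 * (16 * C1 ^+ 2 * W / z ^+ 2).
    have zn0 : z != 0 by rewrite gt_eqF.
    by move: pi => P; field.
  rewrite mulrDr lerD2r -(mulrA 8) ler_peMl//.
    by apply: mulr_ge0 => //; apply: mulr_ge0; rewrite sqr_ge0.
  by rewrite -[leLHS]mulr1 expr2 ler_pM.
rewrite ler_pM2l// in h3; apply: (le_trans h3).
have : 0 <= 16 * C1 ^+ 2 * (z ^+ 2 * b ^+ 2).
  by apply: mulr_ge0; apply: mulr_ge0; rewrite ?sqr_ge0.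
have : 0 <= 8 * (W / z ^+ 2) by rewrite mulr_ge0// divr_ge0// sqr_ge0.
lra.
Qed.

End coefficients.

(** Testing with the speed bounds c; testing with the functions trig_p bounds the
    numbers b_p, the integrals of S trig_p against the polynomial, by Bessel's
    inequality. These bound the tail of the coefficients by
    [coefficient_bound], and the energy, which is sum_p a_p b_p up to a
    constant. *)
Lemma stability_real : exists2 C : R, 0 <= C &
  forall (n : nat) (c : R) (a : 'I_n * bool -> R) (h : R -> R), (0 < n)%N -> sqint h ->
  (forall f, sqint f -> pint (fun t => f t * h t) = pint (fun t => symm_real f t * (c + tpoly a t))) ->
  pint (fun t => (c + tpoly a t) ^+ 2) <= C * (n%:R ^+ 2 * pint (fun t => h t ^+ 2)).
Proof.
have [C1 C10 HC1] := symm_real_trig.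
have [c1 [Cu [K4 [c10 Cu0 K40 HE]]]] := energy_tpoly_lower.
pose C3 := 8 + 16 * C1 ^+ 2.
have C30 : 0 <= C3 by rewrite addr_ge0// mulr_ge0// sqr_ge0.
have [C C0 HC] := absorb c10 Cu0 C30 K40.
pose Sp := pint (fun t => sp t ^+ 2).
have Sp0 : 0 <= Sp by apply: pint_ge0 => t _; exact: sqr_ge0.
pose C5 := 2 * pi + 2 * Sp * (2 * pi * (2 * pi * C1 ^+ 2)) * 4.
have C50 : 0 <= C5.
  rewrite addr_ge0 ?(ltW p20)// mulr_ge0// mulr_ge0 ?mulr_ge0 ?(ltW p0)//.
exists (2 * pi * Sp + pi * (C * (4 * pi ^+ 2 * C5))).
  rewrite addr_ge0 ?mulr_ge0 ?sqr_ge0 ?(ltW p0)// ?(ltW p20)//.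
move=> n c a h n0 sh Hh.
set H := pint (fun t => h t ^+ 2).
have H0 : 0 <= H by apply: pint_ge0 => t _; exact: sqr_ge0.
pose W := \sum_p a p ^+ 2.
have W0 : 0 <= W by rewrite sumr_ge0// => p _; exact: sqr_ge0.
have nR : 1 <= n%:R :> R by rewrite ler1n.
have n2 : 1 <= n%:R ^+ 2 :> R by rewrite expr2 -[leLHS]mulr1 ler_pM.
have sa := stpoly a.
have sc : sqint (fun=> c) by exact: sqint_cst.
(* c is the mean of w, and the operator maps the speed to 1 *)
have c2 : c ^+ 2 <= Sp * H.
  have E : pint (fun t => sp t * h t) = c * (2 * pi).
    rewrite Hh// (_ : (fun t => _) = (fun t => c + tpoly a t)).
      by rewrite pintD ?pint_tpoly ?addr0 ?pint_cst//; exact: sqint_intg.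
    by apply/funext => t; rewrite symm_real_weight mul1r.
  have := pint_cauchy_schwarz ssp sh; rewrite E -/Sp -/H; apply: le_trans.
  rewrite exprMn ler_peMr ?sqr_ge0//.
  by rewrite -[leLHS]mulr1 expr2 ler_pM//; move: p1; lra.
pose b (p : 'I_n * bool) := pint (fun t => symm_real (trig p) t * tpoly a t).
(* adding the constant c to the polynomial changes b_p only by the small mean of S trig_p *)
have hb p : b p ^+ 2 <= 2 * pint (fun t => trig p t * h t) ^+ 2 +
    2 * (c ^+ 2 * (2 * pi * (2 * pi * C1 ^+ 2)) / p.1.+1%:R ^+ 2).
  have E : b p = pint (fun t => trig p t * h t) - c * pint (fun t => symm_real (trig p) t * 1).
    rewrite Hh; last exact: strig.
    have i1 : intg (fun t => symm_real (trig p) t * tpoly a t).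
      by apply: intg_sqM => //; apply: symm_real_sqint; exact: strig.
    have i2 : intg (fun t => symm_real (trig p) t * 1).
      by apply: intg_sqM; [apply: symm_real_sqint; exact: strig|exact: sqint_cst].
    rewrite -pintZ// (_ : (fun t => symm_real (trig p) t * (c + tpoly a t)) =
      (fun t => c * (symm_real (trig p) t * 1) + symm_real (trig p) t * tpoly a t)).
      by rewrite pintD//; [rewrite -/(b p); move: (b p) (pint _) => u v; ring|exact: intgZ].
    by apply/funext => t; ring.
  have := pint_symm_real_trigM C10 (HC1 n) p (sqint_cst 1).
  rewrite (_ : (fun t => trig p t * 1) = trig p); last by apply/funext => t; rewrite mulr1.
  rewrite pint_trig mulr0 subr0 (_ : (fun t : R => 1 ^+ 2) = (fun=> 1)); last first.
    by apply/funext => t; rewrite expr1n.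
  rewrite pint_cst mul1r E.
  move: (pint (fun t => trig p t * h t)) (pint (fun t => symm_real (trig p) t * 1)) => u v hv.
  have k1 : 1 <= p.1.+1%:R :> R by rewrite ler1n.
  move: (p.1.+1%:R) k1 hv => z z1 hv.
  have z0 : 0 < z by apply: lt_le_trans z1.
  have hv' : v ^+ 2 <= 2 * pi * (2 * pi * C1 ^+ 2) / z ^+ 2.
    apply: (le_trans hv).
    have -> : 2 * pi * (C1 / z ^+ 2) ^+ 2 * (2 * pi) = 2 * pi * (2 * pi * C1 ^+ 2) / z ^+ 2 / z ^+ 2.
      have zn0 : z != 0 by rewrite gt_eqF.
      by move: pi => P; field.
    rewrite ler_pdivrMr ?exprn_gt0// ler_peMr//.
      rewrite divr_ge0 ?sqr_ge0// mulr_ge0 ?(ltW p20)// mulr_ge0 ?(ltW p20)//.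
      exact: sqr_ge0.
    by rewrite -[leLHS]mulr1 expr2 ler_pM.
  have := ler_wpM2l (sqr_ge0 c) hv'.
  have := sqr_ge0 (u + c * v); rewrite sqrrD sqrrB exprMn; lra.
pose B := \sum_p b p ^+ 2.
have B0 : 0 <= B by rewrite sumr_ge0// => p _; exact: sqr_ge0.
have hB : B <= C5 * H.
  pose G : R := 2 * (c ^+ 2 * (2 * pi * (2 * pi * C1 ^+ 2))).
  have G0 : 0 <= G.
    apply: mulr_ge0 => //; apply: mulr_ge0; first exact: sqr_ge0.
    by apply: mulr_ge0; [exact: ltW|apply: mulr_ge0; [exact: ltW|exact: sqr_ge0]].
  apply: (@le_trans _ _ (2 * (pi * H) + G * 4)).
    apply: (@le_trans _ _ (\sum_(p : 'I_n * bool) (2 * pint (fun t => trig p t * h t) ^+ 2 +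
        (fun j : nat => G * j.+1%:R ^- 2) p.1))).
      by apply: ler_sum => p _; apply: (le_trans (hb p)); rewrite lerD2l /G (mulrA 2 _ _^-1).
    rewrite big_split/= lerD//; first by rewrite -mulr_sumr ler_wpM2l// bessel.
    rewrite (sum_trig_index n (fun j => G * j.+1%:R ^- 2)) -mulr_sumr mulrCA ler_wpM2l//.
    rewrite (_ : 4 = 2 * 2) ?ler_wpM2l//; last by ring.
    have s1 := @sum_high R n 1 isT; have s2 := @sum_low R n 1 1 ler01.
    have := lerD s1 s2; rewrite -big_split/= invr1 mul1r; apply: le_trans.
    apply: ler_sum => j _; case: ifP => j1; last by rewrite addr0.
    by rewrite add0r invf_le1 ?exprn_gt0// -[leLHS]mulr1 expr2 ler_pM// ler1n.
  rewrite /C5 /G.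
  have : 0 <= 2 * pi * (2 * pi * C1 ^+ 2).
    by apply: mulr_ge0; [exact: ltW|apply: mulr_ge0; [exact: ltW|exact: sqr_ge0]].
  move: (2 * pi * (2 * pi * C1 ^+ 2)) => z z0.
  have := ler_wpM2r z0 c2; lra.
have WB : W <= C * (n%:R ^+ 2 * (4 * pi ^+ 2 * B)).
  have B'0 : 0 <= 4 * pi ^+ 2 * B by rewrite mulr_ge0// mulr_ge0// sqr_ge0.
  have BB' : B <= 4 * pi ^+ 2 * B.
    rewrite ler_peMl//; have : 1 <= pi ^+ 2 :> R by rewrite -[leLHS]mulr1 expr2 ler_pM.
    lra.
  apply: (HC _ _ _ (fun m => energy (fun t s => proximity t s ^+ m) (tpoly a))
    (fun N => \sum_p high_part N a p ^+ 2) n2 W0 B'0) => [N N0|N m m0|m e m0 e0].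
  - apply: (@le_trans _ _ (C3 * (n%:R ^+ 2 * B + 2 * W / N%:R))); last first.
      by rewrite ler_wpM2l// lerD2r ler_wpM2l// sqr_ge0.
    rewrite /B mulr_sumr.
    have s1 := @sum_high R n N N0.
    apply: (@le_trans _ _ (C3 * (\sum_p n%:R ^+ 2 * b p ^+ 2 + \sum_(p : 'I_n * bool)
        (fun j => W * (if (j < N)%N then 0 else j.+1%:R ^- 2)) p.1))); last first.
      rewrite ler_wpM2l// lerD2l (sum_trig_index n (fun j => W * (if (j < N)%N then 0 else j.+1%:R ^- 2))).
      rewrite -mulr_sumr mulrA ler_wpM2l// mulr_ge0//.
    rewrite -big_split/= mulr_sumr; apply: ler_sum => p _.
    rewrite /high_part; case: ifP => _.
      by rewrite expr0n/= mulr0 addr0 mulr_ge0// mulr_ge0// sqr_ge0.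
    apply: (le_trans (coefficient_bound C10 (HC1 n) a p)); rewrite ler_wpM2l// lerD2r ler_wpM2r ?sqr_ge0//.
    by rewrite lerXn2r ?nnegrE// ler_nat.
  - exact: HE.
  have := energy_le_pot M0 Cx Cy px py inj reg (@tpoly_continuous _ n a) (pint_tpoly a) m0.
  rewrite ler_pdivrMr ?ltr0n// mulrC => /le_trans; apply.
  rewrite ler_wpM2l//.
  have -> : pint (fun t => tpoly a t * pot (tpoly a) t) = 4 * pi * \sum_p a p * b p.
    have i p : intg (fun t => tpoly a t * pot (trig p) t).
      by apply: intg_sqM => //; apply: pots; exact: strig.
    rewrite (@eq_pint _ _ (fun t => \sum_p a p * (tpoly a t * pot (trig p) t))); last first.
      by move=> t tD; rewrite pot_tpoly// mulr_sumr; apply: eq_bigr => p _; rewrite mulrCA.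
    have [|_ ->] := intg_sum (F := fun p t => a p * (tpoly a t * pot (trig p) t)).
      by move=> p; exact: intgZ.
    rewrite mulr_sumr; apply: eq_bigr => p _; rewrite pintZ// mulrCA; congr (_ * _).
    rewrite /b -pintZ; last by apply: intg_sqM => //; apply: symm_real_sqint; exact: strig.
    congr pint; apply/funext => t; rewrite /symm_real pint_trig mulr0 addr0.
    have q0 : 4 * pi != 0 :> R by rewrite gt_eqF// mulr_gt0.
    by move: (4 * pi) q0 => q q0; field.
  have -> : e * W + 4 * pi ^+ 2 * B / e = 4 * pi * \sum_p (e / (2 * pi) * a p ^+ 2 + (2 * pi) / e * b p ^+ 2) / 2.
    rewrite -mulr_suml big_split/= -!mulr_sumr -/W -/B.
    have pn : pi != 0 :> R by rewrite gt_eqF.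
    have en : e != 0 by rewrite gt_eqF.
    by move: (pi) pn => P pn; field; rewrite pn en.
  rewrite ler_wpM2l ?mulr_ge0 ?(ltW p0)//; apply: ler_sum => p _.
  have q0 : 0 < e / (2 * pi) by rewrite divr_gt0.
  have -> : 2 * pi / e = (e / (2 * pi))^-1 by rewrite invfM invrK mulrC.
  move: (e / (2 * pi)) q0 => q q0.
  have : 0 <= q^-1 * (q * a p - b p) ^+ 2 by rewrite mulr_ge0 ?sqr_ge0// invr_ge0 ltW.
  have -> : q^-1 * (q * a p - b p) ^+ 2 = q * a p ^+ 2 - 2 * (a p * b p) + q^-1 * b p ^+ 2.
    by field; rewrite gt_eqF.
  lra.
have -> : pint (fun t => (c + tpoly a t) ^+ 2) = c ^+ 2 * (2 * pi) + pi * W.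
  have [_ i2] := sa.
  rewrite (_ : (fun t => _) = (fun t => c ^+ 2 + ((2 * c) * tpoly a t + tpoly a t ^+ 2))); last first.
    by apply/funext => t; ring.
  rewrite pintD; [|exact/sqint_intg/sqint_cst|by apply: intgD => //; apply: intgZ; exact: sqint_intg].
  rewrite pintD//; last by apply: intgZ; exact: sqint_intg.
  by rewrite pintZ ?pint_tpoly ?mulr0 ?add0r ?pint_cst ?parseval//; exact: sqint_intg.
rewrite (mulrDl (2 * pi * Sp)) lerD//.
  rewrite mulrC -(mulrA (2 * pi)); apply: (ler_wpM2l (ltW p20)).
  apply: (le_trans c2); rewrite ler_wpM2l//.
  by rewrite ler_peMl.
rewrite -(mulrA pi); apply: (ler_wpM2l (ltW p0)); apply: (le_trans WB).
rewrite -(mulrA C); apply: (ler_wpM2l C0).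
rewrite (_ : 4 * pi ^+ 2 * C5 * _ = n%:R ^+ 2 * (4 * pi ^+ 2 * (C5 * H))); last first.
  by move: (4 * pi ^+ 2) => q; ring.
apply: ler_wpM2l; first exact: sqr_ge0.
by apply: ler_wpM2l => //; apply: mulr_ge0 => //; exact: sqr_ge0.
Qed.

End stability.

(** * The Hilbert space of square-integrable complex functions *)

Section complex_parts.
Context {R : realType}.
Implicit Types (z w : R[i]).

Lemma ReD z w : complex.Re (z + w) = complex.Re z + complex.Re w.
Proof. by case: z; case: w. Qed.
Lemma ImD z w : complex.Im (z + w) = complex.Im z + complex.Im w.
Proof. by case: z; case: w. Qed.
Lemma ReM z w : complex.Re (z * w) = complex.Re z * complex.Re w - complex.Im z * complex.Im w.
Proof. by case: z; case: w. Qed.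
Lemma ImM z w : complex.Im (z * w) = complex.Re z * complex.Im w + complex.Im z * complex.Re w.
Proof. by case: z; case: w. Qed.
Lemma Re_conj z : complex.Re z^*%C = complex.Re z. Proof. by case: z. Qed.
Lemma Im_conj z : complex.Im z^*%C = - complex.Im z. Proof. by case: z. Qed.
Lemma normc_sqr z : Normc.normc z ^+ 2 = complex.Re z ^+ 2 + complex.Im z ^+ 2.
Proof. by case: z => a b /=; rewrite sqr_sqrtr// addr_ge0 ?sqr_ge0. Qed.
Lemma conjM z w : (z * w)^*%C = z^*%C * w^*%C.
Proof. by rewrite rmorphM. Qed.
Lemma conjB z w : (z - w)^*%C = z^*%C - w^*%C.
Proof. by rewrite rmorphB. Qed.
Lemma conjK z : z^*%C^*%C = z.
Proof. by case: z => a b /=; rewrite opprK. Qed.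
Lemma complex_ext z w : complex.Re z = complex.Re w -> complex.Im z = complex.Im w -> z = w.
Proof. by case: z; case: w => a b c d /= -> ->. Qed.

End complex_parts.

Section hilbert.
Context {R : realType}.
Local Notation mu := (@lebesgue_measure R).
Local Notation D := (`[0, 2 * pi[%classic : set R).
Local Notation intg f := (mu.-integrable D (EFin \o f)).
Local Notation re f := (fun t => complex.Re (f t)).
Local Notation im f := (fun t => complex.Im (f t)).
Implicit Types (f g h : R -> R[i]).

Let p0 : 0 < pi :> R. Proof. exact: pi_gt0. Qed.
Let p20 : 0 < 2 * pi :> R. Proof. by rewrite mulr_gt0. Qed.

Lemma inL2P f : inL2 f <-> sqint (re f) /\ sqint (im f).
Proof.
have mD : measurable D by exact: measurable_itv.
have E : (fun t => Normc.normc (f t) ^+ 2) = (fun t => complex.Re (f t) ^+ 2 + complex.Im (f t) ^+ 2).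
  by apply/funext => t; rewrite normc_sqr.
split=> [[mr mi fi]|[[mr r2] [mi i2]]].
  have half (u : R -> R) : measurable_fun D u -> (forall t, u t ^+ 2 <= Normc.normc (f t) ^+ 2) -> sqint u.
    move=> mu' uf; split=> //; apply/integrableP; split.
      by apply/measurable_EFinP; exact: measurable_funX.
    apply: le_lt_trans fi; apply: ge0_le_integral => //.
    - apply: measurableT_comp => //; apply/measurable_EFinP; exact: measurable_funX.
    - apply/measurable_EFinP.
      rewrite E.
      by apply: measurable_funD; exact: measurable_funX.
    - by move=> t _ /=; rewrite lee_fin ger0_norm ?sqr_ge0.
  by split; apply: half => // t; rewrite normc_sqr ?lerDl ?lerDr sqr_ge0.
split=> //.
have /integrableP[_] := intgD r2 i2.
apply: le_lt_trans; apply: ge0_le_integral => //.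
- by move=> t _; rewrite lee_fin sqr_ge0.
- apply/measurable_EFinP; rewrite E.
  by apply: measurable_funD; exact: measurable_funX.
- apply: measurableT_comp => //; apply/measurable_EFinP.
  by apply: measurable_funD; exact: measurable_funX.
- by move=> t _ /=; rewrite lee_fin normc_sqr ler_norm.
Qed.

Lemma inL2D f g : inL2 f -> inL2 g -> inL2 (fun t => f t + g t).
Proof.
move=> /inL2P[fr fi] /inL2P[gr gi]; apply/inL2P; split.
  have := sqintD fr gr; congr sqint; apply/funext => t; by rewrite ReD.
have := sqintD fi gi; congr sqint; apply/funext => t; by rewrite ImD.
Qed.

Lemma inL2Z a f : inL2 f -> inL2 (fun t => a * f t).
Proof.
move=> /inL2P[fr fi]; apply/inL2P; split.
  have := sqintD (sqintZ (complex.Re a) fr) (sqintZ (- complex.Im a) fi).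
  congr sqint; apply/funext => t; by rewrite ReM mulNr.
have := sqintD (sqintZ (complex.Re a) fi) (sqintZ (complex.Im a) fr).
congr sqint; apply/funext => t; by rewrite ImM.
Qed.

Lemma inL2_sum (n : nat) (a : 'I_n -> R[i]) (F : 'I_n -> R -> R[i]) : (forall j, inL2 (F j)) ->
  inL2 (fun t => \sum_j a j * F j t).
Proof.
move=> FL; suff H (r : seq 'I_n) : inL2 (fun t => \sum_(j <- r) a j * F j t) by exact: H.
elim: r => [|j r IH].
  have -> : (fun t => \sum_(j <- [::]) a j * F j t) = (fun=> 0) by apply/funext => t; rewrite big_nil.
  by apply/inL2P; split; exact: sqint_cst.
rewrite (_ : (fun t => _) = (fun t => a j * F j t + \sum_(j <- r) a j * F j t)).
  by apply: inL2D => //; exact: inL2Z.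
by apply/funext => t; rewrite big_cons.
Qed.

Lemma inL2B f g : inL2 f -> inL2 g -> inL2 (f - g).
Proof.
move=> fL gL; have := inL2D fL (inL2Z (- 1) gL); congr inL2.
by apply/funext => t; rewrite mulN1r.
Qed.

Lemma dotE f g : inL2 f -> inL2 g ->
  dotL2 f g = (pint (fun t => complex.Re (f t) * complex.Re (g t)) + pint (fun t => complex.Im (f t) * complex.Im (g t)))
   +i* (pint (fun t => complex.Im (f t) * complex.Re (g t)) - pint (fun t => complex.Re (f t) * complex.Im (g t))).
Proof.
move=> /inL2P[fr fi] /inL2P[gr gi].
rewrite -pintD; [|exact: intg_sqM..]; rewrite -pintB; [|exact: intg_sqM..].
rewrite /dotL2 /Cintegral; congr (_ +i* _); apply: eq_Rintegral => t _.
  by rewrite ReM Re_conj Im_conj mulrN opprK.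
by rewrite ImM Re_conj Im_conj mulrN addrC.
Qed.

Lemma dotC f g : inL2 f -> inL2 g -> dotL2 g f = (dotL2 f g)^*%C.
Proof.
move=> fL gL; rewrite !dotE//=; congr (_ +i* _).
  by congr (_ + _); congr pint; apply/funext => t; rewrite mulrC.
by rewrite opprB; congr (_ - _); congr pint; apply/funext => t; rewrite mulrC.
Qed.

Lemma dotDl f g h : inL2 f -> inL2 g -> inL2 h ->
  dotL2 (fun t => f t + g t) h = dotL2 f h + dotL2 g h.
Proof.
move=> fL gL hL; rewrite !dotE//; last exact: inL2D.
move: fL gL hL => /inL2P[fr fi] /inL2P[gr gi] /inL2P[hr hi].
have E (u v w z : R -> R) : sqint u -> sqint v -> sqint w -> (forall t, z t = u t + v t) ->
    pint (fun t => z t * w t) = pint (fun t => u t * w t) + pint (fun t => v t * w t).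
  move=> su sv sw zE; rewrite -pintD; [|exact: intg_sqM..].
  by congr pint; apply/funext => t; rewrite zE mulrDl.
have rD t := ReD (f t) (g t); have iD t := ImD (f t) (g t).
rewrite (E _ _ _ _ fr gr hr rD) (E _ _ _ _ fi gi hi iD) (E _ _ _ _ fi gi hr iD) (E _ _ _ _ fr gr hi rD).
by apply: complex_ext; rewrite ?ReD ?ImD /=; ring.
Qed.

Lemma dotZl a f h : inL2 f -> inL2 h -> dotL2 (fun t => a * f t) h = a * dotL2 f h.
Proof.
move=> fL hL; rewrite !dotE//; last exact: inL2Z.
move: fL hL => /inL2P[fr fi] /inL2P[hr hi].
have E (u v w z : R -> R) b c : sqint u -> sqint v -> sqint w -> (forall t, z t = b * u t + c * v t) ->
    pint (fun t => z t * w t) = b * pint (fun t => u t * w t) + c * pint (fun t => v t * w t).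
  move=> su sv sw zE; rewrite -!pintZ; [|exact: intg_sqM..].
  rewrite -pintD; [|by apply: intgZ; exact: intg_sqM..].
  by congr pint; apply/funext => t; rewrite zE mulrDl !mulrA.
have rD t : complex.Re (a * f t) = complex.Re a * complex.Re (f t) + (- complex.Im a) * complex.Im (f t).
  by rewrite ReM mulNr.
have iD t := ImM a (f t).
rewrite (E _ _ _ _ _ _ fr fi hr rD) (E _ _ _ _ _ _ fi fr hi iD) (E _ _ _ _ _ _ fi fr hr iD) (E _ _ _ _ _ _ fr fi hi rD).
by apply: complex_ext; rewrite ?ReM ?ImM /=; ring.
Qed.

Lemma dot_suml (n : nat) (a : 'I_n -> R[i]) (F : 'I_n -> R -> R[i]) h : (forall j, inL2 (F j)) -> inL2 h ->
  dotL2 (fun t => \sum_j a j * F j t) h = \sum_j a j * dotL2 (F j) h.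
Proof.
move=> FL hL; suff H (r : seq 'I_n) : inL2 (fun t => \sum_(j <- r) a j * F j t) /\
    dotL2 (fun t => \sum_(j <- r) a j * F j t) h = \sum_(j <- r) a j * dotL2 (F j) h by have [] := H (index_enum _).
elim: r => [|j r [IH1 IH2]].
  have E : (fun t => \sum_(j <- [::]) a j * F j t) = (fun=> 0) by apply/funext => t; rewrite big_nil.
  rewrite E big_nil; split; first by apply/inL2P; split; exact: sqint_cst.
  rewrite (_ : (fun=> 0) = (fun t => 0 * h t)); last by apply/funext => t; rewrite mul0r.
  by rewrite dotZl// mul0r.
rewrite big_cons (_ : (fun t => _) = (fun t => a j * F j t + \sum_(j <- r) a j * F j t)).
  by split; [apply: inL2D => //; exact: inL2Z|rewrite dotDl ?IH2 ?dotZl//; exact: inL2Z].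
by apply/funext => t; rewrite big_cons.
Qed.

Lemma dot_sumr (n : nat) (a : 'I_n -> R[i]) (F : 'I_n -> R -> R[i]) h : (forall j, inL2 (F j)) -> inL2 h ->
  dotL2 h (fun t => \sum_j a j * F j t) = \sum_j (a j)^*%C * dotL2 h (F j).
Proof.
move=> FL hL; rewrite dotC ?dot_suml//; last exact: inL2_sum.
rewrite rmorph_sum/=; apply: eq_bigr => j _.
by rewrite conjM (dotC hL (FL j)) conjK.
Qed.

Lemma dotBl f g h : inL2 f -> inL2 g -> inL2 h -> dotL2 (f - g) h = dotL2 f h - dotL2 g h.
Proof.
move=> fL gL hL; rewrite (_ : f - g = (fun t => f t + (- 1) * g t)).
  by rewrite dotDl ?dotZl ?mulN1r//; exact: inL2Z.
by apply/funext => t; rewrite mulN1r.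
Qed.

Lemma dotBr f g h : inL2 f -> inL2 g -> inL2 h -> dotL2 h (f - g) = dotL2 h f - dotL2 h g.
Proof.
move=> fL gL hL; rewrite (dotC (inL2B fL gL) hL) dotBl// conjB.
by rewrite -!dotC.
Qed.

Lemma normL2_sqr f : inL2 f ->
  normL2 f ^+ 2 = pint (fun t => complex.Re (f t) ^+ 2) + pint (fun t => complex.Im (f t) ^+ 2).
Proof.
move=> /inL2P[[_ r2] [_ i2]]; rewrite -pintD// /normL2 sqr_sqrtr.
  by apply: eq_Rintegral => t _; rewrite normc_sqr.
by apply: Rintegral_ge0 => t _; exact: sqr_ge0.
Qed.

Lemma normL2_ge0 f : 0 <= normL2 f. Proof. exact: sqrtr_ge0. Qed.

Lemma dot_norm f : inL2 f -> dotL2 f f = (normL2 f ^+ 2)%:C.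
Proof.
move=> fL; rewrite dotE// normL2_sqr//; apply: complex_ext => //=.
by apply/eqP; rewrite subr_eq0; apply/eqP; congr pint; apply/funext => t; rewrite mulrC.
Qed.

(** The square norm of f - s g is nonnegative for all real s. *)
Lemma Re_dot_le f g : inL2 f -> inL2 g -> complex.Re (dotL2 f g) <= normL2 f * normL2 g.
Proof.
move=> fL gL; have [d0|d0] := leP (complex.Re (dotL2 f g)) 0.
  by apply: (le_trans d0); rewrite mulr_ge0 ?normL2_ge0.
rewrite -(@ler_pXn2r _ 2) ?nnegrE ?(ltW d0) ?mulr_ge0 ?normL2_ge0// exprMn.
apply: quadratic_discriminant => [|s]; first exact: sqr_ge0.
have sgL := inL2Z s%:C gL; have hL := inL2B fL sgL.
suff -> : normL2 f ^+ 2 - 2 * s * complex.Re (dotL2 f g) + s ^+ 2 * normL2 g ^+ 2 =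
  normL2 (f - (fun t => s%:C * g t)) ^+ 2 by exact: sqr_ge0.
suff : (normL2 (f - (fun t => s%:C * g t)) ^+ 2)%:C = (normL2 f ^+ 2)%:C - s%:C * dotL2 f g
    - s%:C * (dotL2 f g)^*%C + s%:C * s%:C * (normL2 g ^+ 2)%:C.
  move: (dotL2 f g) => [a b] /(congr1 (@complex.Re R)); rewrite !(ReD, ReM)/= => ->.
  ring.
rewrite -!dot_norm// dotBl// !dotBr// !dotZl//.
rewrite (dotC sgL fL) (dotC sgL gL) !dotZl// !conjM -!dotC//.
have -> : (s%:C : R[i])^*%C = s%:C by rewrite /= oppr0.
ring.
Qed.

Lemma pythagoras f g : inL2 f -> inL2 g -> dotL2 f g = 0 ->
  normL2 (f - g) ^+ 2 = normL2 f ^+ 2 + normL2 g ^+ 2.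
Proof.
move=> fL gL fg; have gf : dotL2 g f = 0 by rewrite (dotC fL gL) fg conjc0.
have hL := inL2B fL gL.
suff /(congr1 (@complex.Re R)) : (normL2 (f - g) ^+ 2)%:C = (normL2 f ^+ 2)%:C + (normL2 g ^+ 2)%:C by [].
by rewrite -!dot_norm// dotBl// !dotBr// fg gf !sub0r subr0 opprK.
Qed.

Lemma dot_norm0 f g : inL2 f -> inL2 g -> normL2 f = 0 -> dotL2 f g = 0.
Proof.
move=> fL gL f0; have := normL2_sqr fL; rewrite f0 expr0n/=.
move: fL gL (fL) (gL) => /inL2P[fr fi] /inL2P[gr gi] fL gL /esym/eqP.
have pos (u : R -> R) : 0 <= pint (fun t => u t ^+ 2) by apply: pint_ge0 => t _; exact: sqr_ge0.
rewrite paddr_eq0// => /andP[/eqP r0 /eqP i0].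
have Z (u v : R -> R) : sqint u -> sqint v -> pint (fun t => u t ^+ 2) = 0 -> pint (fun t => u t * v t) = 0.
  move=> su sv u0; have := pint_cauchy_schwarz su sv; rewrite u0 mul0r => h.
  by apply/eqP; rewrite -sqrf_eq0 eq_le h sqr_ge0.
by rewrite dotE// (Z _ _ fr gr r0) (Z _ _ fi gi i0) (Z _ _ fi gr i0) (Z _ _ fr gi r0) addr0 subr0.
Qed.

Lemma eqL2_dot f g h : inL2 f -> inL2 g -> inL2 h -> eqL2 f g -> dotL2 f h = dotL2 g h.
Proof.
move=> fL gL hL fg; rewrite !dotE//.
move: fL gL hL => /inL2P[fr fi] /inL2P[gr gi] /inL2P[hr hi].
have E (u v w : R -> R) : sqint u -> sqint v -> sqint w -> ae_eq mu D u v ->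
    pint (fun t => u t * w t) = pint (fun t => v t * w t).
  move=> su sv sw uv; rewrite /pint /Rintegral; congr fine.
  apply: ae_eq_integral => //.
  - exact: measurable_int (intg_sqM su sw).
  - exact: measurable_int (intg_sqM sv sw).
  - by apply: filterS uv => t H tD /=; rewrite H.
have r : ae_eq mu D (re f) (re g) by apply: filterS fg => t H tD /=; rewrite H.
have i : ae_eq mu D (im f) (im g) by apply: filterS fg => t H tD /=; rewrite H.
by rewrite (E _ _ _ fr gr hr r) (E _ _ _ fi gi hi i) (E _ _ _ fi gi hr i) (E _ _ _ fr gr hi r).
Qed.

End hilbert.

(** * Complex exponentials *)

Section exponentials.
Context {R : realType}.
Local Notation mu := (@lebesgue_measure R).
Local Notation D := (`[0, 2 * pi[%classic : set R).

Let p0 : 0 < pi :> R. Proof. exact: pi_gt0. Qed.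
Let p20 : 0 < 2 * pi :> R. Proof. by rewrite mulr_gt0. Qed.

Lemma pint_cos_int (l : int) : pint (fun t : R => cos (l%:~R * t)) = (2 * pi) *+ (l == 0).
Proof.
have H (n : nat) : pint (fun t : R => cos (n%:R * t)) = (2 * pi) *+ (n == 0%N).
  case: n => [|n]; last by rewrite pint_cos.
  rewrite (_ : (fun _ => _) = (fun=> 1)) ?pint_cst ?mul1r//.
  by apply/funext => t; rewrite mul0r cos0.
case: l => n; first exact: H.
rewrite -(H n.+1); congr pint; apply/funext => t.
by rewrite NegzE mulrNz mulNr cosN.
Qed.

Lemma pint_sin_int (l : int) : pint (fun t : R => sin (l%:~R * t)) = 0.
Proof.
case: l => n; first exact: pint_sin.
rewrite NegzE (_ : (fun _ => _) = (fun t : R => (- 1) * sin (n.+1%:R * t))).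
  by rewrite pintZ ?pint_sin ?mulr0//; apply: cont_intg; exact: cont_sinM.
by apply/funext => t; rewrite mulN1r mulrNz mulNr sinN.
Qed.

Lemma expik_inL2 (k : int) : inL2 (@expik R k).
Proof. by apply/inL2P; split; apply: cont_sqint; [exact: cont_cosM|exact: cont_sinM]. Qed.

Lemma dot_expik (j k : int) : dotL2 (@expik R j) (expik k) = ((2 * pi) *+ (j == k))%:C.
Proof.
have [/inL2P[jr ji] /inL2P[kr ki]] := (expik_inL2 j, expik_inL2 k).
rewrite dotE; [|exact: expik_inL2..].
rewrite -pintD; [|exact: intg_sqM..]; rewrite -pintB; [|exact: intg_sqM..].
rewrite -subr_eq0 -pint_cos_int; congr (_ +i* _).
  by congr pint; apply/funext => t; rewrite rmorphB/= mulrBl cosB.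
rewrite -[RHS](pint_sin_int (j - k)).
by congr pint; apply/funext => t; rewrite rmorphB/= mulrBl sinB mulrC [cos _ * _]mulrC mulrC.
Qed.

Lemma trig_poly_inL2 n (f : R -> R[i]) : trig_poly n f -> inL2 f.
Proof. by move=> [a ->]; apply: inL2_sum => j; exact: expik_inL2. Qed.

(** Real and imaginary parts of trigonometric polynomials; c is kept apart as the
    functions trig_p have mean zero. *)
Definition real_trig (n : nat) (f : R -> R) : Prop :=
  exists (c : R) (a : 'I_n * bool -> R), f = (fun t => c + tpoly a t).

Lemma real_trigD n f g : real_trig n f -> real_trig n g -> real_trig n (fun t => f t + g t).
Proof.
move=> [c [a ->]] [c' [a' ->]]; exists (c + c'), (fun p => a p + a' p); apply/funext => t.
rewrite addrACA; congr (_ + _); rewrite -big_split/=.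
by apply: eq_bigr => p _; rewrite mulrDl.
Qed.

Lemma real_trigZ n b f : real_trig n f -> real_trig n (fun t => b * f t).
Proof.
move=> [c [a ->]]; exists (b * c), (fun p => b * a p); apply/funext => t.
rewrite mulrDr; congr (_ + _); rewrite mulr_sumr.
by apply: eq_bigr => p _; rewrite mulrA.
Qed.

Lemma real_trig_cst n c : real_trig n (fun=> c).
Proof.
exists c, (fun=> 0); apply/funext => t; rewrite [tpoly _ _]big1 ?addr0// => p _.
by rewrite mul0r.
Qed.

Lemma real_trig_trig n (p : 'I_n * bool) : real_trig n (trig p).
Proof.
exists 0, (fun q => (q == p)%:R); apply/funext => t.
rewrite add0r /tpoly (bigD1 p)//= eqxx mul1r big1 ?addr0// => q /negbTE ->.
by rewrite mul0r.
Qed.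

Lemma real_trig_cos n (l : int) : (`|l| <= n)%N -> real_trig n (fun t => cos (l%:~R * t)).
Proof.
have H (k : nat) : (k <= n)%N -> real_trig n (fun t => cos (k%:R * t)).
  case: k => [_|k kn]; last exact: (real_trig_trig (Ordinal kn, true)).
  rewrite (_ : (fun _ => _) = (fun=> 1)); first exact: real_trig_cst.
  by apply/funext => t; rewrite mul0r cos0.
case: l => k kn; first exact: H.
rewrite (_ : (fun _ => _) = (fun t : R => cos (k.+1%:R * t))); first exact: H.
by apply/funext => t; rewrite NegzE mulrNz mulNr cosN.
Qed.

Lemma real_trig_sin n (l : int) : (`|l| <= n)%N -> real_trig n (fun t => sin (l%:~R * t)).
Proof.
have H (k : nat) : (k <= n)%N -> real_trig n (fun t => sin (k%:R * t)).
  case: k => [_|k kn]; last exact: (real_trig_trig (Ordinal kn, false)).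
  rewrite (_ : (fun _ => _) = (fun=> 0)); first exact: real_trig_cst.
  by apply/funext => t; rewrite mul0r sin0.
case: l => k kn; first exact: H.
rewrite (_ : (fun _ => _) = (fun t : R => (- 1) * sin (k.+1%:R * t))).
  by apply: real_trigZ; exact: H.
by apply/funext => t; rewrite NegzE mulN1r mulrNz mulNr sinN.
Qed.

Lemma trig_poly_parts n (f : R -> R[i]) : trig_poly n f ->
  real_trig n (fun t => complex.Re (f t)) /\ real_trig n (fun t => complex.Im (f t)).
Proof.
move=> [a ->].
suff H (r : seq 'I_(n.*2.+1)) :
    real_trig n (fun t => complex.Re (\sum_(j <- r) a j * expik (j%:Z - n%:Z) t)) /\
    real_trig n (fun t => complex.Im (\sum_(j <- r) a j * expik (j%:Z - n%:Z) t)) by exact: H.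
elim: r => [|j r [IH1 IH2]].
  by split; rewrite (_ : (fun _ => _) = (fun=> 0)); try exact: real_trig_cst;
    apply/funext => t; rewrite big_nil.
have jn : (`|j%:Z - n%:Z| <= n)%N by have := ltn_ord j; lia.
have C := real_trig_cos jn; have S := real_trig_sin jn.
split.
- rewrite (_ : (fun _ => _) = (fun t : R => (complex.Re (a j) * cos ((j%:Z - n%:Z)%:~R * t) +
    (- complex.Im (a j)) * sin ((j%:Z - n%:Z)%:~R * t)) + complex.Re (\sum_(j <- r) a j * expik (j%:Z - n%:Z) t))).
    by apply: real_trigD => //; apply: real_trigD; exact: real_trigZ.
  by apply/funext => t; rewrite big_cons ReD ReM mulNr.
- rewrite (_ : (fun _ => _) = (fun t : R => (complex.Re (a j) * sin ((j%:Z - n%:Z)%:~R * t) +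
    complex.Im (a j) * cos ((j%:Z - n%:Z)%:~R * t)) + complex.Im (\sum_(j <- r) a j * expik (j%:Z - n%:Z) t))).
    by apply: real_trigD => //; apply: real_trigD; exact: real_trigZ.
  by apply/funext => t; rewrite big_cons ImD ImM.
Qed.

End exponentials.

(** * The operator of an analytic curve *)

Section curve.
Context {R : realType}.
Local Notation mu := (@lebesgue_measure R).
Local Notation D := (`[0, 2 * pi[%classic : set R).
Local Notation intg f := (mu.-integrable D (EFin \o f)).
Local Notation re f := (fun t => complex.Re (f t)).
Local Notation im f := (fun t => complex.Im (f t)).
Variable gamma : R -> R * R.
Hypothesis regular : regular_analytic_curve gamma.

Let p0 : 0 < pi :> R. Proof. exact: pi_gt0. Qed.
Let p20 : 0 < 2 * pi :> R. Proof. by rewrite mulr_gt0. Qed.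

Let x : R -> R := fst \o gamma.
Let y : R -> R := snd \o gamma.
Local Notation d1 f := (derive1 f).
Local Notation d2 f := (derive1 (derive1 f)).
Local Notation d3 f := (derive1 (derive1 (derive1 f))).

Lemma analytic_C3fun (f : R -> R) : real_analytic f -> (forall t : R, f (t + 2 * pi) = f t) ->
  exists2 M : R, 0 <= M & forall M', M <= M' -> C3fun f (d1 f) (d2 f) (d3 f) M'.
Proof.
move=> a0 per0.
have [der0 a1] := real_analytic_derive a0.
have [der1 a2] := real_analytic_derive a1.
have [der2 a3] := real_analytic_derive a2.
have [der3 _] := real_analytic_derive a3.
have per1 (t : R) : d1 f (t + 2 * pi) = d1 f t by rewrite periodic_derive.
have per2 (t : R) : d2 f (t + 2 * pi) = d2 f t by rewrite periodic_derive.
have per3 (t : R) : d3 f (t + 2 * pi) = d3 f t by rewrite periodic_derive.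
have isd (g : R -> R) : (forall t : R, derivable g t 1) -> forall t : R, is_derive t 1 g (d1 g t).
  by move=> dg t; rewrite derive1E; exact: derivableP.
have cont (g : R -> R) : (forall t : R, derivable g t 1) -> continuous g.
  by move=> dg t; exact: is_derive_continuous (isd g dg t).
have [M1 [M10 H1]] := periodic_bounded p20 per1 (cont _ der1).
have [M2 [M20 H2]] := periodic_bounded p20 per2 (cont _ der2).
have [M3 [M30 H3]] := periodic_bounded p20 per3 (cont _ der3).
exists (M1 + M2 + M3) => [|M' MM]; first by rewrite !addr_ge0// ltW.
split=> [||| t]; [exact: (isd f der0)|exact: (isd (d1 f) der1)|exact: (isd (d2 f) der2)|split].
- by apply: (le_trans (H1 t)); lra.
- by apply: (le_trans (H2 t)); lra.
- by apply: (le_trans (H3 t)); lra.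
Qed.

Let curve_facts : exists M : R, [/\ 0 <= M, C3fun x (d1 x) (d2 x) (d3 x) M & C3fun y (d1 y) (d2 y) (d3 y) M].
Proof.
have [[ax ay] per _ _] := regular.
have px (t : R) : x (t + 2 * pi) = x t by rewrite /x /= per.
have py (t : R) : y (t + 2 * pi) = y t by rewrite /y /= per.
have [M1 M10 H1] := analytic_C3fun ax px; have [M2 M20 H2] := analytic_C3fun ay py.
by exists (M1 + M2); split; [exact: addr_ge0|apply: H1|apply: H2]; rewrite ?lerDl ?lerDr.
Qed.

Let px (t : R) : x (t + 2 * pi) = x t.
Proof. by have [_ per _ _] := regular; rewrite /x /= per. Qed.
Let py (t : R) : y (t + 2 * pi) = y t.
Proof. by have [_ per _ _] := regular; rewrite /y /= per. Qed.
Let inj (s t : R) : 0 <= s < 2 * pi -> 0 <= t < 2 * pi -> x s = x t -> y s = y t -> s = t.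
Proof.
have [_ _ inj _] := regular => sD tD xs ys.
apply: inj; rewrite ?in_itv//=.
by rewrite (surjective_pairing (gamma s)) (surjective_pairing (gamma t)); congr pair.
Qed.
Let reg (t : R) : 0 < d1 x t ^+ 2 + d1 y t ^+ 2.
Proof. by have [_ _ _ /(_ t)] := regular; rewrite /speed /euclid_norm sqrtr_gt0. Qed.

Lemma speed_continuous : continuous (speed gamma).
Proof.
have [M [M0 Cx Cy]] := curve_facts.
have [_ dx _ _] := Cx; have [_ dy _ _] := Cy.
move=> t; apply: (@cont_comp _ _ (@Num.sqrt R)); first exact: sqrt_continuous.
by apply: contD; apply: contX; exact: is_derive_continuous.
Qed.

Lemma curve_length_gt0 : 0 < pint (speed gamma).
Proof.
have [M [M0 Cx Cy]] := curve_facts.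
have [m m0 Hm] := speed_lower_bound Cx Cy px py reg.
apply: (@lt_le_trans _ _ (pint (fun=> Num.sqrt m : R))).
  by rewrite pint_cst mulr_gt0// sqrtr_gt0.
apply: le_pint => [||t _]; first by apply: cont_intg => t; exact: contc.
  by apply: cont_intg; exact: speed_continuous.
by rewrite /speed /euclid_norm ler_wsqrtr//; exact: Hm.
Qed.

Local Notation S := (symm_op gamma).
Local Notation symm_real := (symm_real x y (speed gamma)).

Let ln_euclid t s : ln (euclid_norm (gamma t - gamma s)) = 1 / 2 * ln_sqdist x y t s.
Proof.
rewrite /euclid_norm /ln_sqdist /=.
have -> : (x s - x t) ^+ 2 + (y s - y t) ^+ 2 = ((gamma t).1 - (gamma s).1) ^+ 2 + ((gamma t).2 - (gamma s).2) ^+ 2.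
  by rewrite /x /y /=; ring.
set r := _ + _; have r0 : 0 <= r by rewrite addr_ge0 ?sqr_ge0.
move: r0; rewrite le_eqVlt => /predU1P[<-|r0]; first by rewrite sqrtr0 ln0// mulr0.
rewrite -[in RHS](sqr_sqrtr (ltW r0)) lnXn ?sqrtr_gt0//.
by rewrite -mulr_natl; field.
Qed.

(** The kernel is - ln |gamma(t) - gamma(s)|^2 / (4 pi) plus a function of t, which
    is the mean shift because the normalization makes S map the speed to 1. *)
Lemma symm_op_real (f : R -> R[i]) t : inL2 f -> t \in `[0, 2 * pi[ ->
  S f t = symm_real (re f) t +i* symm_real (im f) t.
Proof.
move=> /inL2P[fr fi] tD.
have [M [M0 Cx Cy]] := curve_facts.
have L0 : pint (speed gamma) != 0 by rewrite gt_eqF// curve_length_gt0.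
have ssp : sqint (speed gamma) by apply: cont_sqint; exact: speed_continuous.
have ip (g : R -> R) (sg : sqint g) := pot_integrable M0 Cx Cy px py inj reg sg tD.
have sK s : symm_kernel gamma t s = (4 * pi)^-1 * - ln_sqdist x y t s + mean_shift x y (speed gamma) t.
  rewrite /symm_kernel ln_euclid /mean_shift /curve_length -/(pint _) -/(pint _).
  have -> : pint (fun u => ln (euclid_norm (gamma t - gamma u)) * speed gamma u) =
      (- (1 / 2)) * pot x y (speed gamma) t.
    rewrite /pot -pintZ; last exact: ip.
    by congr pint; apply/funext => u; rewrite ln_euclid; ring.
  have pn : pi != 0 :> R by rewrite gt_eqF.
  move: (pint _) L0 (pot _ _ _ _) (ln_sqdist _ _ _ _) => L L0 P e.
  by move: (pi) pn => p pn; field; rewrite pn L0.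
have E (g : R -> R) : sqint g -> pint (fun s => symm_kernel gamma t s * g s) = symm_real g t.
  move=> sg; rewrite /symm_real /pot -(pintZ _ (ip _ sg)) -(pintZ _ (sqint_intg sg)).
  rewrite -pintD; [|by apply: intgZ; exact: ip|by apply: intgZ; exact: sqint_intg].
  by congr pint; apply/funext => s; rewrite sK; ring.
rewrite -(E _ fr) -(E _ fi) /symm_op /Cintegral; congr (_ +i* _); apply: eq_Rintegral => s _.
  by rewrite ReM /= mul0r subr0.
by rewrite ImM /= mul0r addr0.
Qed.

Let symm_real_sq (f : R -> R) : sqint f -> sqint (symm_real f).
Proof.
have [M [M0 Cx Cy]] := curve_facts.
exact: (symm_real_sqint M0 Cx Cy px py inj reg speed_continuous).
Qed.

Lemma symm_op_inL2 (f : R -> R[i]) : inL2 f -> inL2 (S f).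
Proof.
move=> fL; have /inL2P[fr fi] := fL.
have ext (u v : R -> R) : (forall t, t \in `[0, 2 * pi[ -> u t = v t) -> sqint u -> sqint v.
  move=> uv [mu' u2]; split.
    by apply: eq_measurable_fun mu' => t /set_mem; exact: uv.
  by apply: eq_integrable u2 => // t /set_mem tD /=; rewrite uv.
apply/inL2P; split.
  by apply: ext (symm_real_sq fr) => t tD; rewrite symm_op_real.
by apply: ext (symm_real_sq fi) => t tD; rewrite symm_op_real.
Qed.

(** Testing with real functions f separates the real and imaginary parts of w
    and h, and [stability_real] applies to each. *)
Lemma symm_op_stable : exists2 C : R, 0 <= C & forall (n : nat) (w h : R -> R[i]), (0 < n)%N ->
  trig_poly n w -> inL2 h -> (forall f, inL2 f -> dotL2 (S f) w = dotL2 f h) ->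
  normL2 w <= C * n%:R * normL2 h.
Proof.
have [M [M0 Cx Cy]] := curve_facts.
have [C C0 HC] := stability_real M0 Cx Cy px py inj reg speed_continuous curve_length_gt0.
exists (Num.sqrt C) => [|n w h n0 wn hL H]; first exact: sqrtr_ge0.
have wL := trig_poly_inL2 wn; have /inL2P[wr wi] := wL; have /inL2P[hr hi] := hL.
have real_test (f : R -> R) : sqint f ->
    pint (fun t => f t * complex.Re (h t)) = pint (fun t => symm_real f t * complex.Re (w t)) /\
    pint (fun t => f t * complex.Im (h t)) = pint (fun t => symm_real f t * complex.Im (w t)).
  move=> sf; pose F (t : R) : R[i] := (f t)%:C.
  have FL : inL2 F by apply/inL2P; split => //; exact: sqint_cst.
  have rop0 t : symm_real (fun=> 0) t = 0.
    have z : pint (fun s => - ln_sqdist x y t s * 0) = 0.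
      rewrite (_ : (fun s => _) = (fun=> 0)) ?pint_cst ?mul0r//.
      by apply/funext => s; rewrite mulr0.
    by rewrite /symm_real /pot z pint_cst mul0r !mulr0 addr0.
  have SF t : t \in `[0, 2 * pi[ -> S F t = symm_real f t +i* 0.
    by move=> tD; rewrite symm_op_real// rop0.
  have z (u v : R -> R) : (forall t, t \in `[0, 2 * pi[ -> u t = 0) -> pint (fun t => u t * v t) = 0.
    move=> u0; rewrite -[RHS](mul0r (2 * pi)) -pint_cst; apply: eq_pint => t tD.
    by rewrite u0 ?mul0r.
  have SF0 t : t \in `[0, 2 * pi[ -> complex.Im (S F t) = 0 by move=> tD; rewrite SF.
  have F0 t : t \in `[0, 2 * pi[ -> complex.Im (F t) = 0 by [].
  have e (v : R -> R) : pint (fun t => complex.Re (S F t) * v t) = pint (fun t => symm_real f t * v t).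
    by apply: eq_pint => t tD; rewrite SF.
  have := H F FL; rewrite (dotE (symm_op_inL2 FL) wL) (dotE FL hL).
  rewrite (z _ (re w) SF0) (z _ (im w) SF0) (z _ (re h) F0) (z _ (im h) F0).
  rewrite (e (re w)) (e (im w)) !addr0 !sub0r => -[-> /oppr_inj ->].
  by [].
have part (u v : R -> R) : real_trig n u -> sqint v ->
    (forall f, sqint f -> pint (fun t => f t * v t) = pint (fun t => symm_real f t * u t)) ->
    pint (fun t => u t ^+ 2) <= C * (n%:R ^+ 2 * pint (fun t => v t ^+ 2)).
  by move=> [c [a ->]] sv Hv; exact: HC.
have [tr ti] := trig_poly_parts wn.
have pr := part _ _ tr hr (fun f sf => (real_test f sf).1).
have pi' := part _ _ ti hi (fun f sf => (real_test f sf).2).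
have rhs0 : 0 <= Num.sqrt C * n%:R * normL2 h by rewrite !mulr_ge0 ?sqrtr_ge0 ?normL2_ge0.
rewrite -(@ler_pXn2r _ 2) ?nnegrE ?normL2_ge0// !exprMn (sqr_sqrtr C0) !normL2_sqr//.
by rewrite mulrDr; apply: le_trans (lerD pr pi') _; rewrite !mulrA.
Qed.

End curve.

(** * Dual least squares *)

Section dual_least_squares.
Context {R : realType}.
Variables (gamma : R -> R * R) (S' : (R -> R[i]) -> (R -> R[i])).
Hypotheses (regular : regular_analytic_curve gamma) (adj : adjointL2 (symm_op gamma) S').
Local Notation S := (symm_op gamma).
Variable n : nat.
Hypothesis n0 : (0 < n)%N.

Let SL f : inL2 f -> inL2 (S f). Proof. exact: symm_op_inL2. Qed.
Let S'L f : inL2 f -> inL2 (S' f). Proof. by move=> /adj[]. Qed.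
Let adjE f g : inL2 f -> inL2 g -> dotL2 (S f) g = dotL2 f (S' g).
Proof. by move=> fL /adj[_]; exact. Qed.

Let e (j : 'I_(n.*2.+1)) : R -> R[i] := expik (j%:Z - n%:Z).
Let eL j : inL2 (e j). Proof. exact: expik_inL2. Qed.
Let s j := S' (e j).
Let sL j : inL2 (s j). Proof. exact: S'L. Qed.

(** The adjoint is determined only up to null sets, so it is linear only when
    tested against square-integrable functions. *)
Lemma dot_adjoint_sum (a : 'I_(n.*2.+1) -> R[i]) f : inL2 f ->
  dotL2 f (S' (fun t => \sum_j a j * e j t)) = dotL2 f (fun t => \sum_j a j * s j t).
Proof.
move=> fL; rewrite -adjE//; last exact: inL2_sum.
rewrite !dot_sumr//; last exact: SL.
by apply: eq_bigr => j _; rewrite adjE.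
Qed.

Definition gram : 'M[R[i]]_(n.*2.+1) := \matrix_(j, k) dotL2 (s j) (s k).

(** A vector v in the kernel makes F = sum_j v_j S^* e_j orthogonal to itself, so
    stability forces sum_j v_j e_j = 0, and the e_j are independent. *)
Lemma gram_unit : gram \in unitmx.
Proof.
rewrite -row_free_unit; apply: inj_row_free => v vG.
pose F (t : R) := \sum_j v 0 j * s j t; pose w (t : R) := \sum_j v 0 j * e j t.
have FL : inL2 F by exact: inL2_sum.
have wn : trig_poly n w by exists (fun j => v 0 j).
have wL := trig_poly_inL2 wn.
have Fs k : dotL2 F (s k) = 0.
  have vGk : \sum_j v 0 j * gram j k = 0.
    by have := congr1 (fun A : 'rV_(n.*2.+1) => A 0 k) vG; rewrite [LHS]mxE [RHS]mxE.
  by rewrite dot_suml// -[RHS]vGk; apply: eq_bigr => j _; rewrite [gram _ _]mxE.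
have F0 : normL2 F = 0.
  have : dotL2 F F = 0.
    by rewrite {2}/F dot_sumr// big1// => k _; rewrite Fs mulr0.
  by rewrite dot_norm// => /(congr1 (@complex.Re R))/= /eqP; rewrite sqrf_eq0 => /eqP.
have [C C0 HC] := symm_op_stable regular.
have w0 : normL2 w = 0.
  apply/eqP; rewrite eq_le normL2_ge0 andbT -(mulr0 (C * n%:R)) -F0.
  by apply: HC => // f fL; rewrite adjE// dot_adjoint_sum.
apply/rowP => k; rewrite mxE.
have := dot_norm0 wL (eL k) w0; rewrite dot_suml// (bigD1 k)//= dot_expik eqxx mulr1n.
rewrite big1 ?addr0 => [/eqP|j jk].
  rewrite mulf_eq0 => /orP[/eqP//|/eqP/(congr1 (@complex.Re R))/= h].
  by exfalso; have := @pi_gt0 R; lra.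
rewrite dot_expik (_ : (_ == _) = false) ?mulr0//.
by apply/eqP => /addIr[jk']; move: jk; rewrite -val_eqE/= jk' eqxx.
Qed.

(** The normal equations have the Gram matrix as their matrix. *)
Lemma best_approximation f : inL2 f -> exists2 phi : R -> R[i], trig_poly n phi &
  forall psi, trig_poly n psi -> dotL2 (f - S' phi) (S' psi) = 0.
Proof.
move=> fL; pose v := (\row_k dotL2 f (s k)) *m invmx gram.
have vG k : \sum_j v 0 j * dotL2 (s j) (s k) = dotL2 f (s k).
  have := congr1 (fun A : 'rV_(n.*2.+1) => A 0 k) (mulmxKV gram_unit (\row_k dotL2 f (s k))).
  rewrite -/v [LHS]mxE [RHS]mxE => vGk.
  by rewrite -[RHS]vGk; apply: eq_bigr => j _; rewrite [gram _ _]mxE.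
pose phi (t : R) := \sum_j v 0 j * e j t.
have pn : trig_poly n phi by exists (fun j => v 0 j).
exists phi => // psi [a ->]; have pL := S'L (trig_poly_inL2 pn).
have FL : inL2 (fun t => \sum_j v 0 j * s j t) by exact: inL2_sum.
have dL := inL2B fL pL.
rewrite dot_adjoint_sum// dot_sumr// big1// => k _.
rewrite dotBl// (dotC (sL k) pL) dot_adjoint_sum// -dotC// dot_suml// vG subrr.
by rewrite mulr0.
Qed.

Variables (g Psi gdelta psi : R -> R[i]) (delta : R).
Hypotheses (gL : inL2 g) (PsiL : inL2 Psi) (SPsi : eqL2 (S Psi) g) (gdL : inL2 gdelta).
Hypotheses (gd : normL2 (gdelta - g) <= delta) (psin : trig_poly n psi).
Hypothesis psiE : forall phi, trig_poly n phi -> dotL2 (S' psi) (S' phi) = dotL2 gdelta phi.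

(** Psi - S^* phi is orthogonal to all S^* chi, whence the minimality, and
    the error splits orthogonally into Psi - S^* phi and h = S^* psi - S^* phi. *)
Lemma dual_least_squares_error (C : R) : 0 <= C ->
  (forall w h, trig_poly n w -> inL2 h -> (forall f, inL2 f -> dotL2 (S f) w = dotL2 f h) ->
     normL2 w <= C * n%:R * normL2 h) ->
  exists2 m : R, is_min [set normL2 (Psi - z) | z in S' @` trig_poly n] m &
    normL2 (Psi - S' psi) <= C * (n%:R * delta) + m.
Proof.
move=> C0 HC; have [phi phin ort] := best_approximation PsiL.
have phiL := trig_poly_inL2 phin; have psiL := trig_poly_inL2 psin.
have zL := S'L phiL; have yL := S'L psiL.
have dL := inL2B PsiL zL.
exists (normL2 (Psi - S' phi)).
  split; first by exists (S' phi) => //; exists phi.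
  move=> _ [_ [chi chin <-] <-]; have chiL := trig_poly_inL2 chin; have cL := S'L chiL.
  have -> : Psi - S' chi = (Psi - S' phi) - (S' chi - S' phi) by rewrite opprB addrA subrK.
  have eL' := inL2B cL zL.
  have o : dotL2 (Psi - S' phi) (S' chi - S' phi) = 0 by rewrite dotBr// !ort// subrr.
  rewrite -(@ler_pXn2r _ 2) ?nnegrE ?normL2_ge0// [leRHS](pythagoras dL eL' o).
  by rewrite lerDl sqr_ge0.
pose h := S' psi - S' phi; pose w := psi - phi.
have hL : inL2 h by exact: inL2B.
have wL : inL2 w by exact: inL2B.
have wn : trig_poly n w.
  have [[a aE] [b bE]] := (psin, phin); exists (fun j => a j - b j).
  by rewrite /w aE bE; apply/funext => t; under [RHS]eq_bigr do rewrite mulrBl; rewrite sumrB.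
have wh : normL2 w <= C * n%:R * normL2 h.
  apply: HC => // f fL; have SfL := SL fL.
  by rewrite (dotBr psiL phiL SfL) (dotBr yL zL fL) !adjE.
(* the difference of the equations that determine psi and phi *)
have hphi chi : trig_poly n chi -> dotL2 h (S' chi) = dotL2 (gdelta - g) chi.
  move=> chin; have chiL := trig_poly_inL2 chin; have cL := S'L chiL.
  rewrite !dotBl// psiE//; congr (_ - _).
  rewrite -(eqL2_dot (SL PsiL) gL chiL SPsi) adjE//.
  by have := ort chi chin; rewrite dotBl// => /eqP; rewrite subr_eq0 => /eqP ->.
have hh : normL2 h ^+ 2 <= delta * (C * n%:R) * normL2 h.
  have : complex.Re (dotL2 h h) = complex.Re (dotL2 (gdelta - g) w).
    by congr complex.Re; rewrite {2}/h dotBr// !hphi// dotBr//; exact: inL2B.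
  rewrite dot_norm//= => ->.
  have gdgL := inL2B gdL gL.
  apply: (le_trans (Re_dot_le gdgL wL)); rewrite -mulrA.
  by apply: ler_pM => //; exact: normL2_ge0.
have hn : normL2 h <= C * (n%:R * delta).
  have [h0|h0] := eqVneq (normL2 h) 0.
    rewrite h0 !mulr_ge0//; apply: le_trans gd; exact: normL2_ge0.
  have hp : 0 < normL2 h by rewrite lt_neqAle eq_sym h0 normL2_ge0.
  by rewrite mulrA mulrC -(ler_pM2r hp) -expr2.
have E : Psi - S' psi = (Psi - S' phi) - h by rewrite /h opprB addrA subrK.
have m0 := normL2_ge0 (Psi - S' phi).
apply: (@le_trans _ _ (normL2 h + normL2 (Psi - S' phi))); last by rewrite lerD2r.
have o : dotL2 (Psi - S' phi) h = 0 by rewrite /h dotBr// !ort// subrr.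
rewrite E -(@ler_pXn2r _ 2) ?nnegrE ?addr_ge0 ?normL2_ge0// (pythagoras dL hL o).
have := mulr_ge0 (normL2_ge0 h) m0; rewrite sqrrD.
move: (normL2 h) (normL2 _) => u v; lra.
Qed.

End dual_least_squares.

Theorem mainTheorem4 (R : realType) (Omega : set (R * R)) (gamma : R -> R * R)
    (S0adj : (R -> R[i]) -> (R -> R[i])) (r : R) :
  domain Omega -> bounded_set Omega -> simply_connected Omega ->
  regular_analytic_curve gamma ->
  boundary Omega = gamma @` `[0, 2 * pi[%classic ->
  adjointL2 (symm_op gamma) S0adj ->
  0 <= r ->
  exists2 c : R, 0 < c &
  forall (g Psi : R -> R[i]) (delta : R) (gdelta : R -> R[i]) (n : nat)
    (psi : R -> R[i]),
    sobolev (r + 1) g ->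
    sobolev r Psi -> eqL2 (symm_op gamma Psi) g ->
    0 <= delta -> inL2 gdelta -> normL2 (gdelta - g) <= delta ->
    (1 <= n)%N ->
    trig_poly n psi ->
    (forall phi, trig_poly n phi ->
       dotL2 (S0adj psi) (S0adj phi) = dotL2 gdelta phi) ->
  exists2 m : R,
    is_min [set normL2 (Psi - z) | z in S0adj @` trig_poly n] m &
    normL2 (Psi - S0adj psi) <= c * (n%:R * delta + m).
Proof.
move=> _ _ _ regular _ adj _.
have [C C0 HC] := symm_op_stable regular.
exists (C + 1) => [|g Psi delta gdelta n psi [gL _] [PsiL _] SPsi d0 gdL gd n0 psin psiE].
  by rewrite ltr_wpDl.
have [m [mA mB] H] := dual_least_squares_error regular adj n0 gL PsiL SPsi gdL gd psin psiE C0
  (fun w h => HC n w h n0).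
exists m => //; apply: (le_trans H).
have m0 : 0 <= m by move: mA => [z _ <-]; exact: normL2_ge0.
have nd : 0 <= n%:R * delta by rewrite mulr_ge0.
have := mulr_ge0 C0 m0; lra.
Qed.
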